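(* Let $E$ be a functor from the category of locally convex algebras to the category of abelian groups. If $E$ is split exact, $M_2$-stable and weakly $\mathcal J$-stable for some harmonic Banach ideal $\mathcal J$, then $E$ is diffotopy invariant.
   Context: **Locally convex algebras.** A locally convex algebra is an algebra over $\mathbb C$ (not necessarily unital) with a complete locally convex topology for which multiplication is jointly continuous. Homomorphisms are continuous. $\hat\otimes$ is the completed projective tensor product. $M_2$ is the algebra of complex $2\times 2$ matrices. **Function algebras.** $\mathbb C[0,1]$ is the Fréchet algebra of $C^\infty$-functions on $[0,1]$ all of whose derivatives (of order $\ge 1$) vanish at $0$ and $1$; $A[0,1]=A\hat\otimes\mathbb C[0,1]$, and $\mathrm{ev}_t:A[0,1]\to A$ is evaluation at $t$. **Extensions.** A sequence $0\to I\to A\to B\to 0$ of locally convex algebras is an extension if it is split as a sequence of locally convex vector spaces (the middle term is the topological direct sum of kernel and cokernel). It is a split extension if there is a continuous splitting $B\to A$ that is a homomorphism. **Properties of a functor $E$.** - $E$ is split exact if for every split extension $0\to I\to A\to B\to 0$ the sequence $0\to E(I)\to E(A)\to E(B)\to0$ is exact. - $E$ is $M_2$-stable if for every locally convex algebra $A$ the upper-left-corner inclusion $A\to A\hat\otimes M_2$ induces an isomorphism under $E$. - $E$ is diffotopy invariant if for every $A$ the maps $E(\mathrm{ev}_t):E(A[0,1])\to E(A)$ coincide for all $t\in[0,1]$. - $E$ is weakly $\mathcal J$-stable ($\mathcal J$ a Banach ideal) if there is a natural map $E(A\hat\otimes\mathcal J)\to E(A)$ such that for each $A$ the composition $E(A)\to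 E(A\hat\otimes \mathcal J)\to E(A)$ with the map induced by $a\mapsto a\otimes p$, $p$ a minimal idempotent in $\mathcal J$, is the identity. **Banach ideals.** A (symmetrically normed, multiplicative) Banach ideal $\mathcal J$ assigns to each infinite-dimensional separable Hilbert space $H$ a normed ideal $\mathcal J(H)$ in $\mathcal B(H)$ such that: the norm $\|\cdot\|_{\mathcal J}$ is complete; $\|ABC\|_{\mathcal J}\le\|A\|\,\|B\|_{\mathcal J}\,\|C\|$ for $A,C\in\mathcal B(H)$, $B\in\mathcal J(H)$; there is a natural continuous homomorphism $\mathcal J(H)\hat\otimes\mathcal J(H)\to\mathcal J(H\otimes H)$ compatible with $\mathcal B(H)\hat\otimes\mathcal B(H)\to\mathcal B(H\otimes H)$; and $H\mapsto\mathcal J(H)$ is functorial under unitary transformations. One writes $\mathcal J$ for $\mathcal J(H)$. $\mathcal J$ is harmonic if $\mathcal J(H)$ contains a compact operator whose singular values are $1,\frac12,\frac13,\dots$ (for one, hence every, $H$). *)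

(* Defs.v *)
From HB Require Import structures.
From mathcomp Require Import all_boot all_order all_algebra.
From mathcomp Require Import complex ring.
From mathcomp Require Import all_classical all_reals all_analysis.

Set Implicit Arguments.
Unset Strict Implicit.
Unset Printing Implicit Defensive.

Import Order.TTheory GRing.Theory Num.Theory.
Import numFieldNormedType.Exports.

Local Open Scope classical_set_scope.
Local Open Scope ring_scope.
Local Open Scope complex_scope.

Section LocallyConvexAlgebras.
Variable R : realType.
Local Notation C := R[i].

(* [tvsType C] is a locally convex space over C. Its class carries a uniform
   structure that is only required to induce the topology, so completeness is
   stated for the translation-invariant uniformity of the vector space rather
   than through [cauchy]. *)
Definition tvs_complete (V : tvsType C) : Prop :=
  forall F : set_system V, ProperFilter F ->
    (forall U : set V, nbhs 0 U ->
       exists2 A, F A & forall x y, A x -> A y -> U (x - y)) ->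
    exists l : V, F --> l.

Record lcs := Lcs {
  lcs_sort :> tvsType C;
  lcs_hausdorff : hausdorff_space lcs_sort;
  lcs_complete : tvs_complete lcs_sort }.

Definition cont_linear (V W : lcs) (f : V -> W) : Prop :=
  linear f /\ continuous f.

Definition cont_bilinear (V W X : lcs) (b : V -> W -> X) : Prop :=
  [/\ forall v, linear (b v),
      forall w, linear (b^~ w) &
      continuous (fun z : V * W => b z.1 z.2)].

(* no unit is required *)
Record lcAlg := LcAlg {
  lca_lcs :> lcs;
  lca_mul : lca_lcs -> lca_lcs -> lca_lcs;
  lca_mul_bilinear : cont_bilinear lca_mul;
  lca_mulA : associative lca_mul }.

Record lcHom (A B : lcAlg) := LcHom {
  hom_fun :> A -> B;
  hom_linear : cont_linear hom_fun;
  hom_mul : {morph hom_fun : x y / lca_mul x y >-> lca_mul x y} }.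

Lemma lcHom_id_subproof (A : lcAlg) : cont_linear (@id A).
Proof. by split=> // x; exact: cvg_id. Qed.

Definition lcHom_id (A : lcAlg) : lcHom A A :=
  LcHom (lcHom_id_subproof A) (fun _ _ => erefl).

Lemma cont_linear_comp (V W X : lcs) (g : W -> X) (f : V -> W) :
  cont_linear g -> cont_linear f -> cont_linear (g \o f).
Proof.
move=> [lg cg] [lf cf]; split; first by move=> a x y /=; rewrite lf lg.
by move=> x; apply: continuous_comp; [exact: cf|exact: cg].
Qed.

Lemma lcHom_comp_subproof (A B D : lcAlg) (g : lcHom B D) (f : lcHom A B) :
  {morph g \o f : x y / lca_mul x y >-> lca_mul x y}.
Proof. by move=> x y /=; rewrite !hom_mul. Qed.

Definition lcHom_comp (A B D : lcAlg) (g : lcHom B D) (f : lcHom A B) :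
    lcHom A D :=
  LcHom (cont_linear_comp (hom_linear g) (hom_linear f))
        (lcHom_comp_subproof g f).

Record lcFunctor := LcFunctor {
  fob :> lcAlg -> zmodType;
  fmap : forall A B : lcAlg, lcHom A B -> {additive fob A -> fob B};
  fmap_id : forall (A : lcAlg) (x : fob A), fmap (lcHom_id A) x = x;
  fmap_comp : forall (A B D : lcAlg) (g : lcHom B D) (f : lcHom A B) (x : fob A),
    fmap (lcHom_comp g f) x = fmap g (fmap f x) }.

Definition short_exact (G H K : zmodType) (i : G -> H) (p : H -> K) : Prop :=
  [/\ injective i,
      forall x, p x = 0 <-> exists y, i y = x &
      forall z, exists x, p x = z].

(* In the last clause, (r, p) identifies A with the topological direct sum of
   I and B, the inverse being i + s. *)
Definition extension (I A B : lcAlg) (i : lcHom I A) (p : lcHom A B) : Prop :=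
  short_exact i p /\
  exists (r : A -> I) (s : B -> A),
    [/\ cont_linear r, cont_linear s, cancel i r, cancel s p &
        forall a, i (r a) + s (p a) = a].

Definition split_extension (I A B : lcAlg) (i : lcHom I A) (p : lcHom A B) :
    Prop :=
  extension i p /\ exists s : lcHom B A, cancel s p.

(* The completed projective tensor product, as the complete locally convex
   space representing continuous bilinear maps; it is unique up to a unique
   isomorphism. *)
Definition is_ptensor (V W T : lcs) (t : V -> W -> T) : Prop :=
  cont_bilinear t /\
  forall (X : lcs) (b : V -> W -> X), cont_bilinear b ->
    exists2 f : T -> X,
      cont_linear f /\ (forall v w, f (t v w) = b v w) &
      forall g : T -> X, cont_linear g -> (forall v w, g (t v w) = b v w) ->
        g = f.

(* A model of the algebra A (x)^ B; the universal property determines it up to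
   isomorphism, and the properties of functors below are stated for every
   model. *)
Record ptensor (A B : lcAlg) := PTensor {
  pt_alg :> lcAlg;
  pt_tens : A -> B -> pt_alg;
  pt_univ : is_ptensor pt_tens;
  pt_mul : forall a a' b b',
    lca_mul (pt_tens a b) (pt_tens a' b') =
    pt_tens (lca_mul a a') (lca_mul b b') }.


Lemma ptensor_ext (V W T X : lcs) (t : V -> W -> T) (f g : T -> X) :
  is_ptensor t -> cont_linear f -> cont_linear g ->
  (forall v w, f (t v w) = g (t v w)) -> f = g.
Proof.
move=> [[t1 t2 ct] ut] [lf cf] lg fg.
have bf : cont_bilinear (fun v w => f (t v w)).
  split; [by move=> v a x y; rewrite t1 lf|by move=> w a x y; rewrite /= t2 lf|].
  move=> z; apply: (@continuous_comp _ _ _ (fun z : V * W => t z.1 z.2) f).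
    exact: ct.
  exact: cf.
have [h _ uh] := ut X _ bf.
by rewrite (uh f)// (uh g).
Qed.

Lemma lca_mull_cont (A : lcAlg) (a : A) : cont_linear (lca_mul a).
Proof.
have [l1 l2 c] := lca_mul_bilinear A; split; first exact: l1.
move=> x; apply: (@continuous_comp _ (A * A)%type _ (fun x => (a, x))
  (fun z => lca_mul z.1 z.2)); last exact: c.
by apply: cvg_pair; [exact: cvg_cst|exact: cvg_id].
Qed.

Lemma lca_mulr_cont (A : lcAlg) (a : A) : cont_linear (@lca_mul A ^~ a).
Proof.
have [l1 l2 c] := lca_mul_bilinear A; split; first exact: l2.
move=> x; apply: (@continuous_comp _ (A * A)%type _ (fun x => (x, a))
  (fun z => lca_mul z.1 z.2)); last exact: c.
by apply: cvg_pair; [exact: cvg_id|exact: cvg_cst].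
Qed.

Section PTensorLift.
Variables (A B D : lcAlg) (T : ptensor A B) (b : A -> B -> D).
Hypothesis b_bilinear : cont_bilinear b.
Hypothesis b_mul : forall x x' y y',
  b (lca_mul x x') (lca_mul y y') = lca_mul (b x y) (b x' y').

Definition ptensor_lift_fun : T -> D :=
  sval (cid2 ((pt_univ T).2 D b b_bilinear)).

Lemma ptensor_lift_linear : cont_linear ptensor_lift_fun.
Proof. by rewrite /ptensor_lift_fun; case: cid2 => f /= []. Qed.

Lemma ptensor_liftE x y : ptensor_lift_fun (pt_tens T x y) = b x y.
Proof. by rewrite /ptensor_lift_fun; case: cid2 => f /= []. Qed.

Lemma ptensor_lift_mul :
  {morph ptensor_lift_fun : u v / lca_mul u v >-> lca_mul u v}.
Proof.
have L := ptensor_lift_linear; have U := pt_univ T.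
have step x y : ptensor_lift_fun \o lca_mul (pt_tens T x y) =
    lca_mul (b x y) \o ptensor_lift_fun.
  apply: (ptensor_ext U).
  - by apply: cont_linear_comp => //; exact: lca_mull_cont.
  - by apply: cont_linear_comp => //; exact: lca_mull_cont.
  by move=> x' y' /=; rewrite pt_mul !ptensor_liftE.
move=> u v.
suff: ptensor_lift_fun \o (@lca_mul T ^~ v) =
    (@lca_mul D ^~ (ptensor_lift_fun v)) \o ptensor_lift_fun.
  by move=> /(congr1 (@^~ u)).
apply: (ptensor_ext U).
- by apply: cont_linear_comp => //; exact: lca_mulr_cont.
- by apply: cont_linear_comp => //; exact: lca_mulr_cont.
move=> x y /=; rewrite ptensor_liftE.
by move: (step x y) => /(congr1 (@^~ v)).
Qed.

Definition ptensor_lift : lcHom T D :=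
  LcHom ptensor_lift_linear ptensor_lift_mul.

End PTensorLift.

Section PTensorMap.
Variables (A A' B B' : lcAlg) (T : ptensor A B) (T' : ptensor A' B').
Variables (f : lcHom A A') (g : lcHom B B').

Lemma ptensor_map_bilinear : cont_bilinear (fun x y => pt_tens T' (f x) (g y)).
Proof.
have [t1 t2 ct] := (pt_univ T').1.
have [lf cf] := hom_linear f; have [lg cg] := hom_linear g; split.
- by move=> v a x y; rewrite lg t1.
- by move=> w a x y; rewrite /= lf t2.
move=> z; apply: (@continuous_comp _ (A' * B')%type _
  (fun z : A * B => (f z.1, g z.2)) (fun z => pt_tens T' z.1 z.2)).
  apply: cvg_pair.
    by apply: continuous_comp; [exact: cvg_fst|exact: cf].
  by apply: continuous_comp; [exact: cvg_snd|exact: cg].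
exact: ct.
Qed.

Lemma ptensor_map_mul x x' y y' :
  pt_tens T' (f (lca_mul x x')) (g (lca_mul y y')) =
  lca_mul (pt_tens T' (f x) (g y)) (pt_tens T' (f x') (g y')).
Proof. by rewrite !hom_mul pt_mul. Qed.

Definition ptensor_map : lcHom T T' :=
  ptensor_lift T ptensor_map_bilinear ptensor_map_mul.

End PTensorMap.

Section PTensorIdem.
Variables (A B : lcAlg) (T : ptensor A B) (p : B) (pp : lca_mul p p = p).

Lemma tens_idem_linear : cont_linear (fun a => pt_tens T a p).
Proof.
have [t1 t2 ct] := (pt_univ T).1; split; first exact: t2.
move=> x; apply: (@continuous_comp _ (A * B)%type _ (fun x => (x, p))
  (fun z => pt_tens T z.1 z.2)); last exact: ct.
by apply: cvg_pair; [exact: cvg_id|exact: cvg_cst].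
Qed.

Lemma tens_idem_mul :
  {morph (fun a => pt_tens T a p) : x y / lca_mul x y >-> lca_mul x y}.
Proof. by move=> x y; rewrite pt_mul pp. Qed.

Definition tens_idem : lcHom A T := LcHom tens_idem_linear tens_idem_mul.

End PTensorIdem.

(* Banach algebras; the continuity of the product is with respect to the norm
   topology. *)
Record banachAlg := BanachAlg {
  ba_sort :> completeNormedModType C;
  ba_mul : ba_sort -> ba_sort -> ba_sort;
  ba_mull : forall x, linear (ba_mul x);
  ba_mulr : forall y, linear (ba_mul^~ y);
  ba_mul_cont : continuous (fun z : ba_sort * ba_sort => ba_mul z.1 z.2);
  ba_mulA : associative ba_mul }.

Lemma normed_complete (V : completeNormedModType C) : tvs_complete V.
Proof.
move=> F FF cF; apply/cvg_ex; apply: cauchy_cvg.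
apply/cauchy_ballP => _/posnumP[e].
have [|A FA Ae] := cF (ball (0 : V) e%:num); first exact: nbhsx_ballx.
exists (A, A) => //= -[x y] /= [Ax Ay].
rewrite -ball_normE /= distrC -[y - x]subr0 distrC.
by have := Ae _ _ Ay Ax; rewrite -ball_normE.
Qed.

Definition lcs_of_normed (V : completeNormedModType C) : lcs :=
  Lcs (@norm_hausdorff C V) (@normed_complete V).

Definition lcAlg_of_banach (B : banachAlg) : lcAlg :=
  @LcAlg (lcs_of_normed B) (@ba_mul B)
    (And3 (@ba_mull B) (@ba_mulr B) (@ba_mul_cont B)) (@ba_mulA B).

Record hilbert := Hilbert {
  hs :> completeNormedModType C;
  ip : hs -> hs -> C;
  ip_linear : forall (a : C) x y z, ip (a *: x + y) z = a * ip x z + ip y z;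
  ip_conj : forall x y, ip y x = (ip x y)^*;
  ip_norm : forall x, ip x x = `|x| ^+ 2 }.

Definition separable_space (T : topologicalType) : Prop :=
  exists2 D : set T, countable D & dense D.

Definition infinite_dim (V : lmodType C) : Prop :=
  forall n (v : 'I_n -> V), exists x,
    forall c : 'I_n -> C, x <> \sum_i c i *: v i.

Record sepHilbert := SepHilbert {
  sh :> hilbert;
  sh_separable : separable_space sh;
  sh_infinite_dim : infinite_dim sh }.

Definition bounded_op (V W : normedModType C) (S : V -> W) : Prop :=
  linear S /\ continuous S.

Definition op_norm (V W : normedModType C) (S : V -> W) : R :=
  sup [set complex.Re `|S x| | x in [set x | `|x| <= 1]].

Definition unitary (H K : hilbert) (U : H -> K) : Prop :=
  [/\ linear U, forall x y, ip (U x) (U y) = ip x y & forall z, exists x, U x = z].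

Definition hilbert_tensor (H H' K : hilbert) (t : H -> H' -> K) : Prop :=
  [/\ forall x, linear (t x), forall y, linear (t^~ y),
      forall x x' y y', ip (t x y) (t x' y') = ip x x' * ip y y' &
      dense [set z | exists n (x : 'I_n -> H) (y : 'I_n -> H'),
        z = \sum_i t (x i) (y i)]].

(* The ideal J(H) of B(H) is presented as a Banach algebra for the norm of J
   together with its embedding [bi_op] into the bounded operators. The
   continuity of the product in [banachAlg] follows from the norm inequality
   of [bi_ideal]. The maps in [bi_tensor] and [bi_unitary] are determined by
   the operators they induce, hence their naturality and functoriality are
   automatic. *)
Record banachIdeal := BanachIdeal {
  bi_alg :> sepHilbert -> banachAlg;
  bi_op : forall H : sepHilbert, bi_alg H -> H -> H;
  bi_bounded : forall (H : sepHilbert) (a : bi_alg H), bounded_op (bi_op a);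
  bi_inj : forall H, injective (@bi_op H);
  bi_linear : forall H (c : C) (a b : bi_alg H) x,
    bi_op (c *: a + b) x = c *: bi_op a x + bi_op b x;
  bi_mul : forall H (a b : bi_alg H) x,
    bi_op (ba_mul a b) x = bi_op a (bi_op b x);
  bi_ideal : forall (H : sepHilbert) (S T : H -> H) (a : bi_alg H),
    bounded_op S -> bounded_op T ->
    exists2 b : bi_alg H, bi_op b = S \o bi_op a \o T &
      `|b| <= (op_norm S)%:C * `|a| * (op_norm T)%:C;
  bi_tensor : forall (H K : sepHilbert) (t : H -> H -> K)
      (T : ptensor (lcAlg_of_banach (bi_alg H)) (lcAlg_of_banach (bi_alg H))),
    hilbert_tensor t ->
    exists m : lcHom T (lcAlg_of_banach (bi_alg K)),
      forall (a b : lcAlg_of_banach (bi_alg H)) x y,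
        bi_op (m (pt_tens T a b)) (t x y) = t (bi_op a x) (bi_op b y);
  bi_unitary : forall (H K : sepHilbert) (U : H -> K), unitary U ->
    exists f : lcHom (lcAlg_of_banach (bi_alg H)) (lcAlg_of_banach (bi_alg K)),
      forall a x, bi_op (f a) (U x) = U (bi_op a x) }.

Definition ideal_alg (J : banachIdeal) (H : sepHilbert) : lcAlg :=
  lcAlg_of_banach (J H).

Definition compact_op (H : hilbert) (S : H -> H) : Prop :=
  bounded_op S /\ compact (closure (S @` [set x | `|x| <= 1])).

Definition is_adjoint (H : hilbert) (S S' : H -> H) : Prop :=
  forall x y, ip (S x) y = ip x (S' y).

(* [s] enumerates, with multiplicity, the nonzero singular values of S, that is
   the square roots of the nonzero eigenvalues of S^* S: the [e n] are
   orthonormal eigenvectors, and no further eigenvector is orthogonal to all of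
   them. *)
Definition singular_values (H : hilbert) (S : H -> H) (s : nat -> R) : Prop :=
  [/\ forall n, 0 < s n, nonincreasing_seq s &
      exists S' : H -> H, is_adjoint S S' /\
      exists e : nat -> H,
      [/\ forall m n, ip (e m) (e n) = (m == n)%:R,
          forall n, S' (S (e n)) = (s n ^+ 2)%:C *: e n &
          forall (l : C) v, l != 0 -> S' (S v) = l *: v ->
            (forall n, ip v (e n) = 0) -> v = 0]].

Definition harmonic_ideal (J : banachIdeal) : Prop :=
  exists (H : sepHilbert) (a : J H),
    compact_op (bi_op a) /\ singular_values (bi_op a) (fun n => n.+1%:R^-1).

Definition minimal_idempotent (B : lcAlg) (p : B) : Prop :=
  [/\ p <> 0, lca_mul p p = p &
      forall q : B, q <> 0 -> lca_mul q q = q ->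
        lca_mul p q = q -> lca_mul q p = q -> q = p].

Definition split_exact (E : lcFunctor) : Prop :=
  forall (I A B : lcAlg) (i : lcHom I A) (p : lcHom A B),
    split_extension i p -> short_exact (fmap E i) (fmap E p).

Definition weakly_stable (J : banachIdeal) (E : lcFunctor) : Prop :=
  exists (H : sepHilbert) (p : ideal_alg J H) (pp : lca_mul p p = p)
    (phi : forall (A : lcAlg) (T : ptensor A (ideal_alg J H)),
       {additive E T -> E A}),
  [/\ minimal_idempotent p,
      forall (A A' : lcAlg) (f : lcHom A A')
        (T : ptensor A (ideal_alg J H)) (T' : ptensor A' (ideal_alg J H)) x,
        phi A' T' (fmap E (ptensor_map T T' f (lcHom_id _)) x) =
        fmap E f (phi A T x) &
      forall (A : lcAlg) (T : ptensor A (ideal_alg J H)) x,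
        phi A T (fmap E (tens_idem T pp) x) = x].

End LocallyConvexAlgebras.

Section FunctionAlgebras.
Variable R : realType.
Local Notation C := R[i].

Section ComplexComplete.
Local Notation nm := (@ComplexField.Normc.normc R).

Lemma cnormE (z : C) : `|z| = (nm z)%:C.
Proof. by case: z. Qed.

Lemma nm_ge0 (z : C) : 0 <= nm z.
Proof. by case: z => a b /=; rewrite sqrtr_ge0. Qed.

Lemma nmD (x y : C) : nm (x + y) <= nm x + nm y.
Proof. exact: le_normcD. Qed.

Lemma nmN (x : C) : nm (- x) = nm x.
Proof. exact: normcN. Qed.

Lemma nmB (x y : C) : nm (x - y) = nm (y - x).
Proof. by rewrite -nmN opprB. Qed.

Lemma nmM (x y : C) : nm (x * y) = nm x * nm y.
Proof. exact: ComplexField.Normc.normcM. Qed.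

Lemma nm_real (r : R) : nm r%:C = `|r|.
Proof. by rewrite /= expr0n /= addr0 sqrtr_sqr. Qed.

Lemma nm0 : nm 0 = 0.
Proof. exact: ComplexField.Normc.normc0. Qed.

Lemma nm_Re (z : C) : `|complex.Re z| <= nm z.
Proof. by case: z => a b /=; rewrite -sqrtr_sqr ler_wsqrtr // lerDl sqr_ge0. Qed.

Lemma nm_Im (z : C) : `|complex.Im z| <= nm z.
Proof. by case: z => a b /=; rewrite -sqrtr_sqr ler_wsqrtr // lerDr sqr_ge0. Qed.

Lemma nm_le (z : C) : nm z <= `|complex.Re z| + `|complex.Im z|.
Proof.
case: z => a b; rewrite [X in nm X](_ : _ = a%:C + b%:C * 'i%C).
  apply: (le_trans (nmD _ _)); rewrite nmM !nm_real.
  by rewrite /= expr0n expr1n add0r sqrtr1 mulr1.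
by simpc.
Qed.

Lemma ltcnm (z : C) (e : R) : (`|z| < e%:C) = (nm z < e).
Proof. by rewrite cnormE ltcR. Qed.

Lemma complex_cauchy_cvg (F : set_system C^o) :
  ProperFilter F -> cauchy F -> cvg F.
Proof.
move=> FF /cauchy_ballP Fc.
have key (u : C -> R) : (forall x y, `|u x - u y| <= nm (x - y)) ->
    cvg (u @ F).
  move=> ub; apply: cauchy_cvg; apply/cauchy_ballP => _/posnumP[e].
  have [|[A B] [FA FB] AB] := Fc e%:num%:C; first by rewrite ltcR.
  exists (u @` A, u @` B).
    by split; [apply: filterS FA|apply: filterS FB] => x Ax; exists x.
  move=> -[_ _] /= [[x Ax <-] [y By <-]]; rewrite -ball_normE /=.
  apply: (le_lt_trans (ub _ _)); rewrite -ltcnm.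
  by have := AB (x, y) (conj Ax By); rewrite -ball_normE.
have /cvg_ex[a Fa] : cvg ((@complex.Re R : C -> R) @ F).
  by apply: key => -[x1 x2] [y1 y2]; exact: (nm_Re ((x1 +i* x2) - (y1 +i* y2))).
have /cvg_ex[b Fb] : cvg ((@complex.Im R : C -> R) @ F).
  by apply: key => -[x1 x2] [y1 y2]; exact: (nm_Im ((x1 +i* x2) - (y1 +i* y2))).
apply/cvg_ex; exists (a +i* b : C^o); apply/cvgrPdist_lt => e e0.
have e2 : 0 < complex.Re e / 2.
  by case: e e0 => e1 e2; rewrite ltcE /= => /andP[_ h]; rewrite divr_gt0.
have eE : e = (complex.Re e)%:C.
  by case: e e0 {e2} => e1 e2; rewrite ltcE /= => /andP[/eqP -> _].
have Rsub z : complex.Re ((a +i* b) - z) = a - complex.Re z by case: z.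
have Isub z : complex.Im ((a +i* b) - z) = b - complex.Im z by case: z.
near=> z; rewrite eE ltcnm; apply: (le_lt_trans (nm_le _)).
rewrite [ltRHS]splitr Rsub Isub; apply: ltrD; near: z.
  by move/cvgrPdist_lt : Fa; exact.
by move/cvgrPdist_lt : Fb; exact.
Unshelve. all: by end_near. Qed.

Lemma mx_near (m n : nat) (T : Type) (F : set_system T) (FF : Filter F)
    (P : 'I_m -> 'I_n -> T -> Prop) :
  (forall i j, \forall x \near F, P i j x) ->
  \forall x \near F, forall i j, P i j x.
Proof.
by move=> h; apply: filter_forall => i; apply: filter_forall => j.
Qed.

Lemma mx_cvg (m n : nat) (T : Type) (F : set_system T) (FF : Filter F)
    (f : T -> 'M[C^o]_(m, n)) (l : 'M[C^o]_(m, n)) :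
  (forall i j, (fun x => f x i j : C^o) @ F --> (l i j : C^o)) -> f @ F --> l.
Proof.
move=> h; apply/cvg_ballP => e e0.
apply: (@filterS _ F _ (fun x => forall i j, `|l i j - f x i j| < e)).
  by move=> x hx; split=> // i j; exact: hx.
by apply: mx_near => i j; move/cvgrPdist_lt : (h i j); exact.
Qed.

Lemma mx2_complete : tvs_complete 'M[C^o]_2.
Proof.
move=> F FF Fc.
have ex i j : exists l : C^o, (fun M : 'M[C^o]_2 => M i j : C^o) @ F --> l.
  apply/cvg_ex; apply: complex_cauchy_cvg; apply/cauchy_ballP => e e0.
  have [|A FA hA] := Fc (ball (0 : 'M[C^o]_2) e); first exact: nbhsx_ballx.
  pose B := (fun M : 'M[C^o]_2 => M i j : C^o) @` A.
  have FB : ((fun M : 'M[C^o]_2 => M i j : C^o) @ F) B.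
    apply: (@filterS _ F _ A) FA => M AM; by exists M.
  exists (B, B) => //= -[_ _] /= [[M AM <-] [N AN <-]].
  have [_ /(_ i j)] := hA _ _ AN AM.
  by rewrite -!ball_normE /= !mxE sub0r normrN distrC.
exists (\matrix_(i, j) sval (cid (ex i j))).
apply: (@mx_cvg 2 2 _ F _ id) => i j; rewrite mxE.
by case: (cid (ex i j)).
Qed.

Definition M2_lcs : lcs R := Lcs (@norm_hausdorff C 'M[C^o]_2) mx2_complete.

Lemma M2_mul_bilinear :
  cont_bilinear (fun A B : M2_lcs => (A : 'M[C^o]_2) *m B : M2_lcs).
Proof.
split.
- by move=> A a x y; rewrite mulmxDr -scalemxAr.
- by move=> B a x y; rewrite /= mulmxDl -scalemxAl.
move=> z; apply: (@mx_cvg 2 2 _ (nbhs z) (nbhs_filter z)) => i j.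
rewrite /= !mxE.
under eq_cvg do rewrite mxE.
apply: cvg_big => [|k _]; first exact: add_continuous.
apply: cvgM.
  apply: (@cvg_comp _ _ _ fst (fun M : 'M[C^o]_2 => M i k : C^o) (nbhs z)
    (nbhs z.1)); first exact: cvg_fst.
  exact: coord_continuous.
apply: (@cvg_comp _ _ _ snd (fun M : 'M[C^o]_2 => M k j : C^o) (nbhs z)
  (nbhs z.2)); first exact: cvg_snd.
exact: coord_continuous.
Qed.

Definition M2 : lcAlg R := LcAlg M2_mul_bilinear (@mulmxA C 2 2 2 2).

Definition M2_e11 : M2 := delta_mx 0 0 : 'M[C^o]_2.

Lemma M2_e11_idem : lca_mul M2_e11 M2_e11 = M2_e11.
Proof. exact: mul_delta_mx. Qed.

End ComplexComplete.

Section SmoothFunctions.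
Local Notation nm := (@ComplexField.Normc.normc R).
Local Notation I01 := (set_type `[0 : R, 1]).
Implicit Types (f g h : I01 -> C^o) (x y t : I01).

Definition diff_quot f x y : C^o := ((\val y - \val x)^-1)%:C * (f y - f x).

Definition derivable01 f : Prop := forall x, cvg (diff_quot f x y @[y --> x^']).

Definition der01 f : I01 -> C^o := fun x => lim (diff_quot f x y @[y --> x^']).

Definition I01_0 : I01.
Proof. by exists 0; rewrite inE /= in_itv /= lexx ler01. Defined.

Definition I01_1 : I01.
Proof. by exists 1; rewrite inE /= in_itv /= lexx ler01. Defined.

(* The difference quotients range over points of [0,1] only, so the derivatives
   at 0 and 1 are one-sided. *)
Definition flat_smooth f : Prop :=
  (forall n, derivable01 (iter n der01 f)) /\
  (forall n, iter n.+1 der01 f I01_0 = 0 /\ iter n.+1 der01 f I01_1 = 0).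

Definition has_der f x (l : C) : Prop :=
  forall e : R, 0 < e -> exists2 d : R, 0 < d & forall y,
    `|\val y - \val x| < d ->
    nm (f y - f x - (\val y - \val x)%:C * l) <= e * `|\val y - \val x|.

Lemma I01_bd x : 0 <= \val x <= 1.
Proof. by case: x => x /=; rewrite inE /= in_itv. Qed.

Lemma I01_dnbhsP x (P : set I01) :
  x^' P <-> exists2 d : R, 0 < d &
    forall y, `|\val y - \val x| < d -> y != x -> P y.
Proof.
rewrite /dnbhs /within /=; split.
  move=> /nbhs_ballP[d /= d0 dP]; exists d => // y yx; apply: dP.
  by rewrite distrC in yx.
move=> [d d0 dP]; apply/nbhs_ballP; exists d => //= y yx; apply: dP.
have {}yx : `|\val x - \val y| < d by [].
by rewrite distrC.
Qed.

Lemma has_derP f x (l : C^o) :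
  (diff_quot f x y @[y --> x^'] --> l) <-> has_der f x l.
Proof.
have E y : y != x ->
    nm (f y - f x - (\val y - \val x)%:C * l) =
    nm (l - diff_quot f x y) * `|\val y - \val x|.
  move=> yx; rewrite nmB -nm_real -nmM; congr nm.
  have yx0 : (\val y - \val x)%:C != 0 :> C.
    by rewrite fmorph_eq0 subr_eq0 (inj_eq val_inj).
  rewrite /diff_quot mulrBl [in RHS]mulrC fmorphV mulrAC.
  by rewrite mulVf// mul1r.
split.
  move=> /cvgrPdist_lt h e e0.
  have /I01_dnbhsP[d d0 dP] : \forall y \near x^', `|l - diff_quot f x y| < e%:C.
    by apply: h; rewrite ltcR.
  exists d => // y yd; have [->|yx] := eqVneq y x.
    by rewrite !subrr mul0r subrr nm0 normr0 mulr0.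
  by rewrite E// ler_wpM2r// ltW// -ltcnm dP.
move=> h; apply/cvgrPdist_lt => e e0.
have e1 : 0 < complex.Re e.
  by case: e e0 => e1 e2; rewrite ltcE /= => /andP[_].
have eE : e = (complex.Re e)%:C.
  by case: e e0 {e1} => e1 e2; rewrite ltcE /= => /andP[/eqP -> _].
have [d d0 dP] := h _ (divr_gt0 e1 (ltr0Sn _ 1)).
apply/I01_dnbhsP; exists d => // y /dP + yx; rewrite E//.
have yx0 : 0 < `|\val y - \val x|.
  by rewrite normr_gt0 subr_eq0 (inj_eq val_inj).
rewrite ler_pM2r// eE ltcnm => /le_lt_trans -> //.
by rewrite gtr_pMr// invf_lt1// ltr1n.
Qed.

Lemma I01_proper x : ProperFilter (x^').
Proof.
have FF : Filter (x^') := dnbhs_filter x.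
apply: Build_ProperFilter_ex.
move=> P /I01_dnbhsP[d d0 dP].
have /andP[x0 x1] := I01_bd x.
pose m := Num.min (d / 2) (1 / 2).
have m0 : 0 < m by rewrite lt_min !divr_gt0.
have md : m < d by rewrite gt_min gtr_pMr// invf_lt1// ltr1n.
have m1 : m <= 1 / 2 by rewrite ge_min lexx orbT.
pose z := if \val x <= 1 / 2 then \val x + m else \val x - m.
have z01 : z \in `[0 : R, 1]%classic.
  rewrite inE /= in_itv /= /z; case: ifPn => [h|]; last rewrite -ltNge => h.
    apply/andP; split; first by rewrite addr_ge0// ltW.
    by rewrite [leRHS](splitr (1 : R)) lerD.
  apply/andP; split; first by rewrite subr_ge0 (le_trans m1)// ltW.
  by rewrite lerBlDr (le_trans x1)// lerDl ltW.
have zx : `|z - \val x| = m.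
  by rewrite /z; case: ifP => _; rewrite addrAC subrr add0r ?normrN gtr0_norm.
exists (exist _ z z01); apply: dP => /=; first by rewrite zx.
apply/eqP => /(congr1 val) /= zE.
by move: zx; rewrite zE subrr normr0 => m_0; move: m0; rewrite -m_0 ltxx.
Qed.

Lemma has_der_der f x l : has_der f x l -> der01 f x = l.
Proof.
move=> /has_derP h; apply: cvg_lim => //; last exact: I01_proper.
Qed.

Lemma der_has_der f : derivable01 f -> forall x, has_der f x (der01 f x).
Proof. by move=> h x; apply/has_derP; exact: h. Qed.

Lemma has_der_derivable f (df : I01 -> C^o) :
  (forall x, has_der f x (df x)) -> derivable01 f /\ der01 f = df.
Proof.
move=> h; split.
  by move=> x; apply/cvg_ex; exists (df x); apply/has_derP.
by apply/funext => x; exact: has_der_der.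
Qed.

Let has_der_lin_eq (K : comNzRingType) (a u u' v v' d l m : K) :
  a * u + v - (a * u' + v') - d * (a * l + m) =
  a * (u - u' - d * l) + (v - v' - d * m).
Proof. ring. Qed.

Let has_der_mul_eq (K : comNzRingType) (u u' v v' d l m : K) :
  u * v - u' * v' - d * (l * v' + u' * m) =
  (u - u' - d * l) * v' + u' * (v - v' - d * m) + (u - u') * (v - v').
Proof. ring. Qed.

Lemma has_der_lin (a : C) f g x (l m : C) :
  has_der f x l -> has_der g x m -> has_der (a *: f + g) x (a * l + m).
Proof.
move=> hf hg e e0.
have na : 0 < nm a + 1 by rewrite ltr_wpDl// nm_ge0.
have e1 : 0 < e / 2 / (nm a + 1) by rewrite !divr_gt0.
have [d1 d10 h1] := hf _ e1; have [d2 d20 h2] := hg _ (divr_gt0 e0 (ltr0Sn _ 1)).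
exists (Num.min d1 d2); first by rewrite lt_min d10.
move=> y; rewrite lt_min => /andP[/h1 {}h1 /h2 {}h2].
have -> : (a *: f + g) y - (a *: f + g) x - (\val y - \val x)%:C * (a * l + m) =
  a * (f y - f x - (\val y - \val x)%:C * l) +
  (g y - g x - (\val y - \val x)%:C * m).
  exact: has_der_lin_eq.
apply: (le_trans (nmD _ _)); rewrite (splitr e) mulrDl lerD// nmM.
apply: (le_trans (ler_wpM2l (nm_ge0 _) h1)); rewrite mulrA ler_wpM2r//.
rewrite mulrCA ger_pMr ?divr_gt0// ler_pdivrMr// mul1r.
by rewrite lerDl.
Qed.

Lemma has_der_cst (c : C) x : has_der (fun=> c) x 0.
Proof.
move=> e e0; exists 1 => // y _.
by rewrite mulr0 !subrr nm0 mulr_ge0// ltW.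
Qed.

Lemma has_der_lip f x (l : C) : has_der f x l ->
  exists2 d : R, 0 < d & forall y, `|\val y - \val x| < d ->
    nm (f y - f x) <= (nm l + 1) * `|\val y - \val x|.
Proof.
move=> /(_ 1 ltr01)[d d0 h]; exists d => // y /h {}h.
rewrite -[f y - f x](subrK ((\val y - \val x)%:C * l)).
apply: (le_trans (nmD _ _)); rewrite addrC mulrDl lerD//.
by rewrite nmM nm_real mulrC.
Qed.

Lemma has_der_mul f g x (l m : C) :
  has_der f x l -> has_der g x m ->
  has_der (f * g : I01 -> C^o) x (l * g x + f x * m).
Proof.
move=> hf hg e e0.
have [d0 d00 h0] := has_der_lip hf.
pose K := nm (f x) + nm (g x) + (nm l + 1) * (nm m + 1) + 1.
have K0 : 0 < K.
  by rewrite ltr_wpDl// !addr_ge0 ?mulr_ge0 ?addr_ge0 ?nm_ge0.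
have [d3 d30 h3] := has_der_lip hg.
have eK : 0 < e / K by rewrite divr_gt0.
have [d1 d10 h1] := hf _ eK; have [d2 d20 h2] := hg _ eK.
exists (Num.min (Num.min d0 d3) (Num.min (Num.min d1 d2) (e / K))).
  by rewrite !lt_min d00 d30 d10 d20.
move=> y; rewrite !lt_min => /andP[/andP[/h0 {}h0 /h3 {}h3]].
move=> /andP[/andP[/h1 {}h1 /h2 {}h2] yx].
have -> : (f * g : I01 -> C^o) y - (f * g : I01 -> C^o) x
    - (\val y - \val x)%:C * (l * g x + f x * m) =
  (f y - f x - (\val y - \val x)%:C * l) * g x +
  f x * (g y - g x - (\val y - \val x)%:C * m) + (f y - f x) * (g y - g x).
  exact: has_der_mul_eq.
set h := `|\val y - \val x| in h0 h3 h1 h2 yx *.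
have h_ge0 : 0 <= h by rewrite /h.
apply: (@le_trans _ _ (e / K * h * nm (g x) + nm (f x) * (e / K * h) +
    ((nm l + 1) * h) * ((nm m + 1) * h))).
  apply: (le_trans (nmD _ _)); apply: lerD; last first.
    by rewrite nmM ler_pM ?nm_ge0.
  apply: (le_trans (nmD _ _)); apply: lerD; rewrite nmM.
    by rewrite ler_wpM2r ?nm_ge0.
  by rewrite ler_wpM2l ?nm_ge0.
have -> : ((nm l + 1) * h) * ((nm m + 1) * h) =
    ((nm l + 1) * (nm m + 1) * h) * h by ring.
apply: (@le_trans _ _ (e / K * h * nm (g x) + nm (f x) * (e / K * h) +
   ((nm l + 1) * (nm m + 1) * (e / K)) * h)).
  rewrite lerD2l ler_wpM2r// ler_wpM2l// ?mulr_ge0 ?addr_ge0 ?nm_ge0//.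
  exact: ltW.
have -> : e / K * h * nm (g x) + nm (f x) * (e / K * h) +
   ((nm l + 1) * (nm m + 1) * (e / K)) * h = (e / K) * (K - 1) * h.
  by rewrite /K; ring.
rewrite ler_wpM2r// mulrBr mulr1 divfK ?gt_eqF//.
by rewrite gerBl ltW.
Qed.

Lemma der_lin (a : C) f g : derivable01 f -> derivable01 g ->
  derivable01 (a *: f + g) /\ der01 (a *: f + g) = a *: der01 f + der01 g.
Proof.
by move=> /der_has_der hf /der_has_der hg; apply: has_der_derivable => x;
  exact: has_der_lin.
Qed.

Lemma der_mul f g : derivable01 f -> derivable01 g ->
  derivable01 (f * g : I01 -> C^o) /\
  der01 (f * g : I01 -> C^o) = (der01 f * g + f * der01 g : I01 -> C^o).
Proof.
by move=> /der_has_der hf /der_has_der hg; apply: has_der_derivable => x;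
  exact: has_der_mul.
Qed.

Fixpoint nsmooth n f : Prop :=
  if n is m.+1 then derivable01 f /\ nsmooth m (der01 f) else True.

Lemma nsmoothP f : (forall n, derivable01 (iter n der01 f)) <->
  forall n, nsmooth n f.
Proof.
split.
  move=> h n; elim: n f h => //= n IH f h; split; first exact: (h 0%N).
  by apply: IH => k; rewrite -iterSr; exact: h.
move=> h n; elim: n f h => [|n IH] f h; first by have [] := h 1%N.
by rewrite iterSr; apply: IH => k; have [] := h k.+1.
Qed.

Lemma nsmoothW n f : nsmooth n.+1 f -> nsmooth n f.
Proof. by elim: n f => //= n IH f [h1 h2]; split=> //; exact: IH. Qed.

Lemma nsmooth_le m n f : (m <= n)%N -> nsmooth n f -> nsmooth m f.
Proof.
elim: n m f => [|n IH] [|m] f //= mn [h1 h2].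
by split=> //; exact: IH.
Qed.

Lemma nsmooth_lin n (a : C) f g :
  nsmooth n f -> nsmooth n g -> nsmooth n (a *: f + g).
Proof.
elim: n f g => //= n IH f g [f1 f2] [g1 g2].
by have [h1 ->] := der_lin a f1 g1; split=> //; exact: IH.
Qed.

Lemma iter_der_lin n (a : C) f g : nsmooth n f -> nsmooth n g ->
  iter n der01 (a *: f + g) = a *: iter n der01 f + iter n der01 g.
Proof.
elim: n f g => // n IH f g [f1 f2] [g1 g2].
by rewrite !iterSr; have [_ ->] := der_lin a f1 g1; exact: IH.
Qed.

Lemma nsmooth_mul n f g :
  nsmooth n f -> nsmooth n g -> nsmooth n (f * g : I01 -> C^o).
Proof.
elim: n f g => // n IH f g fn gn.
have [f1 f2] := fn; have [g1 g2] := gn; rewrite /=.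
have [h1 ->] := der_mul f1 g1; split=> //.
rewrite -[der01 f * g]scale1r; apply: nsmooth_lin; apply: IH => //.
  exact: nsmoothW gn.
exact: nsmoothW fn.
Qed.

Lemma iter_der_mul n f g : nsmooth n.+1 f -> nsmooth n.+1 g ->
  iter n.+1 der01 (f * g : I01 -> C^o) =
  iter n der01 (der01 f * g : I01 -> C^o) +
  iter n der01 (f * der01 g : I01 -> C^o).
Proof.
move=> fn gn; have [f1 f2] := fn; have [g1 g2] := gn.
rewrite iterSr; have [_ ->] := der_mul f1 g1.
rewrite -[der01 f * g]scale1r iter_der_lin ?scale1r//; apply: nsmooth_mul => //.
  exact: nsmoothW gn.
exact: nsmoothW fn.
Qed.

Definition dbound n (M : R) f : Prop :=
  forall k t, (k <= n)%N -> nm (iter k der01 f t) <= M.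

Lemma dboundS n M f :
  dbound n.+1 M f <-> (forall t, nm (f t) <= M) /\ dbound n M (der01 f).
Proof.
split=> [h|[h1 h2] [|k] t kn]; last 2 first.
- exact: h1.
- by rewrite iterSr; exact: h2.
split=> [t|k t kn]; first exact: (h 0%N).
by rewrite -iterSr; exact: h.
Qed.

Lemma dboundW n M f : dbound n.+1 M f -> dbound n M f.
Proof. by move=> h k t kn; apply: h; exact: leqW. Qed.

Lemma dbound_mul n f g (a b : R) : 0 <= a -> 0 <= b ->
  nsmooth n f -> nsmooth n g -> dbound n a f -> dbound n b g ->
  dbound n (2 ^+ n * (a * b)) (f * g : I01 -> C^o).
Proof.
move=> a0 b0; elim: n f g => [|n IH] f g fn gn fa gb.
  move=> k t; rewrite leqn0 => /eqP -> /=; rewrite expr0 mul1r.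
  rewrite -[(f * g : I01 -> C^o) t]/(f t * g t) nmM.
  by rewrite ler_pM ?nm_ge0//; [exact: (fa 0%N)|exact: (gb 0%N)].
have [/dboundS[fa1 fa2] /dboundS[gb1 gb2]] := (fa, gb).
have [[f1 f2] [g1 g2]] := (fn, gn).
apply/dboundS; split=> [t|k t kn].
  rewrite -[(f * g : I01 -> C^o) t]/(f t * g t) nmM.
  apply: (@le_trans _ _ (a * b)); first by rewrite ler_pM ?nm_ge0.
  by rewrite ler_peMl ?mulr_ge0// exprn_ege1// ler1n.
rewrite -iterSr.
have nsk h : nsmooth n.+1 h -> nsmooth k.+1 h by exact: nsmooth_le.
rewrite iter_der_mul; [|exact: nsk|exact: nsk].
have -> : 2 ^+ n.+1 * (a * b) = 2 ^+ n * (a * b) + 2 ^+ n * (a * b).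
  by rewrite exprS -mulrA mulr_natl mulr2n.
apply: (le_trans (nmD _ _)); apply: lerD.
  by apply: IH => //; [exact: nsmoothW gn|exact: dboundW gb].
by apply: IH => //; [exact: nsmoothW fn|exact: dboundW fa].
Qed.

Lemma iter_der_mul0 n f g t : nsmooth n f -> nsmooth n g ->
  (forall k, (k <= n)%N -> iter k der01 f t = 0) ->
  iter n der01 (f * g : I01 -> C^o) t = 0.
Proof.
elim: n f g => [|n IH] f g fn gn f0.
  have ft : f t = 0 by exact: (f0 0%N).
  by rewrite /= -[(f * g : I01 -> C^o) t]/(f t * g t) ft mul0r.
have [[f1 f2] [g1 g2]] := (fn, gn).
rewrite iter_der_mul// -[LHS]/(iter n der01 (der01 f * g : I01 -> C^o) t +
  iter n der01 (f * der01 g : I01 -> C^o) t).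
rewrite !IH ?addr0//; [exact: nsmoothW fn| | |].
- by move=> k kn; apply: f0; exact: leqW.
- exact: nsmoothW gn.
- by move=> k kn; rewrite -iterSr; exact: f0.
Qed.

Lemma real_ind (P : R -> Prop) (a b : R) : a <= b -> P a ->
  (forall c, a <= c <= b -> exists2 d : R, 0 < d & forall s t : R,
     a <= s -> t <= b -> c - d < s <= c -> c <= t < c + d -> P s -> P t) ->
  P b.
Proof.
move=> ab Pa step; pose S := [set t : R | a <= t <= b /\ P t].
have Sa : S a by split => //; rewrite lexx.
have hS : has_sup S by split; [exists a|exists b => t [/andP[]]].
pose c := sup S.
have ac : a <= c by exact: sup_upper_bound.
have cb : c <= b by apply: ge_sup => [|t [/andP[]]//]; exists a.
have [|d d0 h] := step c; first by rewrite ac.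
have [s [/andP[sa sb] Ps] cs] := sup_adherent d0 hS.
pose t := Num.min (c + d / 2) b.
have d2 : 0 < d / 2 by rewrite divr_gt0.
have ct : c <= t by rewrite le_min cb andbT lerDl ltW.
have tb : t <= b by rewrite ge_min lexx orbT.
have Pt : P t.
  apply: (h s t) => //.
    by rewrite cs /=; apply: sup_upper_bound => //; split=> //; rewrite sa.
  rewrite ct /= gt_min; apply/orP; left.
  by rewrite ltrD2l gtr_pMr// invf_lt1// ltr1n.
have tc : t <= c.
  by apply: sup_upper_bound => //; split=> //; rewrite tb (le_trans ac).
move: tc Pt; rewrite /t; case: (leP (c + d / 2) b) => // cdb.
by rewrite gerDl leNgt d2.
Qed.

Lemma mkI01 (c : R) : 0 <= c <= 1 -> exists z : I01, \val z = c.
Proof.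
move=> c01; have h : c \in `[0 : R, 1]%classic by rewrite inE /= in_itv.
by exists (exist _ c h).
Qed.

Lemma I01_dist x y : `|\val y - \val x| <= 1.
Proof.
have /andP[x0 x1] := I01_bd x; have /andP[y0 y1] := I01_bd y.
rewrite ler_norml; apply/andP; split.
  by rewrite lerBrDl (le_trans _ y0)// subr_le0.
by rewrite lerBlDl (le_trans y1)// lerDr.
Qed.

Lemma mean_value f (df : I01 -> C^o) (M : R) :
  (forall t, has_der f t (df t)) -> (forall t, nm (df t) <= M) ->
  forall x y, nm (f y - f x) <= M * `|\val y - \val x|.
Proof.
move=> hd hM.
suff main x y : \val x <= \val y ->
    nm (f y - f x) <= M * `|\val y - \val x|.
  move=> x y; have [/main//|/ltW/main] := leP (\val x) (\val y).
  by rewrite nmB distrC.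
move=> xy; apply/ler_addgt0Pr => e e0.
have /andP[x0 x1] := I01_bd x; have /andP[y0 y1] := I01_bd y.
apply: (@le_trans _ _ ((M + e) * `|\val y - \val x|)); last first.
  by rewrite mulrDl lerD2l ger_pMr// I01_dist.
have loc z : exists2 d : R, 0 < d & forall u : I01, `|\val u - \val z| < d ->
    nm (f u - f z) <= (M + e) * `|\val u - \val z|.
  have [d d0 h] := hd z _ e0; exists d => // u /h {}h.
  rewrite -[f u - f z](subrK ((\val u - \val z)%:C * df z)).
  apply: (le_trans (nmD _ _)); rewrite addrC mulrDl lerD//.
  by rewrite nmM nm_real mulrC ler_wpM2r.
pose P (s : R) := forall u : I01, \val u = s -> nm (f u - f x) <= (M + e) * (s - \val x).
rewrite ger0_norm ?subr_ge0//.
suff : P (\val y) by exact.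
apply: (@real_ind P (\val x)) => // [u ux|c /andP[xc cy]].
  by rewrite (val_inj ux) !subrr nm0 mulr0.
have [z zc] : exists z : I01, \val z = c.
  by apply: mkI01; rewrite (le_trans x0 xc) (le_trans cy y1).
have [d d0 h] := loc z; exists d => // s t xs ty /andP[cds sc] /andP[ct tcd].
move=> Ps u ut.
have [v vs] : exists v : I01, \val v = s.
  by apply: mkI01; rewrite (le_trans x0 xs) (le_trans sc)// (le_trans cy).
have hu : nm (f u - f z) <= (M + e) * (t - c).
  have := h u; rewrite ut zc ger0_norm ?subr_ge0//; apply.
  by rewrite ltrBlDl.
have hv : nm (f v - f z) <= (M + e) * (c - s).
  have := h v; rewrite vs zc distrC ger0_norm ?subr_ge0//; apply.
  by rewrite ltrBlDl -ltrBlDr.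
have -> : f u - f x = (f u - f z) + ((f z - f v) + (f v - f x)).
  by rewrite !addrA !subrK.
have -> : (M + e) * (t - \val x) =
    (M + e) * (t - c) + ((M + e) * (c - s) + (M + e) * (s - \val x)).
  by rewrite -!mulrDr !addrA !subrK.
apply: (le_trans (nmD _ _)); rewrite lerD//.
apply: (le_trans (nmD _ _)); rewrite lerD//; first by rewrite nmB.
exact: Ps.
Qed.

Lemma derivable_bounded f : derivable01 f ->
  exists2 M : R, 0 <= M & forall t, nm (f t) <= M.
Proof.
move=> /der_has_der hd.
pose P (s : R) := exists2 M : R, 0 <= M & forall u : I01, \val u <= s -> nm (f u) <= M.
have [M M0 h] : P 1; last first.
  by exists M => // t; apply: h; have /andP[] := I01_bd t.
apply: (@real_ind P 0) => //.
  exists (nm (f I01_0)); first exact: nm_ge0.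
  move=> u u0; have -> // : u = I01_0; apply/val_inj/eqP; rewrite eq_le u0.
  by have /andP[] := I01_bd u.
move=> c c01; have [z zc] := mkI01 c01.
have [d d0 h] := has_der_lip (hd z); exists d => // s t s0 t1.
move=> /andP[cds sc] /andP[ct tcd] [M M0 hM].
exists (M + (nm (f z) + (nm (der01 f z) + 1))).
  by rewrite !addr_ge0 ?nm_ge0.
move=> u ut; have [us|su] := leP (\val u) s.
  by apply: (le_trans (hM _ us)); rewrite lerDl !addr_ge0 ?nm_ge0.
have uz : `|\val u - \val z| < d.
  rewrite zc ltr_norml; apply/andP; split.
    by rewrite ltrBrDl (lt_trans cds).
  by rewrite ltrBlDl (le_lt_trans ut).
rewrite -[f u](subrK (f z)).
apply: (le_trans (nmD _ _)).
apply: (@le_trans _ _ (nm (f z) + (nm (der01 f z) + 1))).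
  rewrite addrC lerD2l (le_trans (h u uz))// ger_pMr ?I01_dist//.
  by rewrite ltr_wpDl// nm_ge0.
by rewrite lerDr.
Qed.

Lemma smooth_dbound f n : (forall n, derivable01 (iter n der01 f)) ->
  exists2 M : R, 0 <= M & dbound n M f.
Proof.
move=> hf; elim: n => [|n [M M0 hM]].
  have [M M0 hM] := derivable_bounded (hf 0%N).
  by exists M => // k t; rewrite leqn0 => /eqP ->; exact: hM.
have [M' M'0 hM'] := derivable_bounded (hf n.+1).
exists (M + M'); first exact: addr_ge0.
move=> k t; rewrite leq_eqVlt => /orP[/eqP ->|kn].
  by apply: (le_trans (hM' _)); rewrite lerDr.
by apply: (le_trans (hM _ _ kn)); rewrite lerDl.
Qed.

Lemma flat_smooth_lin (a : C) f g :
  flat_smooth f -> flat_smooth g -> flat_smooth (a *: f + g).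
Proof.
move=> [/nsmoothP f1 f2] [/nsmoothP g1 g2]; split.
  by apply/nsmoothP => n; exact: nsmooth_lin.
move=> n; rewrite iter_der_lin//; have [f0 f1'] := f2 n; have [g0 g1'] := g2 n.
split; rewrite -[LHS]/(a *: iter n.+1 der01 f _ + iter n.+1 der01 g _).
  by rewrite f0 g0 scaler0 addr0.
by rewrite f1' g1' scaler0 addr0.
Qed.

Lemma flat_smooth0 : flat_smooth 0.
Proof.
have [_ d0] : derivable01 (0 : I01 -> C^o) /\ der01 (0 : I01 -> C^o) = 0.
  by apply: has_der_derivable => x; exact: has_der_cst.
have E n : iter n der01 (0 : I01 -> C^o) = 0.
  by elim: n => // n IH; rewrite iterS IH.
split=> n; last by rewrite E.
rewrite E; have [] // : derivable01 (0 : I01 -> C^o) /\ der01 (0 : I01 -> C^o) = 0.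
by apply: has_der_derivable => x; exact: has_der_cst.
Qed.

Lemma flat_smooth_mul f g :
  flat_smooth f -> flat_smooth g -> flat_smooth (f * g : I01 -> C^o).
Proof.
move=> [/nsmoothP f1 f2] [/nsmoothP g1 g2]; split.
  by apply/nsmoothP => n; exact: nsmooth_mul.
have key n t : (forall k, iter k.+1 der01 f t = 0) ->
    (forall k, iter k.+1 der01 g t = 0) ->
    iter n.+1 der01 (f * g : I01 -> C^o) t = 0.
  move=> ft gt; have [_ sf] := f1 1%N; have [_ sg] := g1 1%N.
  rewrite iter_der_mul// -[LHS]/(iter n der01 (der01 f * g : I01 -> C^o) t +
    iter n der01 (f * der01 g : I01 -> C^o) t) mulrC.
  have [_ df] := f1 n.+1; have [_ dg] := g1 n.+1.
  rewrite [X in _ + iter _ _ X _]mulrC [X in iter _ _ X _ + _]mulrC.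
  rewrite !iter_der_mul0 ?addr0// => k _; rewrite -iterSr.
    exact: gt.
  exact: ft.
by move=> n; split; apply: key => k; [have [] := f2 k|have [] := g2 k|
  have [] := f2 k|have [] := g2 k].
Qed.

Definition flat_pred : {pred I01 -> C^o} := fun f => `[< flat_smooth f >].

Lemma flat_predP f : reflect (flat_smooth f) (f \in flat_pred).
Proof. exact: asboolP. Qed.

Lemma flat_submod_closed : submod_closed flat_pred.
Proof.
split; first by apply/flat_predP; exact: flat_smooth0.
by move=> a f g /flat_predP hf /flat_predP hg; apply/flat_predP;
  exact: flat_smooth_lin.
Qed.

HB.instance Definition _ := GRing.isSubmodClosed.Build C (I01 -> C^o) flat_pred
  flat_submod_closed.

Record C01 : Type := MkC01 {
  c01_fun :> I01 -> C^o;
  c01_flat : c01_fun \in flat_pred }.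

HB.instance Definition _ := [isSub for c01_fun].
HB.instance Definition _ := [Choice of C01 by <:].
HB.instance Definition _ := [SubChoice_isSubLmodule of C01 by <:].

Lemma c01_nsmooth (u : C01) n : nsmooth n u.
Proof. by move: n; apply/nsmoothP; have /flat_predP[] := c01_flat u. Qed.

Lemma c01_iter_lin n (a : C) (u v : C01) t :
  iter n der01 (a *: u + v : C01) t = a *: iter n der01 u t + iter n der01 v t.
Proof.
rewrite -[c01_fun (a *: u + v)]/(a *: c01_fun u + c01_fun v).
by rewrite iter_der_lin//; exact: c01_nsmooth.
Qed.

Definition c01_near n (e : R) (u : C01) : Prop :=
  forall k t, (k <= n)%N -> nm (iter k der01 u t) < e.

Lemma c01_near0 n (e : R) : 0 < e -> c01_near n e 0.
Proof.
move=> e0 k t _; have := c01_iter_lin k (-1) 0 0 t.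
by rewrite scaler0 addr0 scaleN1r addNr => ->; rewrite nm0.
Qed.

Lemma nm1 : nm 1 = 1.
Proof. by rewrite -[1]/(1%:C) nm_real normr1. Qed.

Lemma c01_nearN n (e : R) (u : C01) : c01_near n e u -> c01_near n e (- u).
Proof.
move=> h k t kn; rewrite -[- u]addr0 -scaleN1r c01_iter_lin.
have -> : iter k der01 (0 : C01) t = 0.
  have := c01_iter_lin k (-1) 0 0 t.
  by rewrite scaler0 addr0 scaleN1r addNr => ->.
by rewrite addr0 nmM nmN nm1 mul1r; exact: h.
Qed.

Lemma c01_nearD n (e e' : R) (u v : C01) :
  c01_near n e u -> c01_near n e' v -> c01_near n (e + e') (u + v).
Proof.
move=> hu hv k t kn; rewrite -[u]scale1r c01_iter_lin scale1r.
by apply: (le_lt_trans (nmD _ _)); rewrite ltrD ?hu ?hv.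
Qed.

Lemma c01_near_sub n m (e e' : R) (u : C01) : (n <= m)%N -> e' <= e ->
  c01_near m e' u -> c01_near n e u.
Proof.
by move=> nm' ee h k t kn; apply: lt_le_trans ee; apply: h; exact: leq_trans nm'.
Qed.

(* uniform convergence of all derivatives on [0,1] *)
Definition c01_ent (P : set (C01 * C01)) : Prop :=
  exists n (e : R), 0 < e /\ forall u v, c01_near n e (u - v) -> P (u, v).

Lemma c01_ent_filter : Filter c01_ent.
Proof.
split.
- by exists 0%N, 1; split.
- move=> P Q [n [e [e0 hP]]] [m [e' [e'0 hQ]]].
  exists (maxn n m), (Num.min e e'); split; first by rewrite lt_min e0.
  move=> u v h; split.
    apply: hP; apply: c01_near_sub h; first exact: leq_maxl.
    by rewrite ge_min lexx.
  apply: hQ; apply: c01_near_sub h; first exact: leq_maxr.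
  by rewrite ge_min lexx orbT.
- move=> P Q PQ [n [e [e0 hP]]]; exists n, e; split=> // u v h.
  by apply: PQ; exact: hP.
Qed.

Lemma c01_ent_refl A : c01_ent A -> diagonal `<=` A.
Proof.
move=> [n [e [e0 hA]]] [u v] /= uv.
have -> : v = u by [].
by apply: hA; rewrite subrr; exact: c01_near0.
Qed.

Lemma c01_ent_inv A : c01_ent A -> c01_ent A^-1%relation.
Proof.
move=> [n [e [e0 hA]]]; exists n, e; split=> // u v h.
by apply: hA; rewrite -opprB; exact: c01_nearN.
Qed.

Lemma c01_ent_split A : c01_ent A ->
  exists2 B, c01_ent B & (B \; B)%relation `<=` A.
Proof.
move=> [n [e [e0 hA]]].
have e2 : 0 < e / 2 by rewrite divr_gt0.
exists [set uv | c01_near n (e / 2) (uv.1 - uv.2)]; first by exists n, (e / 2).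
move=> [u v] [w /= h1 h2]; apply: hA.
by rewrite -[u - v](subrKA w) (splitr e); exact: c01_nearD.
Qed.

HB.instance Definition _ := isUniform.Build C01
  c01_ent_filter c01_ent_refl c01_ent_inv c01_ent_split.

Lemma c01_nbhsP (u : C01) (U : set C01) :
  nbhs u U <-> exists n (e : R), 0 < e /\ forall v, c01_near n e (u - v) -> U v.
Proof.
split.
  move=> [A [n [e [e0 hA]]] AU]; exists n, e; split=> // v h.
  by apply: AU; apply/xsectionP; exact: hA.
move=> [n [e [e0 h]]]; exists [set uv | c01_near n e (uv.1 - uv.2)].
  by exists n, e.
by move=> v /xsectionP /= /h.
Qed.

Lemma c01_add_continuous : continuous (fun w : C01 * C01 => w.1 + w.2).
Proof.
move=> [u v] U /c01_nbhsP[n [e [e0 hU]]].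
have e2 : 0 < e / 2 by rewrite divr_gt0.
exists ([set u' | c01_near n (e / 2) (u - u')],
        [set v' | c01_near n (e / 2) (v - v')]).
  by split; apply/c01_nbhsP; exists n, (e / 2).
move=> [u' v'] /= [hu hv]; apply: hU => /=.
by rewrite opprD addrACA (splitr e); exact: c01_nearD.
Qed.

Lemma c01_dbound (u : C01) n : exists2 M : R, 0 < M & c01_near n M u.
Proof.
have /flat_predP[hu _] := c01_flat u.
have [M M0 hM] := smooth_dbound n hu.
exists (M + 1); first by rewrite ltr_wpDl.
by move=> k t kn; apply: (le_lt_trans (hM k t kn)); rewrite ltrDl.
Qed.

Lemma c01_scale_continuous : continuous (fun w : C^o * C01 => w.1 *: w.2).
Proof.
move=> [a u] U /c01_nbhsP[n [e [e0 hU]]].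
have [M M0 hM] := c01_dbound u n.
have na : 0 < nm a + 1 by rewrite ltr_wpDl// nm_ge0.
have e1 : 0 < e / 2 / (nm a + 1) by rewrite !divr_gt0.
have e2 : 0 < Num.min 1 (e / 2 / M) by rewrite lt_min ltr01 !divr_gt0.
exists ([set b : C^o | nm (a - b) < Num.min 1 (e / 2 / M)],
        [set v | c01_near n (e / 2 / (nm a + 1)) (u - v)]).
  split; last by apply/c01_nbhsP; exists n, (e / 2 / (nm a + 1)).
  apply/nbhs_ballP; exists (Num.min 1 (e / 2 / M))%:C; first by rewrite /= ltcR.
  by move=> b; rewrite -ball_normE /= ltcnm.
move=> [b v] /= [hb hv]; apply: hU => /=.
have -> : a *: u - b *: v = (a - b) *: u + b *: (u - v).
  by rewrite scalerBl scalerBr addrA subrK.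
move: hb; rewrite lt_min => /andP[b1 bM].
have nb : nm b <= nm a + 1.
  rewrite -[b](subrK a); apply: (le_trans (nmD _ _)).
  by rewrite addrC lerD2l nmB ltW.
move=> k t kn; rewrite c01_iter_lin -[b *: (u - v)]addr0 c01_iter_lin.
rewrite -[iter k der01 (0 : C01) t]/(iter k der01 (0 : C01) t : C).
have -> : iter k der01 (0 : C01) t = 0.
  have := c01_iter_lin k (-1) 0 0 t.
  by rewrite scaler0 addr0 scaleN1r addNr => ->.
rewrite addr0; apply: (le_lt_trans (nmD _ _)); rewrite !nmM (splitr e).
apply: ltr_leD.
  apply: (@le_lt_trans _ _ (nm (a - b) * M)).
    by rewrite ler_wpM2l ?nm_ge0// ltW// hM.
  by rewrite -ltr_pdivlMr.
apply: (@le_trans _ _ ((nm a + 1) * (e / 2 / (nm a + 1)))).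
  by rewrite ler_pM ?nm_ge0// ltW// hv.
by rewrite mulrC divfK// gt_eqF.
Qed.

Lemma c01_iter0 n t : iter n der01 (0 : C01) t = 0.
Proof.
have := c01_iter_lin n (-1) 0 0 t.
by rewrite scaler0 addr0 scaleN1r addNr => ->.
Qed.

Lemma c01_iter_comb n (a b : C) (u v : C01) t :
  iter n der01 (a *: u + b *: v : C01) t =
  a * iter n der01 u t + b * iter n der01 v t.
Proof.
rewrite c01_iter_lin -[b *: v]addr0 c01_iter_lin c01_iter0.
by rewrite addr0.
Qed.

Lemma nm_convex (l : C) : 0 <= l -> l <= 1 -> nm l + nm (1 - l) = 1.
Proof.
move=> l0 l1; apply: (@complexI R); rewrite rmorphD /= -!cnormE.
by rewrite !ger0_norm ?subr_ge0// addrC subrK.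
Qed.

Definition c01_ball (u : C01) n (e : R) : set C01 :=
  [set v | exists2 e' : R, e' < e &
    forall k t, (k <= n)%N -> nm (iter k der01 (u - v) t) <= e'].

Lemma c01_ball_convex u n e : convex_set (c01_ball u n e).
Proof.
move=> v w l; rewrite !inE => -[e1 e1e h1] [e2 e2e h2].
exists (Num.max e1 e2); first by rewrite gt_max e1e.
move=> k t kn.
have l0 : 0 <= (l%:num : C) by [].
have l1 : (l%:num : C) <= 1 by [].
change (nm (iter k der01 (u - ((l%:num : C) *: v + (1 - (l%:num : C)) *: w)) t)
  <= Num.max e1 e2).
have -> : u - ((l%:num : C) *: v + (1 - (l%:num : C)) *: w) =
    (l%:num : C) *: (u - v) + (1 - (l%:num : C)) *: (u - w).
  have ll : (l%:num : C) + (1 - (l%:num : C)) = 1 by rewrite addrC subrK.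
  by rewrite [in RHS]scalerBr [in X in _ = _ + X]scalerBr addrACA -scalerDl ll
    scale1r opprD.
rewrite c01_iter_comb; apply: (le_trans (nmD _ _)); rewrite !nmM.
apply: (@le_trans _ _ (nm (l%:num : C) * Num.max e1 e2 +
    nm (1 - (l%:num : C)) * Num.max e1 e2)).
  apply: lerD; rewrite ler_wpM2l ?nm_ge0// le_max.
    by rewrite h1.
  by rewrite h2 ?orbT.
by rewrite -mulrDl nm_convex// mul1r.
Qed.

Lemma c01_ball_open u n e : open (c01_ball u n e).
Proof.
rewrite openE => v [e' ee h]; apply/c01_nbhsP.
have d0 : 0 < (e - e') / 2 by rewrite divr_gt0// subr_gt0.
exists n, ((e - e') / 2); split => // w vw.
exists (e' + (e - e') / 2).
  by rewrite -ltrBrDl gtr_pMr ?subr_gt0// invf_lt1// ltr1n.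
move=> k t kn; rewrite -[u - w](subrKA v) -[u - v]scale1r c01_iter_lin scale1r.
by apply: (le_trans (nmD _ _)); rewrite lerD ?h// ltW// vw.
Qed.

Lemma c01_locally_convex : exists2 B : set_system C01,
  (forall b, b \in B -> convex_set b) & basis B.
Proof.
exists [set b | exists u n e, b = c01_ball u n e].
  by move=> b; rewrite inE => -[u [n [e ->]]]; exact: c01_ball_convex.
split; first by move=> _ [u [n [e ->]]]; exact: c01_ball_open.
move=> u U /c01_nbhsP[n [e [e0 hU]]].
exists (c01_ball u n e).
  split; first by exists u, n, e.
  by exists 0 => // k t kn; rewrite subrr c01_iter0 nm0.
by move=> v [e' ee h]; apply: hU => k t kn; exact: le_lt_trans (h k t kn) ee.
Qed.

HB.instance Definition _ := PreTopologicalNmodule_isTopologicalNmodule.Build C01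
  c01_add_continuous.
HB.instance Definition _ := TopologicalNmodule_isTopologicalLmodule.Build C C01
  c01_scale_continuous.
HB.instance Definition _ := Uniform_isTvs.Build C C01 c01_locally_convex.

Lemma c01_hausdorff : hausdorff_space C01.
Proof.
move=> u v uv; apply/val_inj/funext => t.
have h (e : R) : 0 < e -> nm (u t - v t) < e.
  move=> e0; have e2 : 0 < e / 2 by rewrite divr_gt0.
  have [] := uv [set w | c01_near 0 (e / 2) (u - w)]
                [set w | c01_near 0 (e / 2) (v - w)].
  - by apply/c01_nbhsP; exists 0%N, (e / 2).
  - by apply/c01_nbhsP; exists 0%N, (e / 2).
  move=> w [/= uw /c01_nearN vw].
  have := c01_nearD uw vw; rewrite -splitr opprB subrKA.
  by move=> /(_ 0%N t (leqnn _)).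
apply/eqP; rewrite -subr_eq0; apply/eqP/ComplexField.Normc.eq0_normc.
apply/eqP; rewrite eq_le nm_ge0 andbT; apply/ler_addgt0Pr => e e0.
by rewrite add0r ltW// h.
Qed.

Let lip_eq (K : comNzRingType) (a b c d l m : K) :
  (a - l) - (b - m) = ((a - c) - (b - d)) + ((c - l) - (d - m)).
Proof. ring. Qed.

Let L_der_eq (K : comNzRingType) (a b l m h p q : K) :
  l - m - h * q = (a - b - h * p) + (h * (p - q) - ((a - l) - (b - m))).
Proof. ring. Qed.

Lemma c01_iterB n (u v : C01) t :
  iter n der01 (u - v : C01) t = iter n der01 u t - iter n der01 v t.
Proof.
by rewrite -[u]scale1r -[- v]scaleN1r c01_iter_comb scale1r mul1r mulN1r.
Qed.

Lemma c01_has_der n (u : C01) t :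
  has_der (iter n der01 u) t (iter n.+1 der01 u t).
Proof.
rewrite iterS; apply: der_has_der.
by have /flat_predP[] := c01_flat u.
Qed.

Lemma c01_complete : tvs_complete C01.
Proof.
move=> F FF Fc.
have hF n (e : R) : 0 < e ->
    exists2 A, F A & forall u v, A u -> A v -> c01_near n e (u - v).
  move=> e0; have [|A FA hA] := Fc [set w | c01_near n e w]; last by exists A.
  by apply/c01_nbhsP; exists n, e; split=> // v /c01_nearN; rewrite sub0r opprK.
have hL k t : exists l : C^o, (fun u : C01 => iter k der01 u t) @ F --> l.
  apply/cvg_ex; apply: complex_cauchy_cvg; apply/cauchy_ballP => e e0.
  have e1 : 0 < complex.Re e.
    by case: e e0 => e1 e2; rewrite ltcE /= => /andP[_].
  have eE : e = (complex.Re e)%:C.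
    by case: e e0 {e1} => e1 e2; rewrite ltcE /= => /andP[/eqP -> _].
  have [A FA hA] := hF k _ e1.
  pose B := (fun u : C01 => iter k der01 u t) @` A.
  have FB : ((fun u : C01 => iter k der01 u t) @ F) B.
    by apply: (@filterS _ F _ A) FA => u Au; exists u.
  exists (B, B) => //= -[_ _] /= [[u Au <-] [v Av <-]].
  rewrite -ball_normE /= eE ltcnm -c01_iterB; exact: hA.
pose L k : I01 -> C^o := fun t => sval (cid (hL k t)).
have LP k t : (fun u : C01 => iter k der01 u t) @ F --> L k t.
  by rewrite /L; case: cid.
have near_L (A : set C01) k t (e : R) : F A -> 0 < e ->
    F [set v | A v /\ nm (iter k der01 v t - L k t) < e].
  move=> FA e0; apply: filterI => //.
  have := LP k t; move/cvgrPdist_lt => /(_ e%:C); rewrite ltcR => /(_ e0).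
  by apply: filterS => v; rewrite ltcnm nmB.
have unif n (e : R) : 0 < e -> exists2 A, F A & forall u, A u ->
    forall k t, (k <= n)%N -> nm (iter k der01 u t - L k t) <= e.
  move=> e0; have [A FA hA] := hF n _ e0; exists A => // u Au k t kn.
  apply/ler_addgt0Pr => e' e'0.
  have [v [Av hv]] := filter_ex (near_L A k t e' FA e'0).
  rewrite -[_ - _](subrKA (iter k der01 v t)).
  apply: (le_trans (nmD _ _)); rewrite lerD ?(ltW hv)//.
  by rewrite -c01_iterB ltW// hA.
have L_der k x : has_der (L k) x (L k.+1 x).
  move=> e e0; have e4 : 0 < e / 4 by rewrite divr_gt0.
  have [A FA hA] := unif k.+1 _ e4.
  have [u Au] := filter_ex FA.
  have [d d0 hd] := c01_has_der k u x e4.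
  exists d => // y /hd {}hd; set h := `|\val y - \val x| in hd *.
  have h_ge0 : 0 <= h by rewrite /h.
  have lip : nm ((iter k der01 u y - L k y) - (iter k der01 u x - L k x)) <=
      (e / 4 + e / 4) * h.
    apply/ler_addgt0Pr => e' e'0.
    have e'2 : 0 < e' / 2 by rewrite divr_gt0.
    have := @filterI _ F (@filter_filter _ F FF) _ _ (near_L A k y _ FA e'2) (near_L A k x _ FA e'2).
    move=> /filter_ex[v [[Av vy] [_ vx]]].
    have mv := @mean_value (iter k der01 (u - v)) (iter k.+1 der01 (u - v))
      (e / 4 + e / 4) (c01_has_der k (u - v)).
    have {}mv : nm (iter k der01 (u - v) y - iter k der01 (u - v) x) <=
        (e / 4 + e / 4) * h.
      apply: mv => t; rewrite c01_iterB.
      rewrite -[_ - _](subrKA (L k.+1 t)); apply: (le_trans (nmD _ _)).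
      by rewrite lerD ?hA// nmB hA.
    have -> : (iter k der01 u y - L k y) - (iter k der01 u x - L k x) =
      (iter k der01 (u - v) y - iter k der01 (u - v) x) +
      ((iter k der01 v y - L k y) - (iter k der01 v x - L k x)).
      by rewrite !c01_iterB; exact: lip_eq.
    apply: (le_trans (nmD _ _)); rewrite lerD//.
    apply: (le_trans (nmD _ _)); rewrite nmN (splitr e').
    by rewrite lerD// ltW.
  have -> : L k y - L k x - (\val y - \val x)%:C * L k.+1 x =
    (iter k der01 u y - iter k der01 u x
       - (\val y - \val x)%:C * iter k.+1 der01 u x) +
    ((\val y - \val x)%:C * (iter k.+1 der01 u x - L k.+1 x)
     - ((iter k der01 u y - L k y) - (iter k der01 u x - L k x))).
    exact: L_der_eq.
  have -> : e * h = e / 4 * h + (e / 4 * h + (e / 4 + e / 4) * h).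
    by field.
  apply: (le_trans (nmD _ _)); rewrite lerD//.
  apply: (le_trans (nmD _ _)); rewrite nmN lerD//.
  by rewrite nmM nm_real mulrC ler_wpM2r// hA.
have iterL n : iter n der01 (L 0%N) = L n.
  elim: n => // n IH; rewrite iterS IH.
  by have [] := has_der_derivable (L_der n).
have L0 k t : (forall u : C01, iter k der01 u t = 0) -> L k t = 0.
  move=> h; apply: ComplexField.Normc.eq0_normc; apply/eqP.
  rewrite eq_le nm_ge0 andbT; apply/ler_addgt0Pr => e e0; rewrite add0r.
  have [A FA hA] := unif k _ e0; have [u Au] := filter_ex FA.
  by have := hA u Au k t (leqnn k); rewrite h sub0r nmN.
have Lflat : L 0%N \in flat_pred.
  apply/flat_predP; split=> n.
    by rewrite iterL; have [] := has_der_derivable (L_der n).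
  by rewrite iterL; split; apply: L0 => u;
    have /flat_predP[_ /(_ n)[]] := c01_flat u.
exists (MkC01 Lflat) => U /c01_nbhsP[n [e [e0 hU]]].
have e2 : 0 < e / 2 by rewrite divr_gt0.
have [A FA hA] := unif n _ e2.
apply: (@filterS _ F _ A) FA => u Au; apply: hU => k t kn.
rewrite c01_iterB -[c01_fun (MkC01 Lflat)]/(L 0%N) iterL nmB.
by apply: (le_lt_trans (hA u Au k t kn)); rewrite gtr_pMr// invf_lt1// ltr1n.
Qed.

Definition C01_lcs : lcs R := Lcs c01_hausdorff c01_complete.

Lemma c01_mul_flat (u v : C01) :
  ((u : I01 -> C^o) * (v : I01 -> C^o) : I01 -> C^o) \in flat_pred.
Proof.
have /flat_predP hu := c01_flat u; have /flat_predP hv := c01_flat v.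
by apply/flat_predP; exact: flat_smooth_mul.
Qed.

Definition c01_mul (u v : C01) : C01 := MkC01 (c01_mul_flat u v).

Lemma c01_mul_near n (u v : C01) (a b : R) :
  c01_near n a u -> c01_near n b v -> 0 <= a -> 0 <= b ->
  forall k t, (k <= n)%N -> nm (iter k der01 (c01_mul u v) t) <= 2 ^+ n * (a * b).
Proof.
move=> hu hv a0 b0; apply: dbound_mul => //; try exact: c01_nsmooth.
  by move=> k t kn; rewrite ltW// hu.
by move=> k t kn; rewrite ltW// hv.
Qed.

Lemma c01_mull u : linear (c01_mul u).
Proof.
move=> a v w; apply/val_inj/funext => t.
rewrite -[LHS]/(u t * (a * v t + w t)) -[RHS]/(a * (u t * v t) + u t * w t).
by rewrite mulrDr mulrCA.
Qed.

Lemma c01_mulC u v : c01_mul u v = c01_mul v u.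
Proof.
by apply/val_inj/funext => t; rewrite -[LHS]/(u t * v t) mulrC.
Qed.

Lemma c01_mulA : associative c01_mul.
Proof.
move=> u v w; apply/val_inj/funext => t.
by rewrite -[LHS]/(u t * (v t * w t)) mulrA.
Qed.

Lemma c01_mul_continuous :
  continuous (fun w : C01 * C01 => c01_mul w.1 w.2).
Proof.
move=> [u v] U /c01_nbhsP[n [e [e0 hU]]].
have [a a0 ha] := c01_dbound u n; have [b b0 hb] := c01_dbound v n.
pose K : R := 2 ^+ n * (a + b + 1).
have K0 : 0 < K by rewrite mulr_gt0 ?exprn_gt0// !addr_gt0.
pose d := Num.min 1 (e / 2 / K).
have d0 : 0 < d by rewrite lt_min ltr01 !divr_gt0.
exists ([set u' | c01_near n d (u - u')], [set v' | c01_near n d (v - v')]).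
  by split; apply/c01_nbhsP; exists n, d.
move=> [u' v'] /= [hu hv]; apply: hU => k t kn.
have d1 : d <= 1 by rewrite ge_min lexx.
have dK : d * K <= e / 2.
  by rewrite -ler_pdivlMr// ge_min lexx orbT.
have hb' : c01_near n (b + 1) v'.
  have -> : v' = v + - (v - v') by rewrite opprB addrC subrK.
  apply: c01_nearD => //; apply: c01_nearN.
  by apply: c01_near_sub hv.
have -> : c01_mul u v - c01_mul u' v' =
    c01_mul u (v - v') + c01_mul (u - u') v'.
  apply/val_inj/funext => s.
  rewrite -[LHS]/(u s * v s - u' s * v' s).
  rewrite -[RHS]/(u s * (v s - v' s) + (u s - u' s) * v' s).
  by rewrite mulrBr mulrBl addrA subrK.
rewrite -[X in iter k _ (c01_fun (X + _))]scale1r c01_iter_lin scale1r.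
apply: (le_lt_trans (nmD _ _)).
have h1 := c01_mul_near ha hv (ltW a0) (ltW d0) t kn.
have h2 := c01_mul_near hu hb' (ltW d0) (addr_ge0 (ltW b0) ler01) t kn.
apply: (le_lt_trans (lerD h1 h2)).
have -> : 2 ^+ n * (a * d) + 2 ^+ n * (d * (b + 1)) = d * K.
  by rewrite /K; ring.
by apply: (le_lt_trans dK); rewrite gtr_pMr// invf_lt1// ltr1n.
Qed.

Lemma c01_mul_bilinear :
  cont_bilinear (c01_mul : C01_lcs -> C01_lcs -> C01_lcs).
Proof.
split; [exact: c01_mull| |exact: c01_mul_continuous].
move=> v a u w; rewrite ![c01_mul _ v]c01_mulC; exact: c01_mull.
Qed.

Definition C01_alg : lcAlg R := LcAlg c01_mul_bilinear c01_mulA.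

Lemma c01_eval_continuous t : continuous (fun u : C01 => u t).
Proof.
move=> u; have Fu : Filter (nbhs u) := nbhs_filter u.
apply/cvgrPdist_lt => e e0.
have e1 : 0 < complex.Re e.
  by case: e e0 => e1 e2; rewrite ltcE /= => /andP[_].
have eE : e = (complex.Re e)%:C.
  by case: e e0 {e1} => e1 e2; rewrite ltcE /= => /andP[/eqP -> _].
apply/c01_nbhsP; exists 0%N, (complex.Re e); split => // v h.
by rewrite eE ltcnm -[_ - _]/((u - v) t); exact: (h 0%N t).
Qed.

End SmoothFunctions.

Section Evaluation.
Local Notation I01 := (set_type `[0 : R, 1]).
Variables (A : lcAlg R) (T : ptensor A C01_alg) (t : I01).

Definition ev_bilin (a : A) (u : C01_alg) : A := (u : C01) t *: a.

Lemma ev_bilinear : cont_bilinear ev_bilin.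
Proof.
split.
- by move=> a c u v; rewrite /ev_bilin scalerA -scalerDl.
- by move=> u c a b; rewrite /ev_bilin scalerDr !scalerA mulrC.
move=> z; rewrite /ev_bilin.
apply: (@cvg_comp _ _ _ (fun w : A * C01 => ((w.2 : C01) t : C^o, w.1))
  (fun w : C^o * A => w.1 *: w.2) (nbhs z) (nbhs ((z.2 : C01) t : C^o, z.1)));
  last exact: (@scale_continuous C A ((z.2 : C01) t : C^o, z.1)).
have Fz : Filter (nbhs z) := nbhs_filter z.
apply: (@cvg_pair _ _ _ (nbhs z) (nbhs ((z.2 : C01) t : C^o)) (nbhs z.1));
  last exact: cvg_fst.
apply: (@cvg_comp _ _ _ snd (fun u : C01 => u t) (nbhs z) (nbhs z.2)).
  exact: cvg_snd.
exact: c01_eval_continuous.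
Qed.

Lemma ev_mul a a' u u' :
  ev_bilin (lca_mul a a') (lca_mul u u') =
  lca_mul (ev_bilin a u) (ev_bilin a' u').
Proof.
have [l1 l2 _] := lca_mul_bilinear A.
have zl (b : A) : lca_mul (0 : A) b = 0.
  by have := l2 b (-1) 0 0; rewrite scaler0 addr0 scaleN1r addNr.
have zr (b : A) : lca_mul b (0 : A) = 0.
  by have := l1 b (-1) 0 0; rewrite scaler0 addr0 scaleN1r addNr.
rewrite /ev_bilin.
have := l1 ((u : C01) t *: a) ((u' : C01) t) a' 0; rewrite !addr0 zr addr0 => ->.
have := l2 a' ((u : C01) t) a 0; rewrite /= !addr0 zl addr0 => ->.
by rewrite scalerA mulrC.
Qed.

Definition ev_hom : lcHom T A := ptensor_lift T ev_bilinear ev_mul.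

End Evaluation.

Definition m2_stable (E : lcFunctor R) : Prop :=
  forall (A : lcAlg R) (T : ptensor A M2),
    bijective (fmap E (tens_idem T M2_e11_idem)).

Definition diffotopy_invariant (E : lcFunctor R) : Prop :=
  forall (A : lcAlg R) (T : ptensor A C01_alg) (s t : set_type `[0 : R, 1]),
    fmap E (ev_hom T s) =1 fmap E (ev_hom T t).

End FunctionAlgebras.

(* Main.v *)
Require Import Defs.
From HB Require Import structures.
From mathcomp Require Import all_boot all_order all_algebra.
From mathcomp Require Import complex ring zify.
From mathcomp Require Import all_classical all_reals all_analysis.
(* Again, since mathcomp has its own [fmap]. *)
Require Import Defs.

(* Let T be the completed projective tensor product of A and C[0,1]; fix an
   orthonormal basis g_0, g_1, ... of a Hilbert space H.  Dyadic subdivision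
   yields intervals [al n, be n] with midpoints mi n such that al 0 = s,
   be 0 = t, the children of the n-th interval have indices 2n+1 and 2n+2, and
   |be n - al n| <= 2 / (n + 1).  For a sequence q of points write pi_q f for the
   operator diag (f (q n)).  If q n - al n is O(1 / n), then pi_q f - pi_al f is a
   bounded operator times diag (1 / (n + 1)), hence lies in J(H) since J is harmonic.
   So f |-> pi_q f is a section sec_q of the split extension
     0 -> J(H) -> D -> C[0,1] -> 0,   D = {pi_al f + j},
   and all of this can be tensored with A.
   Let V be the isometry g_n |-> g_{2n+1} or g_n |-> g_{2n+2}.  Conjugation by V is
   trivial under E on A (x) J(H), by M_2-stability, and extends to D; as E is split
   exact, this relates E(sec_q) for the sequences obtained from al, be, mi by moving
   along the tree.  The two shifts together give E(sec_al) = E(sec_al'), where al'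
   is al with its root al 0 = s replaced by t.  But sec_al and sec_al' are
   orthogonal sums of a common homomorphism with ev_s, resp. ev_t, followed by
   a |-> a (x) e, e the rank one projection onto g_0.  Hence E(ev_s) and E(ev_t) agree
   after a |-> a (x) e; e may be replaced by any minimal idempotent of J(H), again by
   M_2-stability, and weak J-stability gives the claim. *)

Set Implicit Arguments.
Unset Strict Implicit.
Unset Printing Implicit Defensive.

Import Order.TTheory GRing.Theory Num.Theory.
Import numFieldNormedType.Exports.

Local Open Scope classical_set_scope.
Local Open Scope ring_scope.
Local Open Scope complex_scope.

(** * Duality of locally convex spaces *)

(** The stability hypotheses speak about all models of a tensor product, so models of A (x)^ J(H)
    and A (x)^ D must be shown to exist; the duality theory below serves to construct them. The
    bookkeeping of the two shifts: write [q] for E(sec_q). If ga (s n) = al n for a shift s, the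
    extended conjugation sends sec_al to sec_ga and sec_q to sec_q', where q' is q transported along
    s and equal to ga off the image of s; hence [q'] - [ga] = [q] - [al]. As mi n is both the right
    end of the left half and the left end of the right half of the n-th interval, both shifts carry
    mi to one and the same sequence g1, with ga = al' for the left shift and another sequence ga =
    g2 for the right one. The right shift also carries be to itself, again with ga = g2, so [g2] =
    [al]; comparing the two equations for g1 leaves [al'] = [al]. Breadth-first numbering of a
    dyadic tree gives lengths O(1 / n), the decay that a harmonic ideal can absorb. *)

Section TopologicalVectorSpaces.
Variable R : realType.
Local Notation C := R[i].
Local Notation nm := (@ComplexField.Normc.normc R).

Section LinearFunctions.
Variables (V W : lmodType C) (f : V -> W).
Hypothesis lf : linear f.

Lemma lin0 : f 0 = 0.
Proof. by have := lf (-1) 0 0; rewrite scaler0 addr0 scaleN1r addNr. Qed.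

Lemma linD x y : f (x + y) = f x + f y.
Proof. by have := lf 1 x y; rewrite !scale1r. Qed.

Lemma linZ c x : f (c *: x) = c *: f x.
Proof. by have := lf c x 0; rewrite lin0 !addr0. Qed.

Lemma linN x : f (- x) = - f x.
Proof. by rewrite -scaleN1r linZ scaleN1r. Qed.

Lemma linB x y : f (x - y) = f x - f y.
Proof. by rewrite linD linN. Qed.

Lemma lin_sum (I : Type) (r : seq I) (P : pred I) (F : I -> V) :
  f (\sum_(i <- r | P i) F i) = \sum_(i <- r | P i) f (F i).
Proof. exact: (big_morph f linD lin0). Qed.

End LinearFunctions.

Section Neighbourhoods.
Variable V : tvsType C.
Implicit Types (U : set V) (x y : V).

Lemma nbhs0_add U : nbhs 0 U ->
  exists2 W, nbhs 0 W & forall x y, W x -> W y -> U (x + y).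
Proof.
move=> U0; have := @add_continuous V (0, 0) U; rewrite /= addr0 => /(_ U0).
move=> [[W1 W2] /= [h1 h2] h]; exists (W1 `&` W2); first exact: filterI.
by move=> x y [x1 _] [_ y2]; apply: (h (x, y)).
Qed.

Lemma nbhs0_scale U : nbhs 0 U ->
  exists2 e : R, 0 < e & exists2 W, nbhs 0 W &
    forall c x, nm c < e -> W x -> U (c *: x).
Proof.
move=> U0; have := @scale_continuous C V (0, 0) U; rewrite /= scaler0 => /(_ U0).
move=> [[W1 W2] /= [/nbhs_ballP[e /= e0 he] h2] h].
have e1 : 0 < complex.Re e by move: e0; case: (e) => e1 e2; rewrite ltcE /= => /andP[_].
have eE : e = (complex.Re e)%:C.
  by case: (e) e0 => a b; rewrite ltcE /= => /andP[/eqP ->].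
exists (complex.Re e) => //; exists W2 => // c x ce Wx; apply: (h (c, x)).
by split=> //; apply: he; rewrite -ball_normE /= sub0r normrN eE ltcnm.
Qed.

(** [W] is the largest balanced part of [U]. It is a neighbourhood because it contains a multiple of
    a set whose multiples by scalars below [e] all lie in [U]. *)
Lemma nbhs0_balanced U : nbhs 0 U ->
  exists2 W, nbhs 0 W & (forall c x, nm c <= 1 -> W x -> W (c *: x)) /\
    W `<=` U.
Proof.
move=> /nbhs0_scale[e e0 [W W0 h]].
exists [set x | forall c, nm c <= 1 -> U (c *: x)]; last first.
  split=> [c x c1 hx d d1|x /(_ 1)].
    by rewrite scalerA; apply: hx; rewrite nmM mulr_ile1 ?nm_ge0.
  by rewrite scale1r; apply; rewrite nm1.
have e2 : (e / 2)%:C != 0 :> C by rewrite fmorph_eq0 gt_eqF// divr_gt0.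
apply: filterS (nbhs0Z e2 W0) => _ [x Wx <-] c c1; rewrite scalerA.
apply: h => //; rewrite nmM nm_real gtr0_norm ?divr_gt0//.
apply: (@le_lt_trans _ _ (e / 2)); last by rewrite gtr_pMr// invf_lt1// ltr1n.
by rewrite ler_piMl// divr_ge0// ltW.
Qed.

Lemma nbhs0_absorb U x : nbhs 0 U ->
  exists2 r : R, 0 < r & forall c, nm c < r -> U (c *: x).
Proof.
move=> U0; have := @scale_continuous C V (0, x) U; rewrite /= scale0r => /(_ U0).
move=> [[W1 W2] /= [/nbhs_ballP[e /= e0 he] h2] h].
have e1 : 0 < complex.Re e by move: e0; case: (e) => e1 e2; rewrite ltcE /= => /andP[_].
have eE : e = (complex.Re e)%:C.
  by case: (e) e0 => a b; rewrite ltcE /= => /andP[/eqP ->].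
exists (complex.Re e) => // c ce; apply: (h (c, x)); split.
  by apply: he; rewrite -ball_normE /= sub0r normrN eE ltcnm.
exact: nbhs_singleton.
Qed.

Lemma nbhs_to0P x U : nbhs x U <-> nbhs 0 [set y | U (x + y)].
Proof.
split=> [Ux|U0].
  have := nbhsB (- x) Ux; rewrite addNr; apply: filterS => _ [y Uy <-] /=.
  by rewrite addrA subrr add0r.
have := nbhsT x U0; apply: filterS => _ [y Uy <-]; exact: Uy.
Qed.

End Neighbourhoods.

Lemma linear_continuous0 (V W : tvsType C) (f : V -> W) : linear f ->
  (forall U, nbhs 0 U -> exists2 N, nbhs 0 N & forall x, N x -> U (f x)) ->
  continuous f.
Proof.
move=> lf h x U /nbhs_to0P /h[N N0 hN]; apply/nbhs_to0P; apply: filterS N0 => y /hN /=.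
by rewrite /= (linD lf).
Qed.

Lemma linear_continuousP (V W : tvsType C) (f : V -> W) U : linear f ->
  continuous f -> nbhs 0 U -> nbhs 0 [set x | U (f x)].
Proof. by move=> lf cf U0; apply: cf; rewrite (lin0 lf). Qed.

(** In the expansion of [b x y - b v w] two terms have a fixed entry, [v] or [w]. A small multiple
    of that entry lies in the given neighbourhood, and the factor is moved across to the other
    argument. *)
Lemma bilinear_continuous0 (V W X : tvsType C) (b : V -> W -> X) :
  (forall v, linear (b v)) -> (forall w, linear (b^~ w)) ->
  (forall U, nbhs 0 U -> exists2 N, nbhs 0 N & exists2 M, nbhs 0 M &
    forall x y, N x -> M y -> U (b x y)) ->
  continuous (fun z : V * W => b z.1 z.2).
Proof.
move=> l1 l2 h [v w] U /= /nbhs_to0P U0.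
have [U1 U10 h1] := nbhs0_add U0; have [U2 U20 h2] := nbhs0_add U10.
have [N N0 [M M0 NM]] := h _ U20.
have [N' N'0 [bN sN]] := nbhs0_balanced N0.
have [M' M'0 [bM sM]] := nbhs0_balanced M0.
have [r r0 hr] := nbhs0_absorb v N'0; have [s s0 hs] := nbhs0_absorb w M'0.
have r2 : (r / 2)%:C != 0 :> C by rewrite fmorph_eq0 gt_eqF// divr_gt0.
have s2 : (s / 2)%:C != 0 :> C by rewrite fmorph_eq0 gt_eqF// divr_gt0.
(* The second set in [A] and in [B] serves the mixed terms: if [x - v] is [s / 2] times [x'], then
   [b (x - v) w] is [b x'] at [s / 2] times [w], a point of [M']. *)
pose A := N' `&` [set (s / 2)%:C *: x | x in N'].
pose B := M' `&` [set (r / 2)%:C *: x | x in M'].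
have half (e : R) : 0 < e -> nm (e / 2)%:C < e.
  by move=> e0; rewrite nm_real gtr0_norm ?divr_gt0// gtr_pMr// invf_lt1// ltr1n.
exists ([set x | A (x - v)], [set y | B (y - w)]).
  split; apply/nbhs_to0P.
    have : nbhs 0 A by apply: filterI => //; exact: nbhs0Z.
    by apply: filterS => x /=; rewrite addrC addKr.
  have : nbhs 0 B by apply: filterI => //; exact: nbhs0Z.
  by apply: filterS => x /=; rewrite addrC addKr.
move=> [x y] /= [[Nx [x' Nx' xE]] [My [y' My' yE]]].
have -> : b x y = b v w + ((b v (y - w) + b (x - v) w) + b (x - v) (y - w)).
  rewrite !(linB (l1 _)) !(linB (l2 _)) /=.
  move: (b x y) (b v w) (b v y) (b x w) => p q a c.
  rewrite [_ + (_ - (c - q))]addrACA subrr addr0.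
  by rewrite [a - q + _]addrC subrKA addrC subrK.
have e3 : U2 (b (x - v) (y - w)) by apply: NM; [exact: sN|exact: sM].
have e1 : U2 (b v (y - w)).
  rewrite -yE (linZ (l1 _)) -(linZ (l2 _)); apply: NM; last exact: sM.
  by apply: sN; apply: hr; exact: half.
have e2 : U2 (b (x - v) w).
  rewrite -xE (linZ (l2 _)) -(linZ (l1 _)); apply: NM; first exact: sN.
  by apply: sM; apply: hs; exact: half.
apply: h1; first exact: h2.
by rewrite -[b _ _]addr0; apply: h2 => //; exact: nbhs_singleton.
Qed.

(** * The Hahn-Banach theorem for complex seminorms *)

Section HahnBanach.
Variable V : lmodType C.
Implicit Types (p q : V -> R) (x y : V).

Definition sublinear p : Prop :=
  (forall x y, p (x + y) <= p x + p y) /\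
  (forall (r : R) x, 0 < r -> p (r%:C *: x) = r * p x).

Lemma sublinear0 p : sublinear p -> p 0 = 0.
Proof.
move=> [_ h]; have := h 2 0 (ltr0Sn _ 1); rewrite scaler0 mulr_natl mulr2n.
by move=> /eqP; rewrite -subr_eq0 opprD addrA subrr sub0r oppr_eq0 => /eqP.
Qed.

Lemma sublinearN p x : sublinear p -> - p (- x) <= p x.
Proof.
move=> h; rewrite -subr_ge0 opprK.
by have [+ _] := h; move=> /(_ x (- x)); rewrite subrr sublinear0.
Qed.

Lemma sublinear_ge0 p (r : R) x : sublinear p -> 0 <= r ->
  p (r%:C *: x) = r * p x.
Proof.
move=> h; rewrite le_eqVlt => /orP[/eqP <-|r0]; last by have [_] := h; exact.
by rewrite scale0r mul0r sublinear0.
Qed.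

(* A minimal sublinear [q] coincides with the [q'] below for every [y], hence is
   additive. *)
Lemma sublinear_ray q y : sublinear q ->
  let q' x := inf [set q (x + t%:C *: y) - t * q y | t in [set t : R | 0 <= t]] in
  sublinear q' /\ forall x (t : R), 0 <= t -> q' x <= q (x + t%:C *: y) - t * q y.
Proof.
move=> hq q'; have [qD qZ] := hq.
have lb x : lbound [set q (x + t%:C *: y) - t * q y | t in [set t : R | 0 <= t]]
    (- q (- x)).
  move=> _ [t /= t0 <-]; rewrite -(sublinear_ge0 y hq t0) lerBrDl lerBlDr.
  apply: le_trans (qD _ _); rewrite addrC addrA addNr add0r.
  by rewrite lexx.
have hi x : has_inf [set q (x + t%:C *: y) - t * q y | t in [set t : R | 0 <= t]].
  by split; [exists (q (x + 0%:C *: y) - 0 * q y), 0 => /=|exists (- q (- x))].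
have le x (t : R) : 0 <= t -> q' x <= q (x + t%:C *: y) - t * q y.
  by move=> t0; apply: ge_inf; [case: (hi x)|exists t].
have ge x z : (forall t : R, 0 <= t -> z <= q (x + t%:C *: y) - t * q y) -> z <= q' x.
  by move=> h; apply: lb_le_inf; [case: (hi x)|move=> _ [t /= t0 <-]; exact: h].
split=> //; split.
  move=> x x'; rewrite -lerBlDr; apply: (ge _ _) => t t0.
  rewrite lerBlDl -lerBlDr; apply: ge => t' t'0; rewrite lerBlDl.
  apply: (le_trans (le _ _ (addr_ge0 t0 t'0))).
  rewrite mulrDl opprD addrACA lerD2r.
  by rewrite rmorphD scalerDl addrACA qD.
have half (r : R) x : 0 < r -> q' (r%:C *: x) <= r * q' x.
  move=> r0; rewrite -ler_pdivrMl//; apply: ge => t t0.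
  rewrite ler_pdivrMl//; apply: (le_trans (le _ _ (mulr_ge0 (ltW r0) t0))).
  by rewrite rmorphM -scalerA -scalerDr qZ// mulrBr mulrA.
move=> r x r0; apply/eqP; rewrite eq_le half//=.
rewrite -ler_pdivlMl//; apply: le_trans (half _ _ _); last by rewrite invr_gt0.
by rewrite scalerA -rmorphM mulVf ?gt_eqF// scale1r.
Qed.

(** Zorn's lemma for the reversed pointwise order: the infimum of a chain is again sublinear, and it
    is finite since every member is at least [- p (- x)] at [x]. *)
Lemma sublinear_minimal p : sublinear p ->
  exists2 q, (sublinear q /\ forall x, q x <= p x) &
    forall q', sublinear q' -> (forall x, q' x <= q x) -> q' = q.
Proof.
move=> hp; pose T := {q | sublinear q /\ forall x, q x <= p x}.
pose le (q q' : T) := `[< forall x, sval q' x <= sval q x >].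
have [t ht] : exists t, forall s, le t s -> s = t.
  apply: Zorn.
  - by move=> t; apply/asboolP => x.
  - move=> r s t /asboolP rs /asboolP st; apply/asboolP => x.
    exact: le_trans (rs x).
  - move=> [s hs] [t ht] /asboolP st /asboolP ts; apply: eq_exist; apply/funext => x.
    by apply/eqP; rewrite eq_le st ts.
  move=> A tA; have [[s0 As0]|A0] := pselect (exists s, A s); last first.
    by exists (exist _ p (conj hp (fun=> lexx _))) => s As; case: A0; exists s.
  pose S x := [set sval s x | s in A].
  have hi x : has_inf (S x).
    split; first by exists (sval s0 x), s0.
    exists (- p (- x)) => _ [s As <-].
    have [h hs] := svalP s; apply: le_trans (sublinearN x h).
    by rewrite lerN2.
  have lei x s : A s -> inf (S x) <= sval s x.
    by move=> As; apply: ge_inf; [case: (hi x)|exists s].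
  have gei x z : (forall s, A s -> z <= sval s x) -> z <= inf (S x).
    by move=> h; apply: lb_le_inf; [case: (hi x)|move=> _ [s As <-]; exact: h].
  have sS : sublinear (fun x => inf (S x)) /\ forall x, inf (S x) <= p x.
    split; last by move=> x; apply: (le_trans (lei x _ As0)); have [] := svalP s0.
    split=> [x y|r x r0].
      rewrite -lerBlDr; apply: (gei _ _) => s As; rewrite lerBlDl -lerBlDr.
      apply: gei => s' As'; rewrite lerBlDl.
      have [/asboolP h|/asboolP h] := tA _ _ As As'.
        apply: (le_trans (lei _ _ As')); have [[+ _] _] := svalP s'.
        by move=> /(_ x y) /le_trans; apply; rewrite lerD2r.
      apply: (le_trans (lei _ _ As)); have [[+ _] _] := svalP s.
      by move=> /(_ x y) /le_trans; apply; rewrite lerD2l.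
    apply/eqP; rewrite eq_le; apply/andP; split.
      rewrite -ler_pdivrMl//; apply: gei => s As; rewrite ler_pdivrMl//.
      apply: (le_trans (lei _ _ As)); have [[_ ->//] _] := svalP s.
    apply: gei => s As; have [[_ ->//] _] := svalP s.
    by rewrite ler_pM2l// lei.
  by exists (exist _ (fun x => inf (S x)) sS) => s As; apply/asboolP => x; exact: lei.
have [h hp'] := svalP t; exists (sval t) => // q hq qt.
have sq : sublinear q /\ forall x, q x <= p x.
  by split=> // x; exact: le_trans (hp' x).
by rewrite -(ht (exist _ q sq))//; apply/asboolP.
Qed.

(** A minimal sublinear functional [q] is real linear, and [q x - i q (i x)] is the complex linear
    functional with real part [q]. *)
Lemma hahn_banach p (x0 : V) :
  (forall x y, p (x + y) <= p x + p y) ->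
  (forall c x, p (c *: x) = nm c * p x) ->
  exists phi : V -> C^o, [/\ linear phi, forall x, nm (phi x) <= p x &
    p x0 <= nm (phi x0)].
Proof.
move=> pD pZ; have hp : sublinear p.
  by split=> // r x r0; rewrite pZ nm_real gtr0_norm.
(* Minimising below this functional, not just below [p], is what makes the result norming at [x0]:
   its value at [- x0] is at most [- p x0], hence [q x0] is at least [p x0]. *)
have [hp0 p0le] := sublinear_ray x0 hp.
have [q [hq qp0] qmin] := sublinear_minimal hp0.
have [qD qZ] := hq.
have {qmin} qD' x y : q (x + y) = q x + q y.
  apply/eqP; rewrite eq_le qD/=.
  have [h1 h2] := sublinear_ray y hq.
  have := qmin _ h1; move=> /(_ _)/funeqP <-//.
    by rewrite -lerBrDr; have := h2 x 1 ler01; rewrite scale1r mul1r.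
  by move=> z; have := h2 z 0 (lexx _); rewrite scale0r mul0r addr0 subr0.
have q0 : q 0 = 0 by exact: sublinear0.
have qN x : q (- x) = - q x.
  by apply/eqP; rewrite -addr_eq0 -qD' addNr q0.
have qle x : q x <= p x.
  apply: (le_trans (qp0 x)); have := p0le x 0 (lexx _).
  by rewrite scale0r mul0r addr0 subr0.
have qx0 : p x0 <= q x0.
  rewrite -[q _]opprK -qN lerNr; apply: (le_trans (qp0 _)).
  have := p0le (- x0) 1 ler01; rewrite scale1r mul1r addNr.
  by rewrite sublinear0// sub0r.
have qR (r : R) x : q (r%:C *: x) = r * q x.
  have [r0|r0] := leP 0 r; first exact: sublinear_ge0.
  rewrite -[r]opprK rmorphN scaleNr qN qZ ?oppr_gt0// mulNr.
  by rewrite !opprK.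
pose phi x : C^o := q x +i* - q ('i *: x).
have phiD x y : phi (x + y) = phi x + phi y.
  by rewrite /phi scalerDr !qD' opprD; simpc.
have qi x : q ('i *: ('i *: x)) = - q x.
  by rewrite scalerA -expr2 sqr_i scaleN1r qN.
have phiZ c x : phi (c *: x) = c *: phi x.
  case: c => a b; have -> : a +i* b = a%:C + b%:C * 'i by simpc.
  rewrite /phi scalerDl scalerDr -!scalerA !scalerA !['i * _]mulrC.
  rewrite -!scalerA !qD' !qR qi -[RHS]/(_ * _); simpc.
  by [].
have phile x : nm (phi x) <= p x.
  have [->|z0] := eqVneq (phi x) 0.
    rewrite nm0; have := pD x (- x); rewrite subrr -[- x]scaleN1r pZ nmN nm1 mul1r.
    by rewrite -[0 : V](scale0r 0) pZ nm0 mul0r -mulr2n pmulrn_lge0.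
  have n0 : nm (phi x) != 0 by apply: contra z0 => /eqP/ComplexField.Normc.eq0_normc ->.
  (* Rotating [x] by a scalar of modulus 1 makes [phi] real and nonnegative there, so the bound on
     [q] is enough. *)
  pose c := ((nm (phi x))%:C / phi x : C).
  have c1 : nm c = 1 by rewrite nmM nm_real ger0_norm ?nm_ge0// ComplexField.Normc.normcV mulfV.
  have : phi (c *: x) = (nm (phi x))%:C.
    by rewrite phiZ -[_ *: _]/(c * phi x) divfK.
  move=> /(congr1 (@complex.Re R)) /= <-.
  by rewrite (le_trans (qle _))// pZ c1 mul1r.
exists phi; split=> //; first by move=> c x y; rewrite phiD phiZ.
by apply: (le_trans qx0); apply: le_trans (nm_Re (phi x0)); rewrite /= ler_norm.
Qed.

End HahnBanach.

Section Polars.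
Variable V : tvsType C.
Implicit Types (U : set V) (x y : V).

(** [p] is the Minkowski gauge of the balanced core of a convex basic set [b]; the scalars [c] in
    [S] make it homogeneous for complex factors, not only positive ones. *)
Lemma nbhs0_seminorm U : nbhs 0 U -> exists p : V -> R,
  [/\ forall x y, p (x + y) <= p x + p y,
      forall c x, p (c *: x) = nm c * p x,
      forall x, p x < 1 -> U x &
      nbhs 0 [set x | p x <= 1]].
Proof.
move=> U0; have [B Bc [Bo Bb]] := @locally_convex C V.
have [b [Bb' b0] bU] := Bb 0 U U0.
have nb0 : nbhs 0 b by apply: open_nbhs_nbhs; split=> //; exact: Bo.
have {Bc} bc x y (l m : R) : 0 <= l -> 0 <= m -> l + m = 1 -> b x -> b y ->
    b (l%:C *: x + m%:C *: y).
  move=> l0 m0 lm bx by'.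
  have l01 : Itv.spec (@Itv.num_sem C) (Itv.Real `[0%Z, 1%Z]) l%:C.
    rewrite /= /Itv.num_sem /= realE !lecR /= in_itv /= !lecR l0 /=.
    by rewrite -lm lerDl.
  have := Bc b; rewrite inE => /(_ Bb' x y (Itv.mk l01)); rewrite !inE => /(_ bx by').
  have <- : 1 - l%:C = m%:C by rewrite -[1]/(1%:C) -rmorphB -lm addrC addKr.
  exact.
have [W W0 [bW Wb]] := nbhs0_balanced nb0.
pose S x := [set t : R | 0 < t /\ forall c, nm c <= 1 -> b ((c * t^-1%:C) *: x)].
pose p x := inf (S x).
have S_ex x : exists t, S x t.
  have [r r0 hr] := nbhs0_absorb x nb0; exists (2 / r); split; first exact: divr_gt0.
  move=> c c1; apply: hr; rewrite nmM nm_real invf_div gtr0_norm ?divr_gt0//.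
  apply: (@le_lt_trans _ _ (r / 2)); first by rewrite ler_piMl// divr_ge0// ltW.
  by rewrite gtr_pMr// invf_lt1// ltr1n.
have hi x : has_inf (S x).
  by split; [exact: S_ex|exists 0 => t [/ltW]].
have le x t : S x t -> p x <= t by move=> St; apply: ge_inf => //; case: (hi x).
have ge x z : (forall t, S x t -> z <= t) -> z <= p x.
  by move=> h; apply: lb_le_inf => //; case: (hi x).
have p_ge0 x : 0 <= p x by apply: (ge _ _) => t [/ltW].
have p0 : p 0 = 0.
  apply/eqP; rewrite eq_le p_ge0 andbT; apply/ler_addgt0Pr => e e0.
  by rewrite add0r; apply: le; split=> // c _; rewrite scaler0.
have pZ' c x : c != 0 -> p (c *: x) <= nm c * p x.
  move=> c0; have n0 : 0 < nm c.
    rewrite lt_neqAle nm_ge0 andbT eq_sym.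
    by apply: contra c0 => /eqP/ComplexField.Normc.eq0_normc ->.
  rewrite -ler_pdivrMl//; apply: (ge _ _) => t [t0 ht]; rewrite ler_pdivrMl//.
  apply: le; split=> [|d d1]; first exact: mulr_gt0.
  rewrite scalerA; have -> : d * (nm c * t)^-1%:C * c =
      (d * (c / (nm c)%:C)) * t^-1%:C.
    rewrite invfM rmorphM /= (fmorphV _ (nm c)).
    by move: (_^-1) (_^-1)%:C => u v; ring.
  apply: ht; rewrite !nmM ComplexField.Normc.normcV nm_real gtr0_norm// divff ?gt_eqF//.
  by rewrite mulr1.
exists p; split.
- move=> x y; rewrite -lerBlDr; apply: (ge _ _) => t [t0 ht].
  rewrite lerBlDl -lerBlDr; apply: (ge _ _) => s [s0 hs]; rewrite lerBlDl.
  have st0 : t + s != 0 by rewrite gt_eqF// addr_gt0.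
  apply: le; split=> [|c c1]; first exact: addr_gt0.
  have -> : (c * (t + s)^-1%:C) *: (x + y) =
      (t / (t + s))%:C *: ((c * t^-1%:C) *: x) + (s / (t + s))%:C *: ((c * s^-1%:C) *: y).
    rewrite scalerDr !scalerA; congr (_ *: _ + _ *: _).
      by rewrite mulrCA -rmorphM mulrAC mulfV ?gt_eqF// mul1r.
    by rewrite mulrCA -rmorphM mulrAC mulfV ?gt_eqF// mul1r.
  apply: bc; rewrite ?divr_ge0 ?addr_ge0 ?(ltW t0) ?(ltW s0)//.
  + by rewrite -mulrDl mulfV.
  + exact: ht.
  + exact: hs.
- move=> c x; have [->|c0] := eqVneq c 0; first by rewrite scale0r nm0 mul0r.
  apply/eqP; rewrite eq_le pZ'//=.
  have n0 : 0 < nm c.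
    rewrite lt_neqAle nm_ge0 andbT eq_sym.
    by apply: contra c0 => /eqP/ComplexField.Normc.eq0_normc ->.
  rewrite -ler_pdivlMl// -ComplexField.Normc.normcV.
  apply: le_trans (pZ' _ _ _); last by rewrite invr_eq0.
  by rewrite scalerA mulVf// scale1r.
- move=> x /inf_lt [//|t [t0 ht] t1]; apply: bU.
  have := ht t%:C; rewrite -rmorphM mulfV ?gt_eqF// scale1r; apply.
  by rewrite nm_real gtr0_norm// ltW.
- apply: filterS W0 => x Wx; apply: le; split=> // c c1.
  by rewrite invr1 mulr1; apply: Wb; exact: bW.
Qed.

(** A form of the bipolar theorem: functionals bounded by 1 on one fixed [W] detect membership in
    [U]. It reduces Cauchy and continuity questions in arbitrary spaces to scalar ones. *)
Lemma nbhs0_polar U : nbhs 0 U -> exists2 W, nbhs 0 W &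
  forall x, (forall phi : V -> C^o, linear phi -> continuous phi ->
    (forall y, W y -> nm (phi y) <= 1) -> nm (phi x) <= 1) -> U x.
Proof.
move=> U0; have [p [pD pZ pU p1]] := nbhs0_seminorm U0.
have half0 : (2^-1)%:C != 0 :> C by rewrite fmorph_eq0 invr_eq0 pnatr_eq0.
(* With radius 1/2, twice [phi] is still bounded by 1 on this set. The conclusion is then
   [p x <= 1/2], which leaves room for the strict bound required by [pU]. *)
exists [set x | p x <= 2^-1].
  apply: filterS (nbhs0Z half0 p1) => _ [x /= px <-].
  by rewrite pZ nm_real gtr0_norm ?invr_gt0// ler_piMr// invr_ge0.
move=> x hx; apply: pU.
have [phi [lphi phip xphi]] := hahn_banach x pD pZ.
have le1 y : p y <= 2^-1 -> nm (2%:C * phi y) <= 1.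
  move=> py; rewrite nmM nm_real normr_nat -ler_pdivlMl// mulr1.
  exact: le_trans (phip y) py.
have l2 : linear (fun y => 2%:C * phi y : C^o).
  by move=> c y z; rewrite lphi mulrDr -[c *: phi y]/(c * phi y) mulrCA.
have : nm (2%:C * phi x) <= 1.
  apply: (hx (fun y => 2%:C * phi y : C^o)) => //.
  apply: linear_continuous0 => // N /nbhs_ballP[e /= e0 hN].
  have e1 : 0 < complex.Re e by move: e0; case: (e) => a b; rewrite ltcE /= => /andP[_].
  have eE : e = (complex.Re e)%:C.
    by case: (e) e0 => a b; rewrite ltcE /= => /andP[/eqP ->].
  have r0 : (complex.Re e / 4)%:C != 0 :> C by rewrite fmorph_eq0 gt_eqF// divr_gt0.
  exists [set (complex.Re e / 4)%:C *: y | y in [set x | p x <= 1]].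
    exact: nbhs0Z.
  move=> _ [y /= py <-]; apply: hN; rewrite -ball_normE /= sub0r normrN eE ltcnm.
  rewrite (linZ lphi) -[_ *: _]/(_ * phi y) !nmM !nm_real normr_nat.
  rewrite gtr0_norm ?divr_gt0// mulrA.
  apply: (@le_lt_trans _ _ (2 * (complex.Re e / 4))).
    by rewrite ler_piMr ?mulr_ge0 ?divr_ge0 ?(ltW e1)// (le_trans (phip y)).
  by rewrite mulrCA gtr_pMr// -[ltRHS](@divff _ 4%:R) ?pnatr_eq0// ltr_pM2r ?invr_gt0// ltr_nat.
rewrite nmM nm_real normr_nat -ler_pdivlMl// mulr1 => h.
by apply: (le_lt_trans (le_trans xphi h)); rewrite invf_lt1// ltr1n.
Qed.

End Polars.
End TopologicalVectorSpaces.

(** * Completed projective tensor products *)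

Section ProjectiveTensorProduct.
Variable R : realType.
Local Notation C := R[i].
Local Notation nm := (@ComplexField.Normc.normc R).

Lemma nm_ball (e : C) (z : C^o) : 0 < e -> ball (0 : C^o) e z <-> nm z < complex.Re e.
Proof.
case: e => a b; rewrite ltcE /= => /andP[/eqP -> a0].
by rewrite -ball_normE /= sub0r normrN -[a +i* 0]/(a%:C) ltcnm.
Qed.

Lemma ltc_Re (e : C) : 0 < e -> 0 < complex.Re e.
Proof. by case: e => a b; rewrite ltcE /= => /andP[_]. Qed.

Lemma nbhs0_CP (U : set C^o) : nbhs (0 : C^o) U <->
  exists2 e : R, 0 < e & forall z, nm z < e -> U z.
Proof.
split=> [/nbhs_ballP[e /= e0 h]|[e e0 h]].
  by exists (complex.Re e); [exact: ltc_Re|move=> z ze; apply/h/nm_ball].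
apply/nbhs_ballP; exists e%:C; first by rewrite /= ltcR.
by move=> z /nm_ball; rewrite ltcR => /(_ e0); exact: h.
Qed.

Lemma C_complete : tvs_complete (C^o : tvsType C).
Proof.
move=> F FF cF; apply/cvg_ex; apply: complex_cauchy_cvg; apply/cauchy_ballP => e e0.
have [|A FA hA] := cF (ball (0 : C^o) e); first exact: nbhsx_ballx.
exists (A, A) => //= -[x y] /= [Ax Ay].
have := hA _ _ Ay Ax; rewrite -!ball_normE /= sub0r normrN.
by rewrite distrC.
Qed.

Definition C_lcs : lcs R := Lcs (@norm_hausdorff C C^o) C_complete.

Lemma eq_functionals (X : lcs R) (x y : X) :
  (forall phi : X -> C_lcs, linear phi -> continuous phi -> phi x = phi y) -> x = y.
Proof.
move=> h; apply: (@lcs_hausdorff _ X) => P Q /nbhs_to0P P0 Qy.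
exists y; split; last exact: nbhs_singleton.
suff : [set y | P (x + y)] (y - x) by rewrite /= addrC subrK.
have [W W0 hW] := nbhs0_polar P0; apply: hW => phi lp cp _.
by rewrite (linB lp) (h phi lp cp) subrr nm0.
Qed.

(** * Tensors as functionals on bilinear forms *)

Section Forms.
Variables A B : lcs R.
Implicit Types (U : set A) (V : set B).

Record form := Form {
  form_fun :> A -> B -> C_lcs;
  form_bilinear : cont_bilinear form_fun }.

Lemma form_ext (w w' : form) : (forall a b, w a b = w' a b) -> w = w'.
Proof.
case: w w' => [f hf] [g hg] /= h.
have fg : f = g by apply/funext => a; apply/funext => b.
by move: hf hg; rewrite fg => hf hg; congr Form; exact: Prop_irrelevance.
Qed.

Lemma form0l (w : form) b : w 0 b = 0.
Proof. by have [_ l _] := form_bilinear w; exact: (lin0 (l b)). Qed.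

Lemma formZl (w : form) c a b : w (c *: a) b = c *: w a b.
Proof. by have [_ l _] := form_bilinear w; exact: (linZ (l b)). Qed.

(* Unit balls of the seminorms on forms; since a continuous bilinear form is
   bounded by 1 on some [U `*` V], these cover all forms. *)
Definition fball U V (w : form) : Prop :=
  forall a b, U a -> V b -> nm (w a b) <= 1.

Lemma fball_sub U U' V V' w : U' `<=` U -> V' `<=` V ->
  fball U V w -> fball U' V' w.
Proof. by move=> uu vv h a b /uu ? /vv ?; exact: h. Qed.

Lemma fball_ex (w : form) : exists U V, [/\ nbhs 0 U, nbhs 0 V & fball U V w].
Proof.
have [_ _ c] := form_bilinear w.
have : nbhs (0 : C^o) [set z | nm z < 1] by apply/nbhs0_CP; exists 1.
rewrite -(form0l w 0) => /(c (0, 0))[[U V] /= [U0 V0] h].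
exists U, V; split=> // a b Ua Vb; apply: ltW; exact: (h (a, b)).
Qed.

Implicit Types u v : form -> C^o.

Definition unear U V (e : R) u : Prop := forall w, fball U V w -> nm (u w) <= e.

Definition tsum (s : seq (A * B)) : form -> C^o :=
  fun w => \sum_(z <- s) w z.1 z.2.

Definition tapprox u : Prop := forall U V (e : R), nbhs 0 U -> nbhs 0 V -> 0 < e ->
  exists s, unear U V e (u - tsum s).

Lemma unear0 U V (e : R) : 0 <= e -> unear U V e 0.
Proof. by move=> e0 w _; rewrite -[(0 : form -> C^o) w]/(0 : C) nm0. Qed.

Lemma unearD U V (e e' : R) u v : unear U V e u -> unear U V e' v ->
  unear U V (e + e') (u + v).
Proof.
by move=> hu hv w hw; apply: (le_trans (nmD _ _)); rewrite lerD ?hu ?hv.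
Qed.

Lemma unearZ U V (e : R) c u : unear U V e u -> unear U V (nm c * e) (c *: u).
Proof.
move=> hu w hw; rewrite -[(c *: u) w]/(c * u w) nmM.
by rewrite ler_wpM2l ?nm_ge0 ?hu.
Qed.

Lemma unearN U V (e : R) u : unear U V e u -> unear U V e (- u).
Proof. by move=> /(unearZ (-1)); rewrite scaleN1r nmN nm1 mul1r. Qed.

Lemma unear_sub U U' V V' (e e' : R) u : U' `<=` U -> V' `<=` V -> e' <= e ->
  unear U' V' e' u -> unear U V e u.
Proof.
by move=> uu vv ee hu w hw; apply: le_trans ee; apply/hu/(fball_sub uu vv).
Qed.

Lemma tsum_unear s U V : nbhs 0 U -> nbhs 0 V ->
  exists2 M : R, 0 < M & unear U V M (tsum s).
Proof.
move=> U0 V0; elim: s => [|[a b] s [M M0 hM]].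
  by exists 1 => // w hw; rewrite /tsum big_nil nm0.
have [r r0 hr] := nbhs0_absorb a U0; have [r' r'0 hr'] := nbhs0_absorb b V0.
have half (e : R) : 0 < e -> nm (e / 2)%:C < e.
  by move=> e0; rewrite nm_real gtr0_norm ?divr_gt0// gtr_pMr// invf_lt1// ltr1n.
exists ((r / 2 * (r' / 2))^-1 + M).
  by rewrite addr_gt0// invr_gt0 mulr_gt0// divr_gt0.
move=> w hw; rewrite /tsum big_cons; apply: (le_trans (nmD _ _)).
apply: lerD; last exact: hM.
have := hw _ _ (hr _ (half _ r0)) (hr' _ (half _ r'0)).
have [l1 l2 _] := form_bilinear w.
rewrite (linZ (l1 _)) (linZ (l2 _)) -[_ *: _]/(_ * (_ * w a b)) !nmM !nm_real.
rewrite !gtr0_norm ?divr_gt0// mulrA -ler_pdivlMl ?mulr1.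
  by rewrite [r / 2 * _]mulrC.
by rewrite mulr_gt0// divr_gt0.
Qed.

Lemma tapprox_unear u U V : tapprox u -> nbhs 0 U -> nbhs 0 V ->
  exists2 M : R, 0 < M & unear U V M u.
Proof.
move=> hu U0 V0; have [s hs] := hu U V 1 U0 V0 ltr01.
have [M M0 hM] := tsum_unear s U0 V0; exists (1 + M); first by rewrite addr_gt0.
by rewrite -[u](subrK (tsum s)); exact: unearD.
Qed.

Lemma tapprox_closed u : (forall U V (e : R), nbhs 0 U -> nbhs 0 V -> 0 < e ->
  exists2 v, tapprox v & unear U V e (u - v)) -> tapprox u.
Proof.
move=> h U V e U0 V0 e0; have e2 : 0 < e / 2 by rewrite divr_gt0.
have [v hv uv] := h U V _ U0 V0 e2; have [s hs] := hv U V _ U0 V0 e2.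
by exists s; rewrite -[u - _](subrKA v) (splitr e); exact: unearD.
Qed.

Lemma tsum_cat s s' : tsum (s ++ s') = tsum s + tsum s'.
Proof. by apply/funext => w; rewrite /tsum big_cat. Qed.

Lemma tapprox_tsum s : tapprox (tsum s).
Proof. by move=> U V e U0 V0 e0; exists s; rewrite subrr; apply: unear0; exact: ltW. Qed.

Lemma tapproxD u v : tapprox u -> tapprox v -> tapprox (u + v).
Proof.
move=> hu hv U V e U0 V0 e0; have e2 : 0 < e / 2 by rewrite divr_gt0.
have [s hs] := hu U V _ U0 V0 e2; have [s' hs'] := hv U V _ U0 V0 e2.
by exists (s ++ s'); rewrite tsum_cat opprD addrACA (splitr e); exact: unearD.
Qed.

Lemma tapproxZ c u : tapprox u -> tapprox (c *: u).
Proof.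
move=> hu U V e U0 V0 e0.
have nc : 0 < nm c + 1 by rewrite ltr_wpDl// nm_ge0.
have [s hs] := hu U V (e / (nm c + 1)) U0 V0 (divr_gt0 e0 nc).
exists [seq (c *: z.1, z.2) | z <- s].
have -> : tsum [seq (c *: z.1, z.2) | z <- s] = c *: tsum s.
  apply/funext => w; rewrite /tsum big_map -[RHS]/(c *: \sum_(z <- s) w z.1 z.2).
  by rewrite scaler_sumr; apply: eq_bigr => z _; rewrite formZl.
rewrite -scalerBr => w hw; apply: (le_trans (unearZ c hs hw)).
by rewrite mulrA ler_pdivrMr// mulrC ler_wpM2l ?(ltW e0)// lerDl.
Qed.

Definition tapprox_pred : {pred form -> C^o} := fun u => `[< tapprox u >].

Lemma tapprox_submod_closed : submod_closed tapprox_pred.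
Proof.
split.
  apply/asboolP; have -> : 0 = tsum [::] by apply/funext => w; rewrite /tsum big_nil.
  exact: tapprox_tsum.
by move=> c u v /asboolP hu /asboolP hv; apply/asboolP/tapproxD => //; exact: tapproxZ.
Qed.

HB.instance Definition _ := GRing.isSubmodClosed.Build C (form -> C^o) tapprox_pred
  tapprox_submod_closed.

(* The elements of the completed projective tensor product are the functionals
   on the continuous bilinear forms which on each [fball U V] are uniform limits
   of evaluations at elementary tensors. *)
Record pten : Type := MkPten {
  pten_fun :> form -> C^o;
  pten_approx : pten_fun \in tapprox_pred }.

HB.instance Definition _ := [isSub for pten_fun].
HB.instance Definition _ := [Choice of pten by <:].
HB.instance Definition _ := [SubChoice_isSubLmodule of pten by <:].

Lemma ptenP (u : pten) : tapprox u.
Proof. by have /asboolP := pten_approx u. Qed.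

Definition pten_ent (P : set (pten * pten)) : Prop :=
  exists U V (e : R), [/\ nbhs 0 U, nbhs 0 V, 0 < e &
    forall u v : pten, unear U V e ((u - v : pten) : form -> C^o) -> P (u, v)].

Lemma pten_ent_filter : Filter pten_ent.
Proof.
split.
- by exists setT, setT, 1; split=> //; exact: filterT.
- move=> P Q [U [V [e [U0 V0 e0 hP]]]] [U' [V' [e' [U'0 V'0 e'0 hQ]]]].
  exists (U `&` U'), (V `&` V'), (Num.min e e'); split; try exact: filterI.
    by rewrite lt_min e0.
  move=> u v h; split; [apply: hP|apply: hQ]; apply: unear_sub h.
  + exact: subIsetl.
  + exact: subIsetl.
  + by rewrite ge_min lexx.
  + exact: subIsetr.
  + exact: subIsetr.
  + by rewrite ge_min lexx orbT.
- move=> P Q PQ [U [V [e [U0 V0 e0 hP]]]]; exists U, V, e; split=> // u v h.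
  by apply: PQ; exact: hP.
Qed.

Lemma pten_ent_refl P : pten_ent P -> diagonal `<=` P.
Proof.
move=> [U [V [e [U0 V0 e0 hP]]]] [u v] /= uv.
have -> : v = u by [].
by apply: hP; rewrite subrr; apply: unear0; exact: ltW.
Qed.

Lemma pten_ent_inv P : pten_ent P -> pten_ent P^-1%relation.
Proof.
move=> [U [V [e [U0 V0 e0 hP]]]]; exists U, V, e; split=> // u v h.
by apply: hP; rewrite -opprB; exact: unearN.
Qed.

Lemma pten_ent_split P : pten_ent P ->
  exists2 Q, pten_ent Q & (Q \; Q)%relation `<=` P.
Proof.
move=> [U [V [e [U0 V0 e0 hP]]]].
have e2 : 0 < e / 2 by rewrite divr_gt0.
exists [set uv : pten * pten | unear U V (e / 2) ((uv.1 - uv.2 : pten) : form -> C^o)].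
  by exists U, V, (e / 2).
move=> [u v] [w /= h1 h2]; apply: hP.
by rewrite -[u - v](subrKA w) (splitr e); exact: unearD.
Qed.

HB.instance Definition _ := isUniform.Build pten
  pten_ent_filter pten_ent_refl pten_ent_inv pten_ent_split.

Lemma pten_nbhsP (u : pten) (P : set pten) :
  nbhs u P <-> exists U V (e : R), [/\ nbhs 0 U, nbhs 0 V, 0 < e &
    forall v : pten, unear U V e ((u - v : pten) : form -> C^o) -> P v].
Proof.
split.
  move=> [Q [U [V [e [U0 V0 e0 hQ]]]] QP]; exists U, V, e; split=> // v h.
  by apply: QP; apply/xsectionP; exact: hQ.
move=> [U [V [e [U0 V0 e0 h]]]].
exists [set uv : pten * pten | unear U V e ((uv.1 - uv.2 : pten) : form -> C^o)].
  by exists U, V, e.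
by move=> v /xsectionP /= /h.
Qed.

Lemma pten_nbhs0P (P : set pten) :
  nbhs (0 : pten) P <-> exists U V (e : R), [/\ nbhs 0 U, nbhs 0 V, 0 < e &
    forall v : pten, unear U V e v -> P v].
Proof.
split=> [/pten_nbhsP|] [U [V [e [U0 V0 e0 h]]]].
  by exists U, V, e; split=> // v /unearN; rewrite -[X in unear _ _ _ X]/(\val (- v)) -sub0r => /h.
apply/pten_nbhsP; exists U, V, e; split=> // v /unearN.
by rewrite -[X in unear _ _ _ X]/(\val (- (0 - v))) opprB subr0 => /h.
Qed.

Lemma pten_add_continuous : continuous (fun z : pten * pten => z.1 + z.2).
Proof.
move=> [u v] P /pten_nbhsP[U [V [e [U0 V0 e0 hP]]]].
have e2 : 0 < e / 2 by rewrite divr_gt0.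
exists ([set w | unear U V (e / 2) ((u - w : pten) : form -> C^o)],
        [set w | unear U V (e / 2) ((v - w : pten) : form -> C^o)]).
  by split; apply/pten_nbhsP; exists U, V, (e / 2).
move=> [u' v'] /= [hu hv]; apply: hP => /=.
by rewrite opprD addrACA (splitr e); exact: unearD.
Qed.

Lemma pten_scale_continuous : continuous (fun z : C^o * pten => z.1 *: z.2).
Proof.
move=> [a u] P /pten_nbhsP[U [V [e [U0 V0 e0 hP]]]].
have [M M0 hM] := tapprox_unear (ptenP u) U0 V0.
have na : 0 < nm a + 1 by rewrite ltr_wpDl// nm_ge0.
have e1 : 0 < e / 2 / (nm a + 1) by rewrite !divr_gt0.
have e2 : 0 < Num.min 1 (e / 2 / M) by rewrite lt_min ltr01 !divr_gt0.
exists ([set b : C^o | nm (a - b) < Num.min 1 (e / 2 / M)],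
        [set v | unear U V (e / 2 / (nm a + 1)) ((u - v : pten) : form -> C^o)]).
  split; last by apply/pten_nbhsP; exists U, V, (e / 2 / (nm a + 1)).
  apply/nbhs_ballP; exists (Num.min 1 (e / 2 / M))%:C; first by rewrite /= ltcR.
  by move=> b; rewrite -ball_normE /= ltcnm.
move=> [b v] /= [hb hv]; apply: hP => /=.
have E : (a : C) *: u - (b : C) *: v = (a - b : C) *: u + (b : C) *: (u - v).
  by rewrite scalerBl scalerBr addrA subrK.
change (unear U V e (\val ((a : C) *: u - (b : C) *: v))); rewrite E.
move: hb; rewrite lt_min => /andP[b1 bM].
have nb : nm b <= nm a + 1.
  rewrite -[b](subrK a); apply: (le_trans (nmD _ _)).
  by rewrite addrC lerD2l nmB ltW.
rewrite (splitr e); apply: unearD => w hw.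
  apply: (le_trans (unearZ (a - b) hM hw)).
  by rewrite -ler_pdivlMr// ltW.
apply: (le_trans (unearZ b hv hw)).
rewrite mulrCA ger_pMr// ?divr_gt0//.
by rewrite ler_pdivrMr// mul1r.
Qed.

Definition pten_ball (u : pten) U V (e : R) : set pten :=
  [set v | exists2 e' : R, e' < e & unear U V e' ((u - v : pten) : form -> C^o)].

Lemma pten_ball_convex (u : pten) U V e : convex_set (pten_ball u U V e).
Proof.
move=> v w l; rewrite !inE => -[e1 e1e h1] [e2 e2e h2].
exists (Num.max e1 e2); first by rewrite gt_max e1e.
have l0 : 0 <= (l%:num : C) by [].
have l1 : (l%:num : C) <= 1 by [].
change (unear U V (Num.max e1 e2)
  (\val (u - ((l%:num : C) *: v + (1 - (l%:num : C)) *: w)))).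
have -> : u - ((l%:num : C) *: v + (1 - (l%:num : C)) *: w) =
    (l%:num : C) *: (u - v) + (1 - (l%:num : C)) *: (u - w).
  have ll : (l%:num : C) + (1 - (l%:num : C)) = 1 by rewrite addrC subrK.
  by rewrite [in RHS]scalerBr [in X in _ = _ + X]scalerBr addrACA -scalerDl ll
    scale1r opprD.
have -> : Num.max e1 e2 = nm (l%:num : C) * Num.max e1 e2 +
    nm (1 - (l%:num : C)) * Num.max e1 e2.
  by rewrite -mulrDl nm_convex// mul1r.
apply: (@unearD U V _ _ ((l%:num : C) *: \val (u - v))
  ((1 - (l%:num : C)) *: \val (u - w))); apply: unearZ => z hz.
  by apply: (le_trans (h1 z hz)); rewrite le_max lexx.
by apply: (le_trans (h2 z hz)); rewrite le_max lexx orbT.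
Qed.

Lemma pten_ball_open (u : pten) U V e : nbhs 0 U -> nbhs 0 V -> open (pten_ball u U V e).
Proof.
move=> U0 V0; rewrite openE => v [e' ee h]; apply/pten_nbhsP.
have d0 : 0 < (e - e') / 2 by rewrite divr_gt0// subr_gt0.
exists U, V, ((e - e') / 2); split => // w vw.
exists (e' + (e - e') / 2).
  by rewrite -ltrBrDl gtr_pMr ?subr_gt0// invf_lt1// ltr1n.
by rewrite -[u - w](subrKA v); exact: unearD.
Qed.

Lemma pten_locally_convex : exists2 B : set_system pten,
  (forall b, b \in B -> convex_set b) & basis B.
Proof.
exists [set b | exists (u : pten) U V e, [/\ nbhs 0 U, nbhs 0 V & b = pten_ball u U V e]].
  by move=> b; rewrite inE => -[u [U [V [e [_ _ ->]]]]]; exact: pten_ball_convex.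
split; first by move=> _ [u [U [V [e [U0 V0 ->]]]]]; exact: pten_ball_open.
move=> u P /pten_nbhsP[U [V [e [U0 V0 e0 hP]]]].
exists (pten_ball u U V e).
  split; first by exists u, U, V, e.
  by exists 0 => //; rewrite subrr; exact: unear0.
by move=> v [e' ee h]; apply: hP => w hw; exact: le_trans (h w hw) (ltW ee).
Qed.

HB.instance Definition _ := PreTopologicalNmodule_isTopologicalNmodule.Build pten
  pten_add_continuous.
HB.instance Definition _ := TopologicalNmodule_isTopologicalLmodule.Build C pten
  pten_scale_continuous.
HB.instance Definition _ := Uniform_isTvs.Build C pten pten_locally_convex.

Lemma pten_hausdorff : hausdorff_space pten.
Proof.
move=> u v uv; apply/val_inj/funext => w.
have [U [V [U0 V0 hw]]] := fball_ex w.
apply/eqP; rewrite -subr_eq0; apply/eqP/ComplexField.Normc.eq0_normc.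
apply/eqP; rewrite eq_le nm_ge0 andbT; apply/ler_addgt0Pr => e e0.
have e2 : 0 < e / 2 by rewrite divr_gt0.
have [] := uv [set x | unear U V (e / 2) (\val (u - x))]
              [set x | unear U V (e / 2) (\val (v - x))].
- by apply/pten_nbhsP; exists U, V, (e / 2).
- by apply/pten_nbhsP; exists U, V, (e / 2).
move=> x [/= ux /unearN vx]; have := unearD ux vx; rewrite -splitr add0r.
move=> /(_ w hw); rewrite -[X in nm X]/(u w - x w - (v w - x w)).
by rewrite opprB subrKA.
Qed.

Lemma pten_complete : tvs_complete pten.
Proof.
move=> F FF Fc.
have hF U V (e : R) : nbhs 0 U -> nbhs 0 V -> 0 < e ->
    exists2 P, F P & forall u v : pten, P u -> P v -> unear U V e (\val (u - v)).
  move=> U0 V0 e0; have [|P FP hP] := Fc [set u : pten | unear U V e u]; last by exists P.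
  by apply/pten_nbhs0P; exists U, V, e.
have hL w : exists l : C^o, (fun u : pten => u w) @ F --> l.
  have [U [V [U0 V0 hw]]] := fball_ex w.
  apply/cvg_ex; apply: complex_cauchy_cvg; apply/cauchy_ballP => e e0.
  have e1 : 0 < complex.Re e / 2 by rewrite divr_gt0// ltc_Re.
  have [P FP hP] := hF U V _ U0 V0 e1.
  pose Q := (fun u : pten => u w) @` P.
  have FQ : ((fun u : pten => u w) @ F) Q.
    by apply: (@filterS _ F _ P) FP => u Pu; exists u.
  exists (Q, Q) => //= -[_ _] /= [[u Pu <-] [v Pv <-]].
  have /(nm_ball (v w - u w)) : 0 < e by [].
  rewrite -!ball_normE /= sub0r normrN distrC => ->.
  apply: (le_lt_trans (hP v u Pv Pu w hw)).
  by rewrite gtr_pMr ?ltc_Re// invf_lt1// ltr1n.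
(* The limit is taken pointwise in [w]; [unif] upgrades it to uniform convergence on each ball,
   under which [tapprox] is closed. *)
pose L : form -> C^o := fun w => sval (cid (hL w)).
have LP w : (fun u : pten => u w) @ F --> L w by rewrite /L; case: cid.
have unif U V (e : R) : nbhs 0 U -> nbhs 0 V -> 0 < e -> exists2 P, F P &
    forall u : pten, P u -> unear U V e (L - (u : form -> C^o)).
  move=> U0 V0 e0; have [P FP hP] := hF U V _ U0 V0 e0; exists P => // u Pu w hw.
  apply/ler_addgt0Pr => e' e'0.
  have : F [set v : pten | P v /\ nm (v w - L w) < e'].
    apply: filterI => //; move/cvgrPdist_lt: (LP w) => /(_ e'%:C).
    by rewrite ltcR => /(_ e'0); apply: filterS => v; rewrite ltcnm nmB.
  move=> /filter_ex[v [Pv hv]]; rewrite -[X in nm X]/(L w - u w).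
  rewrite -[_ - _](subrKA (v w)) addrC; apply: (le_trans (nmD _ _)).
  by rewrite lerD ?(hP v u)// nmB ltW.
have hL' : L \in tapprox_pred.
  apply/asboolP/tapprox_closed => U V e U0 V0 e0.
  have [P FP hP] := unif U V e U0 V0 e0; have [u Pu] := filter_ex FP.
  by exists (u : form -> C^o); [exact: ptenP|exact: hP].
exists (MkPten hL') => P /pten_nbhsP[U [V [e [U0 V0 e0 hP]]]].
have [Q FQ hQ] := unif U V e U0 V0 e0.
by apply: (@filterS _ F _ Q) FQ => u Qu; apply/hP/hQ.
Qed.

Definition pten_lcs : lcs R := Lcs pten_hausdorff pten_complete.

(** Elements of [pten] are mere functions of a form. Linearity is inherited from the sums [tsum s],
    which are uniformly close on a ball containing all three forms. The combination [w3] is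
    described pointwise because [form] carries no module structure. *)
Lemma pten_form_linear (u : pten) (c : C) (w1 w2 w3 : form) :
  (forall a b, w3 a b = c *: w1 a b + w2 a b) -> u w3 = c *: u w1 + u w2.
Proof.
move=> h; have [U1 [V1 [U10 V10 h1]]] := fball_ex w1.
have [U2 [V2 [U20 V20 h2]]] := fball_ex w2.
have [U3 [V3 [U30 V30 h3]]] := fball_ex w3.
pose U := U1 `&` U2 `&` U3; pose V := V1 `&` V2 `&` V3.
have U0 : nbhs 0 U by apply: filterI => //; exact: filterI.
have V0 : nbhs 0 V by apply: filterI => //; exact: filterI.
have {}h1 : fball U V w1 by apply: fball_sub h1 => x [[]].
have {}h2 : fball U V w2 by apply: fball_sub h2 => x [[]].
have {}h3 : fball U V w3 by apply: fball_sub h3 => x [].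
apply/eqP; rewrite -subr_eq0; apply/eqP/ComplexField.Normc.eq0_normc.
apply/eqP; rewrite eq_le nm_ge0 andbT; apply/ler_addgt0Pr => e e0; rewrite add0r.
(* The errors at [w3], [w1] and [w2] enter with weights 1, [nm c] and 1. *)
have K0 : 0 < 1 + (nm c + 1) by rewrite addr_gt0// ltr_wpDl// nm_ge0.
have [s hs] := ptenP u U0 V0 (divr_gt0 e0 K0).
have hsE : tsum s w3 = c *: tsum s w1 + tsum s w2.
  by rewrite /tsum scaler_sumr -big_split; apply: eq_bigr => z _; exact: h.
have -> : u w3 - (c *: u w1 + u w2) =
    (u w3 - tsum s w3) - (c *: (u w1 - tsum s w1) + (u w2 - tsum s w2)).
  rewrite hsE; move: (u w3) (u w1) (u w2) (tsum s w1) (tsum s w2) => p q r x y.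
  change ((p : C) - (c * q + r) = p - (c * x + y) - (c * (q - x) + (r - y))).
  by ring.
apply: (le_trans (nmD _ _)); rewrite nmN.
apply: (@le_trans _ _ (e / (1 + (nm c + 1)) * (1 + (nm c + 1)))).
  rewrite mulrDr mulr1; apply: lerD; first exact: hs.
  apply: (le_trans (nmD _ _)); rewrite mulrDr mulr1; apply: lerD; last exact: hs.
  by rewrite -[_ *: _]/(c * _) nmM mulrC ler_wpM2r ?nm_ge0//; exact: hs.
by rewrite divfK// gt_eqF.
Qed.

Definition ptens_tens_fun (a : A) (b : B) : form -> C^o := fun w => w a b.

Lemma ptens_tens_approx a b : ptens_tens_fun a b \in tapprox_pred.
Proof.
apply/asboolP; have -> : ptens_tens_fun a b = tsum [:: (a, b)].
  by apply/funext => w; rewrite /tsum big_seq1.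
exact: tapprox_tsum.
Qed.

Definition ptens_tens (a : A) (b : B) : pten_lcs := MkPten (ptens_tens_approx a b).

Lemma ptens_tens_bilinear : cont_bilinear ptens_tens.
Proof.
have l1 a : linear (ptens_tens a).
  by move=> c x y; apply/val_inj/funext => w; have [l _ _] := form_bilinear w; exact: l.
have l2 b : linear (ptens_tens ^~ b).
  by move=> c x y; apply/val_inj/funext => w; have [_ l _] := form_bilinear w; exact: l.
split=> //; apply: bilinear_continuous0 => // P /pten_nbhs0P[U [V [e [U0 V0 e0 hP]]]].
have e1 : e%:C != 0 :> C by rewrite fmorph_eq0 gt_eqF.
exists [set e%:C *: x | x in U]; first exact: nbhs0Z.
exists V => // _ b [a Ua <-] Vb; apply: hP => w hw.
rewrite -[X in nm X]/(w (e%:C *: a) b) formZl -[_ *: _]/(_ * w a b) nmM nm_real gtr0_norm//.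
by rewrite ler_piMr ?(ltW e0)// hw.
Qed.

Lemma tsum_ptens s : tsum s = (\sum_(z <- s) ptens_tens z.1 z.2 : pten).
Proof.
elim: s => [|z s IH]; first by rewrite big_nil; apply/funext => w; rewrite /tsum big_nil.
rewrite big_cons -[RHS]/(ptens_tens_fun z.1 z.2 + pten_fun (\sum_(z <- s) ptens_tens z.1 z.2)).
by rewrite -IH; apply/funext => w; rewrite /tsum big_cons.
Qed.

Section Lift.
Variables (X : lcs R) (b : A -> B -> X).
Hypothesis b_bilinear : cont_bilinear b.

Lemma form_comp_bilinear (phi : X -> C_lcs) : linear phi -> continuous phi ->
  cont_bilinear (fun x y => phi (b x y)).
Proof.
have [l1 l2 cb] := b_bilinear => lp cp; split.
- by move=> x c y z; rewrite l1 lp.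
- by move=> x c y z; rewrite /= l2 lp.
move=> z; apply: (@continuous_comp _ _ _ (fun z : A * B => b z.1 z.2) phi).
  exact: cb.
exact: cp.
Qed.

Definition form_comp phi (lp : linear phi) (cp : continuous phi) : form :=
  Form (form_comp_bilinear lp cp).

(** One ball serves all functionals in the polar of [W] at once. This uniformity gives both the
    Cauchy property behind the lift and its continuity. *)
Lemma bilinear_polar (W : set X) : nbhs 0 W ->
  exists U V, [/\ nbhs 0 U, nbhs 0 V &
    forall (phi : X -> C_lcs) (lp : linear phi) (cp : continuous phi),
    (forall x, W x -> nm (phi x) <= 1) -> fball U V (form_comp lp cp)].
Proof.
have [l1 l2 cb] := b_bilinear => W0.
have [|[U V] /= [U0 V0] h] := cb (0, 0) W.
  by rewrite /= (lin0 (l1 0)).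
by exists U, V; split=> // phi lp cp hW x y Ux Vy; apply/hW/(h (x, y)).
Qed.

(** [x] is the limit of the sums [bsum s] as the finite tensors [s] tend to [u]. A filter takes the
    place of a sequence, since no countable base of neighbourhoods is assumed. *)
Lemma pten_lift_ex (u : pten) : exists x : X,
  forall (phi : X -> C_lcs) (lp : linear phi) (cp : continuous phi), phi x = u (form_comp lp cp).
Proof.
pose bsum (s : seq (A * B)) := \sum_(z <- s) b z.1 z.2.
have phi_bsum phi (lp : linear phi) (cp : continuous phi) s :
    phi (bsum s) = tsum s (form_comp lp cp).
  by rewrite (lin_sum lp).
pose S U V (e : R) := [set bsum s | s in [set s | unear U V e ((u : form -> C^o) - tsum s)]].
pose D := [set z : set A * set B * R | [/\ nbhs 0 z.1.1, nbhs 0 z.1.2 & 0 < z.2]].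
pose F : set_system X := filter_from D (fun z => S z.1.1 z.1.2 z.2).
have FF : ProperFilter F.
  apply: filter_from_proper; last first.
    move=> [[U V] e] [/= U0 V0 e0]; have [s hs] := ptenP u U0 V0 e0.
    by exists (bsum s); exists s.
  apply: filter_from_filter.
    by exists (setT, setT, 1); split=> //; exact: filterT.
  move=> [[U V] e] [[U' V'] e'] [/= U0 V0 e0] [/= U'0 V'0 e'0].
  exists (U `&` U', V `&` V', Num.min e e').
    by split=> /=; [exact: filterI|exact: filterI|rewrite lt_min e0].
  move=> _ [s /= hs <-]; split; exists s => //=; apply: unear_sub hs.
  - exact: subIsetl.
  - exact: subIsetl.
  - by rewrite ge_min lexx.
  - exact: subIsetr.
  - exact: subIsetr.
  - by rewrite ge_min lexx orbT.
have Fc : forall N : set X, nbhs 0 N ->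
    exists2 P, F P & forall x y, P x -> P y -> N (x - y).
  move=> N N0; have [W W0 hW] := nbhs0_polar N0.
  have [U [V [U0 V0 hb]]] := bilinear_polar W0.
  exists (S U V 2^-1); first by exists (U, V, 2^-1) => //; split; rewrite //= invr_gt0.
  move=> _ _ [s /= hs <-] [s' /= hs' <-]; apply: hW => phi lp cp hphi.
  rewrite (linB lp) !phi_bsum; set w := form_comp lp cp.
  have hw : fball U V w by exact: hb.
  rewrite -[_ - _](subrKA (u w)) (splitr 1) mul1r.
  by apply: (le_trans (nmD _ _)); apply: lerD; [rewrite nmB; exact: hs|exact: hs'].
have [x Fx] := lcs_complete FF Fc; exists x => phi lp cp; set w := form_comp lp cp.
apply/eqP; rewrite -subr_eq0; apply/eqP/ComplexField.Normc.eq0_normc.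
apply/eqP; rewrite eq_le nm_ge0 andbT; apply/ler_addgt0Pr => e e0; rewrite add0r.
have e2 : 0 < e / 2 by rewrite divr_gt0.
have [U [V [U0 V0 hw]]] := fball_ex w.
have : F (S U V (e / 2)) by exists (U, V, e / 2).
have : F [set y | nm (phi x - phi y) < e / 2].
  apply: Fx; apply/nbhs_to0P; have : nbhs (0 : C^o) [set z | nm z < e / 2].
    by apply/nbhs0_CP; exists (e / 2).
  move=> /(linear_continuousP lp cp); apply: filterS => y /=.
  by rewrite (linD lp) opprD addrA subrr sub0r nmN.
move=> /(filterI) h /h /filter_ex[y [hx [s hs bs]]].
move: hx; rewrite /= -bs phi_bsum -/w => hx.
rewrite -[_ - _](subrKA (tsum s w)) (splitr e); apply: (le_trans (nmD _ _)).
by apply: lerD; [exact: ltW|rewrite nmB; exact: hs].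
Qed.

Definition pten_lift (u : pten_lcs) : X := sval (cid (pten_lift_ex u)).

Lemma pten_liftP (u : pten_lcs) phi (lp : linear phi) (cp : continuous phi) :
  phi (pten_lift u) = (u : pten) (form_comp lp cp).
Proof. by rewrite /pten_lift; case: cid => x /= ->. Qed.

Lemma pten_lift_linear : linear pten_lift.
Proof.
move=> c u v; apply: eq_functionals => phi lp cp.
by rewrite lp !(pten_liftP _ lp cp).
Qed.

Lemma pten_lift_continuous : continuous pten_lift.
Proof.
apply: linear_continuous0; first exact: pten_lift_linear.
move=> N N0; have [W W0 hW] := nbhs0_polar N0.
have [U [V [U0 V0 hb]]] := bilinear_polar W0.
exists [set u : pten | unear U V 1 u]; first by apply/pten_nbhs0P; exists U, V, 1.
move=> u hu; apply: hW => phi lp cp hphi.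
by rewrite (pten_liftP _ lp cp); apply/hu/hb.
Qed.

Lemma pten_liftE x y : pten_lift (ptens_tens x y) = b x y.
Proof. by apply: eq_functionals => phi lp cp; rewrite (pten_liftP _ lp cp). Qed.

End Lift.

Lemma ptens_tens_univ : is_ptensor ptens_tens.
Proof.
split; first exact: ptens_tens_bilinear.
move=> X b hb; exists (pten_lift hb).
  split; last exact: pten_liftE.
  by split; [exact: pten_lift_linear|exact: pten_lift_continuous].
move=> g [lg cg] gE; apply/funext => u; apply: eq_functionals => phi lp cp.
rewrite (pten_liftP hb _ lp cp); set w := form_comp hb lp cp.
have lpg : linear (phi \o g) by move=> c x y /=; rewrite lg lp.
have cpg : continuous (phi \o g).
  by move=> x; apply: continuous_comp; [exact: cg|exact: cp].
apply/eqP; rewrite -subr_eq0; apply/eqP/ComplexField.Normc.eq0_normc.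
apply/eqP; rewrite eq_le nm_ge0 andbT; apply/ler_addgt0Pr => e e0; rewrite add0r.
have e2 : 0 < e / 2 by rewrite divr_gt0.
have [U1 [V1 [U10 V10 hw]]] := fball_ex w.
have : nbhs (0 : C^o) [set z | nm z < e / 2] by apply/nbhs0_CP; exists (e / 2).
move=> /(linear_continuousP lpg cpg) /pten_nbhs0P[U [V [d [U0 V0 d0 hd]]]].
have hU : nbhs 0 (U `&` U1) by exact: filterI.
have hV : nbhs 0 (V `&` V1) by exact: filterI.
have hm : 0 < Num.min d (e / 2) by rewrite lt_min d0.
have [s hs] := ptenP u hU hV hm.
pose v : pten_lcs := \sum_(z <- s) ptens_tens z.1 z.2.
have gv : phi (g v) = tsum s w.
  rewrite (lin_sum lg) (lin_sum lp); apply: eq_bigr => z _; by rewrite gE.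
rewrite -[phi (g u) - _](subrKA (tsum s w)) (splitr e); apply: (le_trans (nmD _ _)).
apply: lerD.
  rewrite -gv -(linB lp) -(linB lg); apply: ltW; apply: hd.
  have vE : tsum s = pten_fun v by exact: tsum_ptens.
  change (unear U V d (pten_fun u - pten_fun v)); rewrite -vE; apply: unear_sub hs.
  - exact: subIsetl.
  - exact: subIsetl.
  - by rewrite ge_min lexx.
rewrite nmB; apply: (le_trans (hs w _)); last by rewrite ge_min lexx orbT.
apply: fball_sub hw; exact: subIsetr.
Qed.

End Forms.

(** * The product on the tensor product *)

Section TensorAlgebra.
Variables A B : lcAlg R.
Implicit Types (U : set A) (V : set B) (u v : pten A B).

Lemma form_shift_bilinear (w : form A B) a b :
  cont_bilinear (fun a' b' => w (lca_mul a a') (lca_mul b b')).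
Proof.
have [l1 l2 c] := form_bilinear w.
have [la ca] := lca_mull_cont a; have [lb cb] := lca_mull_cont b.
split.
- by move=> x d y z; rewrite lb l1.
- by move=> x d y z; rewrite /= la l2.
move=> z; apply: (@continuous_comp _ (A * B)%type _
  (fun z : A * B => (lca_mul a z.1, lca_mul b z.2)) (fun z => w z.1 z.2)).
  apply: cvg_pair.
    by apply: continuous_comp; [exact: cvg_fst|exact: ca].
  by apply: continuous_comp; [exact: cvg_snd|exact: cb].
exact: c.
Qed.

Definition form_shift w a b : form A B := Form (form_shift_bilinear w a b).

Lemma form_shift_ball U V : nbhs 0 U -> nbhs 0 V ->
  exists U' V', [/\ nbhs 0 U', nbhs 0 V' & forall w a b, fball U V w ->
    U' a -> V' b -> fball U' V' (form_shift w a b)].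
Proof.
move=> U0 V0; have [_ _ ca] := lca_mul_bilinear A; have [_ _ cb] := lca_mul_bilinear B.
have [|[U1 U2] /= [U10 U20] hU] := ca (0, 0) U.
  by rewrite /= (lin0 (lca_mull_cont (0 : A)).1).
have [|[V1 V2] /= [V10 V20] hV] := cb (0, 0) V.
  by rewrite /= (lin0 (lca_mull_cont (0 : B)).1).
exists (U1 `&` U2), (V1 `&` V2); split; try exact: filterI.
move=> w a b hw [a1 _] [b1 _] a' b' [_ a2] [_ b2]; apply: hw.
  exact: (hU (a, a')).
exact: (hV (b, b')).
Qed.

Lemma pten_act_bilinear v (w : form A B) :
  cont_bilinear (fun a b => v (form_shift w a b) : C_lcs).
Proof.
have [l1 l2 _] := form_bilinear w.
have h1 a : linear (fun b => v (form_shift w a b) : C_lcs).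
  move=> c x y; apply: pten_form_linear => a' b' /=.
  by have [_ lb _] := lca_mul_bilinear B; rewrite lb l1.
have h2 b : linear (fun a => v (form_shift w a b) : C_lcs).
  move=> c x y; apply: pten_form_linear => a' b' /=.
  by have [_ la _] := lca_mul_bilinear A; rewrite la l2.
split=> //.
apply: (@bilinear_continuous0 R A B C_lcs (fun a b => v (form_shift w a b))) => //.
move=> P /nbhs0_CP[e e0 hP].
have [U [V [U0 V0 hw]]] := fball_ex w.
have [U' [V' [U'0 V'0 h]]] := form_shift_ball U0 V0.
have [M M0 hM] := tapprox_unear (ptenP v) U'0 V'0.
have k0 : (e / 2 / M)%:C != 0 :> C by rewrite fmorph_eq0 gt_eqF// !divr_gt0.
exists [set (e / 2 / M)%:C *: x | x in U']; first exact: nbhs0Z.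
exists V' => // _ b [a Ua <-] Vb; apply: hP.
rewrite (linZ (h2 b)) -[_ *: _]/(_ * v _) nmM nm_real gtr0_norm ?divr_gt0//.
apply: (@le_lt_trans _ _ (e / 2)); last by rewrite gtr_pMr// invf_lt1// ltr1n.
by rewrite mulrAC ler_pdivrMr// ler_wpM2l ?divr_ge0 ?(ltW e0)//; apply/hM/h.
Qed.

Definition pten_act v w : form A B := Form (pten_act_bilinear v w).

Lemma tapprox_shift v a b :
  tapprox (fun w => (v : form A B -> C^o) (form_shift w a b)).
Proof.
move=> U V e U0 V0 e0.
have [la ca] := lca_mull_cont a; have [lb cb] := lca_mull_cont b.
have U1 := linear_continuousP la ca U0; have V1 := linear_continuousP lb cb V0.
have [s hs] := ptenP v U1 V1 e0.
exists [seq (lca_mul a z.1, lca_mul b z.2) | z <- s] => w hw.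
have hw' : fball [set x | U (lca_mul a x)] [set y | V (lca_mul b y)] (form_shift w a b).
  by move=> x y; exact: hw.
have := hs _ hw'; congr (nm (_ - _) <= _).
by rewrite /tsum big_map.
Qed.

(** When [u] is replaced by a finite sum, [tsum s (pten_act v w)] is a sum of translates of [v],
    each of them a limit of finite sums by [tapprox_shift]. *)
Lemma tapprox_mul u v : (fun w => (u : form A B -> C^o) (pten_act v w)) \in
  (@tapprox_pred A B).
Proof.
apply/asboolP/tapprox_closed => U V e U0 V0 e0.
have [U' [V' [U'0 V'0 h]]] := form_shift_ball U0 V0.
have [M M0 hM] := tapprox_unear (ptenP v) U'0 V'0.
(* Dividing [U'] by the bound [M] of [v] puts [pten_act v w] in the unit ball for every [w] in
   [fball U V]. *)
have k0 : M^-1%:C != 0 :> C by rewrite fmorph_eq0 invr_eq0 gt_eqF.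
have [s hs] := ptenP u (nbhs0Z k0 U'0) V'0 e0.
exists (fun w => tsum s (pten_act v w)); last first.
  move=> w hw; apply: hs => _ b [a Ua <-] Vb.
  rewrite formZl -[_ *: _]/(_ * v (form_shift w a b)) nmM nm_real gtr0_norm ?invr_gt0//.
  by rewrite ler_pdivrMl// mulr1; apply/hM/h.
elim: s {hs} => [|z s IH].
  have -> : (fun w => tsum [::] (pten_act v w)) = tsum [::].
    by apply/funext => w; rewrite /tsum !big_nil.
  exact: tapprox_tsum.
have -> : (fun w => tsum (z :: s) (pten_act v w)) =
    (fun w => v (form_shift w z.1 z.2)) + (fun w => tsum s (pten_act v w)).
  by apply/funext => w; rewrite /tsum big_cons.
by apply: tapproxD => //; exact: tapprox_shift.
Qed.

(** A convolution of functionals: [u] acts in the variables [(a, b)], [v] in [(a', b')], and [w] is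
    evaluated at the pair of products. Associativity thereby reduces to that of [A] and [B]. *)
Definition pten_mul (u v : pten_lcs A B) : pten_lcs A B := MkPten (tapprox_mul u v).

Lemma pten_mul_bilinear : cont_bilinear pten_mul.
Proof.
have l1 u : linear (pten_mul u).
  move=> c v v'; apply/val_inj/funext => w.
  exact: (@pten_form_linear A B u c (pten_act v w) (pten_act v' w)
    (pten_act (c *: v + v' : pten A B) w)).
have l2 u : linear (pten_mul ^~ u) by move=> c v v'; apply/val_inj/funext.
split=> //; apply: bilinear_continuous0 => // P /pten_nbhs0P[U [V [e [U0 V0 e0 hP]]]].
have [U' [V' [U'0 V'0 h]]] := form_shift_ball U0 V0.
exists [set u | unear U' V' e (u : pten A B)]; first by apply/pten_nbhs0P; exists U', V', e.
exists [set u | unear U' V' 1 (u : pten A B)]; first by apply/pten_nbhs0P; exists U', V', 1.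
move=> u v hu hv; apply: hP => w hw; apply: hu => a b Ua Vb.
exact/hv/h.
Qed.

Lemma pten_mulA : associative pten_mul.
Proof.
move=> u v x; apply/val_inj/funext => w /=; congr (pten_fun u _).
apply: form_ext => a b /=; congr (pten_fun v _).
apply: form_ext => a' b' /=; congr (pten_fun x _).
by apply: form_ext => a'' b'' /=; rewrite !lca_mulA.
Qed.

Definition pten_alg : lcAlg R := LcAlg pten_mul_bilinear pten_mulA.

Lemma pten_tens_mul a a' b b' :
  lca_mul (ptens_tens a b : pten_alg) (ptens_tens a' b') =
  ptens_tens (lca_mul a a') (lca_mul b b').
Proof. exact/val_inj/funext. Qed.

Definition ptens : ptensor A B :=
  @PTensor R A B pten_alg _ (@ptens_tens_univ A B) pten_tens_mul.

End TensorAlgebra.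
End ProjectiveTensorProduct.

(** * Products and matrix algebras *)

Section Constructions.
Variable R : realType.
Local Notation C := R[i].
Local Notation "x ** y" := (lca_mul x y) (at level 40, left associativity).

Lemma lcHom_eq (A B : lcAlg R) (f g : lcHom A B) : f =1 g -> f = g.
Proof.
case: f g => [f f1 f2] [g g1 g2] /= /funext fg.
by move: f1 f2 g1 g2; rewrite fg => *; congr LcHom; exact: Prop_irrelevance.
Qed.

Section ProductSpace.
Variables V W : lcs R.

Lemma prod_hausdorff : hausdorff_space (V * W : tvsType C)%type.
Proof.
move=> [a b] [a' b'] h; congr (_, _).
  apply: (@lcs_hausdorff _ V) => P Q Pa Qa.
  have [||[x y] [/= h1 h2]] := h (fst @^-1` P) (fst @^-1` Q); last by exists x.
    exact: (@cvg_fst _ _ (nbhs a) (nbhs b) _ P Pa).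
  exact: (@cvg_fst _ _ (nbhs a') (nbhs b') _ Q Qa).
apply: (@lcs_hausdorff _ W) => P Q Pa Qa.
have [||[x y] [/= h1 h2]] := h (snd @^-1` P) (snd @^-1` Q); last by exists y.
  exact: (@cvg_snd _ _ (nbhs a) (nbhs b) _ P Pa).
exact: (@cvg_snd _ _ (nbhs a') (nbhs b') _ Q Qa).
Qed.

Lemma prod_complete : tvs_complete (V * W : tvsType C)%type.
Proof.
move=> F FF Fc.
have FV : ProperFilter (fst @ F) by exact: fmap_proper_filter.
have FW : ProperFilter (snd @ F) by exact: fmap_proper_filter.
have [|a Fa] := @lcs_complete R V (fst @ F) _.
  move=> U U0; have [|P FP hP] := Fc (fst @^-1` U).
    exact: (@cvg_fst _ _ (nbhs (0 : V)) (nbhs (0 : W)) _ U U0).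
  exists (fst @` P); first by apply: (@filterS _ F _ P) FP => x Px; exists x.
  by move=> _ _ [x Px <-] [y Py <-]; exact: hP.
have [|b Fb] := @lcs_complete R W (snd @ F) _.
  move=> U U0; have [|P FP hP] := Fc (snd @^-1` U).
    exact: (@cvg_snd _ _ (nbhs (0 : V)) (nbhs (0 : W)) _ U U0).
  exists (snd @` P); first by apply: (@filterS _ F _ P) FP => x Px; exists x.
  by move=> _ _ [x Px <-] [y Py <-]; exact: hP.
exists (a, b) => U [[P Q] /= [Pa Qb] hPQ].
have := @filterI _ F (@filter_filter _ F FF) _ _ (Fa _ Pa) (Fb _ Qb).
by apply: filterS => x [Px Qx]; apply: hPQ.
Qed.

Definition prod_lcs : lcs R := Lcs prod_hausdorff prod_complete.

Lemma cont_linear_fst : cont_linear (fst : prod_lcs -> V).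
Proof. by split=> // x; exact: cvg_fst. Qed.

Lemma cont_linear_snd : cont_linear (snd : prod_lcs -> W).
Proof. by split=> // x; exact: cvg_snd. Qed.

Lemma cont_linear_pair (X : lcs R) (f : X -> V) (g : X -> W) :
  cont_linear f -> cont_linear g -> cont_linear (fun x => (f x, g x) : prod_lcs).
Proof.
move=> [lf cf] [lg cg]; split; first by move=> c x y; rewrite lf lg.
by move=> x; apply: cvg_pair; [exact: cf|exact: cg].
Qed.

End ProductSpace.

Lemma cont_linear0 (V W : lcs R) : cont_linear (fun _ : V => 0 : W).
Proof.
split; first by move=> c x y; rewrite scaler0 addr0.
by move=> x; exact: cvg_cst.
Qed.

Lemma cont_linearD (V W : lcs R) (f g : V -> W) :
  cont_linear f -> cont_linear g -> cont_linear (fun x => f x + g x).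
Proof.
move=> [lf cf] [lg cg]; split.
  by move=> c x y; rewrite lf lg scalerDr addrACA.
move=> x; apply: (@cvg_comp _ _ _ (fun x => (f x, g x)) (fun z : W * W => z.1 + z.2)
  (nbhs x) (nbhs (f x, g x)));
  last exact: (@add_continuous W (f x, g x)).
by apply: cvg_pair; [exact: cf|exact: cg].
Qed.

Lemma cont_linearZ (V W : lcs R) (f : V -> W) c :
  cont_linear f -> cont_linear (fun x => c *: f x).
Proof.
move=> [lf cf]; split.
  by move=> d x y; rewrite lf scalerDr !scalerA mulrC.
move=> x; apply: (@cvg_comp _ _ _ (fun x => (c : C^o, f x)) (fun z : C^o * W => z.1 *: z.2)
  (nbhs x) (nbhs (c : C^o, f x)));
  last exact: (@scale_continuous C W (c : C^o, f x)).
have Fx : Filter (nbhs x) := nbhs_filter x.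
by apply: (@cvg_pair _ _ _ (nbhs x) (nbhs (c : C^o)) (nbhs (f x)));
  [exact: cvg_cst|exact: cf].
Qed.

Lemma cont_linearN (V W : lcs R) (f : V -> W) :
  cont_linear f -> cont_linear (fun x => - f x).
Proof.
by move=> /(cont_linearZ (-1)); under eq_fun do rewrite scaleN1r.
Qed.

Section Bilinear.
Variables V W X : lcs R.

Lemma cont_bilinear_comp (V' W' : lcs R) (b : V -> W -> X) (f : V' -> V) (g : W' -> W) :
  cont_bilinear b -> cont_linear f -> cont_linear g ->
  cont_bilinear (fun x y => b (f x) (g y)).
Proof.
move=> [l1 l2 cb] [lf cf] [lg cg]; split.
- by move=> v c x y; rewrite lg l1.
- by move=> v c x y; rewrite /= lf l2.
move=> z; apply: (@continuous_comp _ (V * W)%type _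
  (fun z : V' * W' => (f z.1, g z.2)) (fun z => b z.1 z.2)); last exact: cb.
apply: cvg_pair.
  by apply: continuous_comp; [exact: cvg_fst|exact: cf].
by apply: continuous_comp; [exact: cvg_snd|exact: cg].
Qed.

Lemma cont_bilinearD (b b' : V -> W -> X) : cont_bilinear b -> cont_bilinear b' ->
  cont_bilinear (fun x y => b x y + b' x y).
Proof.
move=> [l1 l2 cb] [l1' l2' cb']; split.
- by move=> v c x y; rewrite l1 l1' scalerDr addrACA.
- by move=> v c x y; rewrite /= l2 l2' scalerDr addrACA.
move=> z; apply: (@cvg_comp _ _ _ (fun z => (b z.1 z.2, b' z.1 z.2))
  (fun z : X * X => z.1 + z.2) (nbhs z) (nbhs (b z.1 z.2, b' z.1 z.2))).
  by apply: cvg_pair; [exact: cb|exact: cb'].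
exact: (@add_continuous X (b z.1 z.2, b' z.1 z.2)).
Qed.

Lemma cont_bilinear_pair (Y : lcs R) (b : V -> W -> X) (b' : V -> W -> Y) :
  cont_bilinear b -> cont_bilinear b' ->
  cont_bilinear (fun x y => (b x y, b' x y) : prod_lcs X Y).
Proof.
move=> [l1 l2 cb] [l1' l2' cb']; split.
- by move=> v c x y; rewrite l1 l1'.
- by move=> v c x y; rewrite /= l2 l2'.
by move=> z; apply: cvg_pair; [exact: cb|exact: cb'].
Qed.

Lemma cont_bilinear_linl (b : V -> W -> X) w :
  cont_bilinear b -> cont_linear (b^~ w).
Proof.
move=> [l1 l2 cb]; split; first exact: l2.
move=> x; apply: (@continuous_comp _ (V * W)%type _ (fun x => (x, w))
  (fun z => b z.1 z.2)); last exact: cb.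
by apply: cvg_pair; [exact: cvg_id|exact: cvg_cst].
Qed.

End Bilinear.

Section AlgebraIdentities.
Variable A : lcAlg R.
Implicit Types a b c : A.

Lemma lca_mulDl a b c : (a + b) ** c = a ** c + b ** c.
Proof. exact: (linD (lca_mulr_cont c).1). Qed.

Lemma lca_mulDr a b c : c ** (a + b) = c ** a + c ** b.
Proof. exact: (linD (lca_mull_cont c).1). Qed.

Lemma lca_mul0l a : (0 : A) ** a = 0.
Proof. exact: (lin0 (lca_mulr_cont a).1). Qed.

Lemma lca_mul0r a : a ** (0 : A) = 0.
Proof. exact: (lin0 (lca_mull_cont a).1). Qed.

Lemma lca_mulZl k a b : (k *: a) ** b = k *: (a ** b).
Proof. exact: (linZ (lca_mulr_cont b).1). Qed.

Lemma lca_mulZr k a b : a ** (k *: b) = k *: (a ** b).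
Proof. exact: (linZ (lca_mull_cont a).1). Qed.

Lemma lca_mulNl a b : (- a) ** b = - (a ** b).
Proof. exact: (linN (lca_mulr_cont b).1). Qed.

Lemma lca_mulNr a b : a ** (- b) = - (a ** b).
Proof. exact: (linN (lca_mull_cont a).1). Qed.

End AlgebraIdentities.

Lemma mx2_sum (K : nzRingType) (m : 'M[K]_2) :
  m = m 0 0 *: delta_mx 0 0 + m 0 1 *: delta_mx 0 1 +
      m 1 0 *: delta_mx 1 0 + m 1 1 *: delta_mx 1 1.
Proof.
have two (i : 'I_2) : i = 0 \/ i = 1.
  by case: i => [[|[|//]] hi]; [left|right]; exact/val_inj.
apply/matrixP => i j.
by have [->|->] := two i; have [->|->] := two j;
  rewrite !mxE /= !(mulr1, mulr0, addr0, add0r).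
Qed.

Section Matrices.
Variable D : lcAlg R.

(** Four copies of [D], already complete; with [mx2_tens] they become an explicit model of D (x)^
    M_2, to which [m2_stable] applies directly. *)
Definition mx2 : lcs R := prod_lcs (prod_lcs D D) (prod_lcs D D).

Definition mx2_mul (x y : mx2) : mx2 :=
  ((x.1.1 ** y.1.1 + x.1.2 ** y.2.1, x.1.1 ** y.1.2 + x.1.2 ** y.2.2),
   (x.2.1 ** y.1.1 + x.2.2 ** y.2.1, x.2.1 ** y.1.2 + x.2.2 ** y.2.2)).

Lemma cont_linear_mx11 : cont_linear (fun x : mx2 => x.1.1).
Proof. exact: (cont_linear_comp (@cont_linear_fst _ _) (@cont_linear_fst _ _)). Qed.

Lemma cont_linear_mx12 : cont_linear (fun x : mx2 => x.1.2).
Proof. exact: (cont_linear_comp (@cont_linear_snd _ _) (@cont_linear_fst _ _)). Qed.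

Lemma cont_linear_mx21 : cont_linear (fun x : mx2 => x.2.1).
Proof. exact: (cont_linear_comp (@cont_linear_fst _ _) (@cont_linear_snd _ _)). Qed.

Lemma cont_linear_mx22 : cont_linear (fun x : mx2 => x.2.2).
Proof. exact: (cont_linear_comp (@cont_linear_snd _ _) (@cont_linear_snd _ _)). Qed.

Lemma mx2_mul_bilinear : cont_bilinear mx2_mul.
Proof.
have mD := lca_mul_bilinear D.
have [c11 c12] := (cont_linear_mx11, cont_linear_mx12).
have [c21 c22] := (cont_linear_mx21, cont_linear_mx22).
by apply: cont_bilinear_pair; apply: cont_bilinear_pair; apply: cont_bilinearD;
  exact: cont_bilinear_comp.
Qed.

Lemma mx2_mulA : associative mx2_mul.
Proof.
by move=> x y z; congr ((_, _), (_, _)); rewrite /= !lca_mulDl !lca_mulDr !lca_mulA addrACA.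
Qed.

Definition mx2_alg : lcAlg R := LcAlg mx2_mul_bilinear mx2_mulA.

Lemma scale_bilinear (V : lcs R) : cont_bilinear (fun (v : V) (c : C_lcs R) => (c : C) *: v).
Proof.
split.
- by move=> v c x y; rewrite scalerDl scalerA.
- by move=> c a x y; rewrite /= scalerDr !scalerA mulrC.
move=> z; apply: (@cvg_comp _ _ _ (fun w : V * C^o => (w.2 : C^o, w.1))
  (fun w : C^o * V => w.1 *: w.2) (nbhs z) (nbhs (z.2 : C^o, z.1)));
  last exact: (@scale_continuous C V (z.2 : C^o, z.1)).
have Fz : Filter (nbhs z) := nbhs_filter z.
by apply: (@cvg_pair _ _ _ (nbhs z) (nbhs (z.2 : C^o)) (nbhs z.1));
  [exact: cvg_snd|exact: cvg_fst].
Qed.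

Lemma mx_coord_cont i j : cont_linear (fun m : M2 R => (m : 'M[C^o]_2) i j : C_lcs R).
Proof.
split; first by move=> c x y; rewrite !mxE.
by move=> x; exact: coord_continuous.
Qed.

Definition mx2_tens (d : D) (m : M2 R) : mx2_alg :=
  (((m : 'M[C^o]_2) 0 0 *: d, (m : 'M[C^o]_2) 0 1 *: d),
   ((m : 'M[C^o]_2) 1 0 *: d, (m : 'M[C^o]_2) 1 1 *: d)).

Lemma mx2_tens_bilinear : cont_bilinear mx2_tens.
Proof.
have h i j : cont_bilinear (fun (d : D) (m : M2 R) => (m : 'M[C^o]_2) i j *: d : D).
  apply: (cont_bilinear_comp (scale_bilinear D) (lcHom_id_subproof D)).
  exact: mx_coord_cont.
by apply: cont_bilinear_pair; apply: cont_bilinear_pair; exact: h.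
Qed.

Lemma mx2_tens_univ : is_ptensor mx2_tens.
Proof.
split; first exact: mx2_tens_bilinear.
move=> X b hb; have [l1 l2 _] := hb.
pose e i j : M2 R := delta_mx i j : 'M[C^o]_2.
pose f (x : mx2_alg) : X := b x.1.1 (e 0 0) + b x.1.2 (e 0 1) + b x.2.1 (e 1 0) + b x.2.2 (e 1 1).
have mxsum := @mx2_sum C^o.
exists f.
  split; last first.
    move=> d m; rewrite /f /= !(linZ (l2 _)) -!(linZ (l1 _)) -!(linD (l1 _)).
    by congr (b d _); rewrite [RHS](mxsum m).
  have h i j (g : mx2_alg -> D) : cont_linear g -> cont_linear (fun x => b (g x) (e i j)).
    by move=> /(cont_linear_comp (cont_bilinear_linl (e i j) hb)).
  exact: (cont_linearD (cont_linearD (cont_linearD (h _ _ _ cont_linear_mx11)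
    (h _ _ _ cont_linear_mx12)) (h _ _ _ cont_linear_mx21)) (h _ _ _ cont_linear_mx22)).
move=> g [lg cg] gE; apply/funext => x; rewrite /f -!gE -!(linD lg); congr g.
rewrite /mx2_tens !mxE /= !scale1r !scale0r.
by case: x => [[a b'] [c d]]; congr ((_, _), (_, _)); rewrite /= !(addr0, add0r).
Qed.

Lemma mx2_tens_mul d d' m m' :
  mx2_tens d m ** mx2_tens d' m' = mx2_tens (d ** d') (m ** m').
Proof.
by congr ((_, _), (_, _)); rewrite /= mxE !big_ord_recl big_ord0 addr0 scalerDl;
  rewrite !lca_mulZl !lca_mulZr !scalerA; congr (_ *: _ + _ *: _);
  congr (_ * _); congr (fun_of_matrix _ _ _); exact/val_inj.
Qed.

Definition mx2_ptensor : ptensor D (M2 R) := PTensor mx2_tens_univ mx2_tens_mul.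

End Matrices.
End Constructions.

(** * Split exact and M_2-stable functors *)

Section Functors.
Variable R : realType.
Local Notation C := R[i].
Local Notation "x ** y" := (lca_mul x y) (at level 40, left associativity).

Section Stability.
Variables (E : lcFunctor R) (E_M2 : m2_stable E).

Definition mx2_corner (D : lcAlg R) : lcHom D (mx2_alg D) :=
  tens_idem (mx2_ptensor D) (M2_e11_idem R).

Section Swap.
Variable D : lcAlg R.

Definition mx2_swap_fun (x : mx2_alg D) : mx2_alg D := ((x.2.2, x.2.1), (x.1.2, x.1.1)).

Lemma mx2_swap_linear : cont_linear mx2_swap_fun.
Proof.
by apply: cont_linear_pair; apply: cont_linear_pair;
  [exact: cont_linear_mx22|exact: cont_linear_mx21|
   exact: cont_linear_mx12|exact: cont_linear_mx11].
Qed.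

Lemma mx2_swap_mul : {morph mx2_swap_fun : x y / x ** y}.
Proof. by move=> x y; congr ((_, _), (_, _)); rewrite /= addrC. Qed.

Definition mx2_swap : lcHom (mx2_alg D) (mx2_alg D) := LcHom mx2_swap_linear mx2_swap_mul.

Lemma fmap_swapK x : fmap E mx2_swap (fmap E mx2_swap x) = x.
Proof.
rewrite -fmap_comp -[RHS]fmap_id; congr (fmap E _ x).
by apply: lcHom_eq => -[[a b] [c d]].
Qed.

End Swap.

(* [L] and [Rt] play the roles of multiplication by an isometry on the left and by
   its adjoint on the right.  [f] and the identity are the restrictions to the two
   diagonal corners of the same endomorphism of the 2x2 matrices over [D]. *)
Lemma fmap_inner (D : lcAlg R) (L Rt : D -> D) (f : lcHom D D) :
  cont_linear L -> cont_linear Rt ->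
  (forall x y, L (x ** y) = L x ** y) -> (forall x y, Rt (x ** y) = x ** Rt y) ->
  (forall x y, Rt x ** L y = x ** y) -> (forall x, f x = L (Rt x)) ->
  forall z, fmap E f z = z.
Proof.
move=> cL cR hL hR hRL fE z.
pose c (x : mx2_alg D) : mx2_alg D := ((L (Rt x.1.1), L x.1.2), (Rt x.2.1, x.2.2)).
have [c11 c12] := (cont_linear_mx11 D, cont_linear_mx12 D).
have [c21 c22] := (cont_linear_mx21 D, cont_linear_mx22 D).
have lc : cont_linear c.
  apply: cont_linear_pair; apply: cont_linear_pair => //.
  - exact: (cont_linear_comp cL (cont_linear_comp cR c11)).
  - exact: (cont_linear_comp cL c12).
  - exact: (cont_linear_comp cR c21).
have mc : {morph c : x y / x ** y}.
  move=> [[a b] [a' b']] [[x y] [x' y']]; congr ((_, _), (_, _)); rewrite /=.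
  - by rewrite (linD cR.1) (linD cL.1) !hR !hL -!hL hRL !hL.
  - by rewrite (linD cL.1) !hL -!hL hRL.
  - by rewrite (linD cR.1) !hR hRL.
  - by rewrite hRL.
pose F := LcHom lc mc.
(* [c] is the identity on the lower right corner. The inclusion of that corner induces a bijection,
   being the upper left one followed by the involution [mx2_swap]. *)
have FC x : fmap E F x = x.
  pose j := lcHom_comp (mx2_swap D) (mx2_corner D).
  have [g _ gK] := E_M2 (mx2_ptensor D).
  have -> : x = fmap E j (g (fmap E (mx2_swap D) x)).
    by rewrite fmap_comp gK fmap_swapK.
  rewrite -fmap_comp; congr (fmap E _ _).
  apply: lcHom_eq => d; rewrite /= /mx2_tens /mx2_swap_fun /c /= !mxE /=.
  by rewrite scale1r !scale0r (lin0 cR.1) !(lin0 cL.1).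
have inj : injective (fmap E (mx2_corner D)) by have [g] := E_M2 (mx2_ptensor D) => /can_inj.
apply: inj; rewrite -fmap_comp -[RHS]FC -fmap_comp; congr (fmap E _ z).
apply: lcHom_eq => d; rewrite /= /mx2_tens /c /= !mxE /= !scale1r !scale0r fE.
by rewrite (lin0 cR.1) (lin0 cL.1).
Qed.

(** The swap is conjugation by a permutation matrix. Exchanging rows and exchanging columns make
    sense without a unit in [D], so [fmap_inner] applies to the algebra [mx2_alg D]. *)
Lemma fmap_swap (D : lcAlg R) z : fmap E (mx2_swap D) z = z.
Proof.
pose L (x : mx2_alg D) : mx2_alg D := (x.2, x.1).
pose Rt (x : mx2_alg D) : mx2_alg D := ((x.1.2, x.1.1), (x.2.2, x.2.1)).
have [c11 c12] := (cont_linear_mx11 D, cont_linear_mx12 D).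
have [c21 c22] := (cont_linear_mx21 D, cont_linear_mx22 D).
apply: (@fmap_inner _ L Rt) => //.
- by apply: cont_linear_pair; [exact: cont_linear_snd|exact: cont_linear_fst].
- by apply: cont_linear_pair; apply: cont_linear_pair.
- by move=> x y; congr ((_, _), (_, _)); rewrite /= addrC.
Qed.

Section MatrixUnits.
Variables (A J : lcAlg R) (T : ptensor A J) (u11 u12 u21 u22 : J).
Hypotheses (h1111 : u11 ** u11 = u11) (h1112 : u11 ** u12 = u12)
  (h1121 : u11 ** u21 = 0) (h1122 : u11 ** u22 = 0)
  (h1211 : u12 ** u11 = 0) (h1212 : u12 ** u12 = 0)
  (h1221 : u12 ** u21 = u11) (h1222 : u12 ** u22 = u12)
  (h2111 : u21 ** u11 = u21) (h2112 : u21 ** u12 = u22)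
  (h2121 : u21 ** u21 = 0) (h2122 : u21 ** u22 = 0)
  (h2211 : u22 ** u11 = 0) (h2212 : u22 ** u12 = 0)
  (h2221 : u22 ** u21 = u21) (h2222 : u22 ** u22 = u22).

(** The four elements define a homomorphism from the 2x2 matrices over [A] to [T]. The two maps are
    its restrictions to the diagonal corners, which [mx2_swap] exchanges. *)
Lemma fmap_matrix_units x :
  fmap E (tens_idem T h1111) x = fmap E (tens_idem T h2222) x.
Proof.
have [t1 t2 ct] := (pt_univ T).1.
pose f (x : mx2_alg A) : T := pt_tens T x.1.1 u11 + pt_tens T x.1.2 u12 +
  (pt_tens T x.2.1 u21 + pt_tens T x.2.2 u22).
have cl u (g : mx2_alg A -> A) : cont_linear g -> cont_linear (fun x => pt_tens T (g x) u).
  by move=> /(cont_linear_comp (cont_bilinear_linl u (pt_univ T).1)).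
have lf : cont_linear f.
  exact: (cont_linearD
    (cont_linearD (cl _ _ (cont_linear_mx11 A)) (cl _ _ (cont_linear_mx12 A)))
    (cont_linearD (cl _ _ (cont_linear_mx21 A)) (cl _ _ (cont_linear_mx22 A)))).
have t0l v : pt_tens T 0 v = 0 by exact: (lin0 (t2 v)).
have t0r a : pt_tens T a 0 = 0 by exact: (lin0 (t1 a)).
have tD v a b : pt_tens T (a + b) v = pt_tens T a v + pt_tens T b v by exact: (linD (t2 v)).
have mf : {morph f : x y / x ** y}.
  move=> [[a b] [a' b']] [[p q] [p' q']]; rewrite /f /=.
  rewrite !lca_mulDl !lca_mulDr !pt_mul.
  rewrite h1111 h1112 h1121 h1122 h1211 h1212 h1221 h1222.
  rewrite h2111 h2112 h2121 h2122 h2211 h2212 h2221 h2222.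
  rewrite !t0r !(addr0, add0r) !tD.
  by congr (_ + _); exact: addrACA.
pose F := LcHom lf mf.
have -> : tens_idem T h1111 = lcHom_comp F (mx2_corner A).
  apply: lcHom_eq => a; rewrite /= /f /= /mx2_tens /= !mxE /=.
  by rewrite scale1r !scale0r !t0l !addr0.
have -> : tens_idem T h2222 = lcHom_comp F (lcHom_comp (mx2_swap A) (mx2_corner A)).
  apply: lcHom_eq => a; rewrite /= /f /= /mx2_swap_fun /mx2_tens /= !mxE /=.
  by rewrite scale1r !scale0r !t0l !add0r.
by rewrite !fmap_comp fmap_swap.
Qed.

End MatrixUnits.

End Stability.

(** * Consequences of split exactness *)

Section SplitExact.
Variables (E : lcFunctor R) (E_split : split_exact E).

Section Product.
Variables B B' : lcAlg R.

Definition prod_mul (x y : prod_lcs B B') : prod_lcs B B' := (x.1 ** y.1, x.2 ** y.2).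

Lemma prod_mul_bilinear : cont_bilinear prod_mul.
Proof.
apply: cont_bilinear_pair; apply: cont_bilinear_comp; try exact: lca_mul_bilinear.
all: by [exact: cont_linear_fst|exact: cont_linear_snd].
Qed.

Lemma prod_mulA : associative prod_mul.
Proof. by move=> x y z; congr (_, _); rewrite /= lca_mulA. Qed.

Definition prod_alg : lcAlg R := LcAlg prod_mul_bilinear prod_mulA.

Definition prod_fst : lcHom prod_alg B := @LcHom _ prod_alg B _
  (@cont_linear_fst _ B B') (fun _ _ => erefl).

Definition prod_snd : lcHom prod_alg B' := @LcHom _ prod_alg B' _
  (@cont_linear_snd _ B B') (fun _ _ => erefl).

Lemma prod_inl_mul : {morph (fun b => (b, 0) : prod_alg) : x y / x ** y}.
Proof. by move=> x y; congr (_, _); rewrite /= lca_mul0l. Qed.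

Lemma prod_inr_mul : {morph (fun b => (0, b) : prod_alg) : x y / x ** y}.
Proof. by move=> x y; congr (_, _); rewrite /= lca_mul0l. Qed.

Definition prod_inl : lcHom B prod_alg :=
  @LcHom R B prod_alg (fun b => (b, 0))
    (cont_linear_pair (lcHom_id_subproof B) (@cont_linear0 _ B B')) prod_inl_mul.

Definition prod_inr : lcHom B' prod_alg :=
  @LcHom R B' prod_alg (fun b => (0, b))
    (cont_linear_pair (@cont_linear0 _ B' B) (lcHom_id_subproof B')) prod_inr_mul.

Lemma prod_split : split_extension prod_inr prod_fst.
Proof.
split; last by exists prod_inl.
split.
  split=> [x y [] //|x|z]; last by exists (z, 0).
  split=> [|[y <-] //]; case: x => [a b] /= ->; by exists b.
exists snd, (fun b => (b, 0)); split=> //.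
- exact: cont_linear_snd.
- exact: (cont_linear_pair (lcHom_id_subproof B) (@cont_linear0 _ B B')).
- by move=> [a b]; congr (_, _); rewrite /= ?add0r ?addr0.
Qed.

End Product.

(** The zero map factors as [prod_fst] after [prod_inr], two consecutive maps of a split
    extension. *)
Lemma fmap_zero (A B : lcAlg R) (f : lcHom A B) : (forall x, f x = 0) ->
  forall x, fmap E f x = 0.
Proof.
move=> f0 x; have [_ h _] := E_split (prod_split B A).
have -> : f = lcHom_comp (prod_fst B A) (prod_inr B A) by apply: lcHom_eq.
by rewrite fmap_comp; apply/h; exists x.
Qed.

(** The classes of [g] and of [prod_inl] agree in the first factor, so their difference comes from
    the second one; projecting to [B'] identifies it. *)
Lemma fmap_graph (B B' : lcAlg R) (h : lcHom B B') (g : lcHom B (prod_alg B B')) :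
  (forall x, g x = (x, h x)) -> forall x,
  fmap E g x = fmap E (prod_inl B B') x + fmap E (prod_inr B B') (fmap E h x).
Proof.
move=> gE x; have [_ ex _] := E_split (prod_split B B').
have /ex[y yE] : fmap E (prod_fst B B') (fmap E g x - fmap E (prod_inl B B') x) = 0.
  rewrite raddfB -!fmap_comp; apply/eqP; rewrite subr_eq0; apply/eqP.
  by congr (fmap E _ x); apply: lcHom_eq => b /=; rewrite gE.
have : fmap E (prod_snd B B') (fmap E g x - fmap E (prod_inl B B') x) =
    fmap E (prod_snd B B') (fmap E (prod_inr B B') y) by rewrite yE.
rewrite raddfB -!fmap_comp.
have -> : fmap E (lcHom_comp (prod_snd B B') (prod_inl B B')) x = 0 by exact: fmap_zero.
have -> : lcHom_comp (prod_snd B B') (prod_inr B B') = lcHom_id B' by exact: lcHom_eq.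
have -> : lcHom_comp (prod_snd B B') g = h by apply: lcHom_eq => b /=; rewrite gE.
by rewrite subr0 fmap_id fmap_comp => ->; rewrite yE addrC subrK.
Qed.

(** Orthogonality makes the sum of [f] and [g] a homomorphism on the product algebra, and [k] is
    that sum composed with the graph of [h]. *)
Lemma fmap_orthogonal (A A' B : lcAlg R) (f : lcHom A B) (g : lcHom A' B) (h : lcHom A A')
    (k : lcHom A B) :
  (forall x y, f x ** g y = 0) -> (forall x y, g y ** f x = 0) ->
  (forall x, k x = f x + g (h x)) ->
  forall x, fmap E k x = fmap E f x + fmap E g (fmap E h x).
Proof.
move=> fg gf kE x.
pose s (z : prod_alg A A') : B := f z.1 + g z.2.
have ls : cont_linear s.
  apply: cont_linearD.
    exact: (cont_linear_comp (hom_linear f) (@cont_linear_fst _ A A')).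
  exact: (cont_linear_comp (hom_linear g) (@cont_linear_snd _ A A')).
have ms : {morph s : x y / x ** y}.
  move=> [a b] [a' b']; rewrite /s /= !hom_mul lca_mulDl !lca_mulDr.
  by rewrite fg gf addr0 add0r.
pose S := LcHom ls ms.
have mg : {morph (fun x => (x, h x) : prod_alg A A') : x y / x ** y}.
  by move=> a b; rewrite hom_mul.
pose G := @LcHom R A (prod_alg A A') (fun x => (x, h x))
  (cont_linear_pair (lcHom_id_subproof A) (hom_linear h)) mg.
have -> : k = lcHom_comp S G by apply: lcHom_eq => a; rewrite kE.
rewrite fmap_comp (@fmap_graph _ _ h)// raddfD -!fmap_comp.
congr (fmap E _ x + _); first apply: lcHom_eq => a.
  by rewrite /= /s /= (lin0 (hom_linear g).1) addr0.
rewrite !fmap_comp -fmap_comp; congr (fmap E _ _); apply: lcHom_eq => a.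
by rewrite /= /s /= (lin0 (hom_linear f).1) add0r.
Qed.

End SplitExact.
End Functors.

(** * Operators on Hilbert spaces *)

Section HilbertSpaces.
Variable R : realType.
Local Notation C := R[i].
Local Notation nm := (@ComplexField.Normc.normc R).

(** The norm takes values in [C]; its real part keeps all estimates in the ordered field [R]. *)
Definition hn (V : normedModType C) (x : V) : R := complex.Re `|x|.

Section RealNorm.
Variable V : normedModType C.
Implicit Types x y : V.

Lemma hnE x : `|x| = (hn x)%:C.
Proof.
have : 0 <= `|x| by [].
by rewrite /hn; case: `|x| => a b; rewrite lecE /= => /andP[/eqP ->].
Qed.

Lemma hn_ge0 x : 0 <= hn x.
Proof. by have := normr_ge0 x; rewrite hnE lecR. Qed.

Lemma hnD x y : hn (x + y) <= hn x + hn y.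
Proof. by have := ler_normD x y; rewrite !hnE -rmorphD lecR. Qed.

Lemma hnZ c x : hn (c *: x) = nm c * hn x.
Proof.
by apply: (@complexI R); rewrite rmorphM /= -!hnE normrZ -cnormE.
Qed.

Lemma hnB x y : hn (x - y) = hn (y - x).
Proof. by rewrite /hn distrC. Qed.

Lemma hn0 : hn (0 : V) = 0.
Proof. by rewrite /hn normr0. Qed.

Lemma hn_eq0 x : hn x = 0 -> x = 0.
Proof. by move=> h; apply/eqP; rewrite -normr_eq0 hnE h. Qed.

Lemma hn_gt0 x : x != 0 -> 0 < hn x.
Proof.
move=> x0; rewrite lt_neqAle hn_ge0 andbT eq_sym.
by apply: contra x0 => /eqP/hn_eq0 ->.
Qed.

Lemma cvg_hnP (T : Type) (F : set_system T) (FF : Filter F) (f : T -> V) (l : V) :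
  f @ F --> l <-> forall e : R, 0 < e -> \forall x \near F, hn (l - f x) < e.
Proof.
split=> [/cvgrPdist_lt h e e0|h].
  have := h e%:C; rewrite ltcR => /(_ e0); apply: filterS => x.
  by rewrite hnE ltcR.
apply/cvgrPdist_lt => e; case: e => a b; rewrite ltcE /= => /andP[/eqP -> a0].
by apply: filterS (h a a0) => x; rewrite hnE -[a +i* 0]/(a%:C) ltcR.
Qed.

End RealNorm.

Lemma hn_nm (z : C^o) : hn z = nm z.
Proof. by rewrite /hn cnormE. Qed.

Lemma lin_bounded_continuous (V W : normedModType C) (f : V -> W) (M : R) :
  linear f -> (forall x, hn (f x) <= M * hn x) -> continuous f.
Proof.
move=> lf fM x; apply/cvg_hnP => e e0.
have M1 : 0 < `|M| + 1 by rewrite ltr_wpDl.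
have : nbhs x [set y | hn (x - y) < e / (`|M| + 1)].
  have /cvg_hnP : id @ x --> x by exact: cvg_id.
  by apply; exact: divr_gt0.
apply: filterS => y /= hy.
have -> : f x - f y = f (x - y).
  by rewrite (linB lf).
apply: (le_lt_trans (fM _)); apply: (@le_lt_trans _ _ ((`|M| + 1) * hn (x - y))).
  by rewrite ler_wpM2r ?hn_ge0// (le_trans (ler_norm _))// lerDl.
by rewrite -ltr_pdivlMl// mulrC.
Qed.

Section InnerProduct.
Variable H : hilbert R.
Implicit Types x y z : H.

Lemma ipDl x y z : ip (x + y) z = ip x z + ip y z.
Proof. by have := ip_linear 1 x y z; rewrite scale1r mul1r. Qed.

Lemma ip0l z : ip 0 z = 0.
Proof.
have := ipDl 0 0 z; rewrite addr0 => /eqP.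
by rewrite -subr_eq0 opprD addrA subrr sub0r oppr_eq0 => /eqP.
Qed.

Lemma ipZl c x z : ip (c *: x) z = c * ip x z.
Proof. by have := ip_linear c x 0 z; rewrite addr0 ip0l addr0. Qed.

Lemma ipBl x y z : ip (x - y) z = ip x z - ip y z.
Proof. by rewrite ipDl -scaleN1r ipZl mulN1r. Qed.

Lemma ipZr c x z : ip x (c *: z) = c^*%C * ip x z.
Proof. by rewrite ip_conj ipZl rmorphM /= -ip_conj. Qed.

Lemma ip0r x : ip x 0 = 0.
Proof. by rewrite ip_conj ip0l rmorph0. Qed.

Lemma ipBr x y z : ip x (y - z) = ip x y - ip x z.
Proof. by rewrite ip_conj ipBl rmorphB /= -!ip_conj. Qed.

Lemma ip_suml (I : Type) (r : seq I) (F : I -> H) z :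
  ip (\sum_(i <- r) F i) z = \sum_(i <- r) ip (F i) z.
Proof. exact: (big_morph (fun x => ip x z) (fun x y => ipDl x y z) (ip0l z)). Qed.

Lemma ip_hn x : ip x x = (hn x ^+ 2)%:C.
Proof. by rewrite ip_norm hnE rmorphXn. Qed.

Lemma cauchy_schwarz x y : nm (ip x y) <= hn x * hn y.
Proof.
have [->|y0] := eqVneq y 0; first by rewrite ip0r nm0 hn0 mulr0.
have n0 : 0 < hn y ^+ 2 by rewrite exprn_gt0// hn_gt0.
set n := hn y ^+ 2 in n0; set c := ip x y.
have cc : c * c^*%C = (nm c ^+ 2)%:C by rewrite -sqr_normc cnormE rmorphXn.
have cc' : n%:C * (n%:C * (hn x ^+ 2)%:C - c * c^*%C) =
    (n * (n * hn x ^+ 2 - nm c ^+ 2))%:C :> C.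
  by rewrite cc -rmorphM -rmorphB -rmorphM.
have : 0 <= hn (n%:C *: x - c *: y) ^+ 2 by exact: sqr_ge0.
have -> : hn (n%:C *: x - c *: y) ^+ 2 = n * (n * hn x ^+ 2 - nm c ^+ 2).
  apply: (@complexI R); rewrite -ip_hn ipBl !ipBr !ipZl !ipZr [ip y x]ip_conj -/c.
  rewrite !ip_hn -/n conjc_real -cc'.
  by move: n%:C (c^*)%C (hn x ^+ 2)%:C => m d h; ring.
rewrite pmulr_rge0// subr_ge0 -exprMn mulrC ler_sqr ?nnegrE ?mulr_ge0 ?hn_ge0 ?nm_ge0//.
Qed.

Lemma ip_continuous y : continuous (fun x => ip x y : C^o).
Proof.
apply: (@lin_bounded_continuous _ _ _ (hn y)).
  by move=> c x z; exact: ip_linear.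
by move=> x; rewrite hn_nm mulrC cauchy_schwarz.
Qed.

Definition orthonormal (g : nat -> H) : Prop :=
  forall m n, ip (g m) (g n) = (m == n)%:R.

Definition total (g : nat -> H) : Prop :=
  forall x, (forall n, ip x (g n) = 0) -> x = 0.

Section Orthonormal.
Variable g : nat -> H.
Hypothesis og : orthonormal g.

Lemma ip_sum_orthonormal (r : seq nat) (a : nat -> C) j : uniq r ->
  ip (\sum_(i <- r) a i *: g i) (g j) = if j \in r then a j else 0.
Proof.
move=> ur; rewrite ip_suml; case: ifPn => jr.
  rewrite (bigD1_seq j)//= ipZl og eqxx mulr1 big1 ?addr0// => i ij.
  by rewrite ipZl og (negbTE ij) mulr0.
rewrite big1_seq// => i /andP[_ ir]; rewrite ipZl og; case: eqP => [ij|_].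
  by move: jr; rewrite -ij ir.
by rewrite mulr0.
Qed.

Lemma pythagoras (r : seq nat) (a : nat -> C) : uniq r ->
  hn (\sum_(i <- r) a i *: g i) ^+ 2 = \sum_(i <- r) nm (a i) ^+ 2.
Proof.
move=> ur; apply: (@complexI R); rewrite -ip_hn ip_suml rmorph_sum /=.
rewrite big_seq [RHS]big_seq; apply: eq_bigr => i ir.
rewrite ipZl ip_conj ip_sum_orthonormal// ir -sqr_normc cnormE.
by rewrite rmorphXn.
Qed.

Lemma bessel (r : seq nat) x : uniq r ->
  \sum_(i <- r) nm (ip x (g i)) ^+ 2 <= hn x ^+ 2.
Proof.
move=> ur; rewrite -subr_ge0 -pythagoras//.
set s := \sum_(i <- r) _.
have sx : ip s x = (hn s ^+ 2)%:C.
  rewrite ip_suml pythagoras// rmorph_sum /=; apply: eq_bigr => i _.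
  by rewrite ipZl [ip (g i) x]ip_conj -sqr_normc cnormE rmorphXn.
have -> : hn x ^+ 2 - hn s ^+ 2 = hn (x - s) ^+ 2; last exact: sqr_ge0.
apply: (@complexI R); rewrite -ip_hn ipBl !ipBr sx [ip x s]ip_conj sx conjc_real.
by rewrite !ip_hn subrr subr0 rmorphB.
Qed.

Lemma orthonormal_series (a : nat -> C) (M : R) :
  (forall n, \sum_(0 <= i < n) nm (a i) ^+ 2 <= M) ->
  cvgn (series (fun i => a i *: g i)).
Proof.
move=> hM; have : cvgn (series (fun i => nm (a i) ^+ 2)).
  apply: nondecreasing_is_cvgn.
    by apply: nondecreasing_series => n _ _; exact: sqr_ge0.
  by exists M => _ [n _ <-]; exact: hM.
move=> /cauchy_cvgP/cauchy_seriesP h.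
apply/cauchy_cvgP/cauchy_seriesP => -[e b]; rewrite ltcE /= => /andP[/eqP -> e0].
have := h (e ^+ 2) (exprn_gt0 _ e0); apply: filterS => -[m n] /=.
rewrite hnE -[e +i* 0]/(e%:C) ltcR -pythagoras ?iota_uniq//.
by rewrite ger0_norm ?sqr_ge0// ltr_sqr ?nnegrE ?hn_ge0// ltW.
Qed.

End Orthonormal.
End InnerProduct.

Section PartialOperators.
Variables H K : hilbert R.
Implicit Types (g : nat -> H) (h : nat -> K) (c : nat -> C).

(** For orthonormal [g] and [h] and bounded [c], this sends [g n] to [c n] times [h n] and kills the
    orthogonal complement of the [g n]. Diagonal operators, the isometry of a shift, its adjoint and
    the unitaries between two bases are all instances. *)
Definition shift_op c g h (x : H) : K :=
  limn (series (fun n => (c n * ip x (g n)) *: h n)).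

Section Bounded.
Variables (c : nat -> C) (g : nat -> H) (h : nat -> K) (M : R).
Hypotheses (og : orthonormal g) (oh : orthonormal h) (cM : forall n, nm (c n) <= M).

Lemma shift_op_bound_ge0 : 0 <= M.
Proof. exact: le_trans (nm_ge0 (c 0%N)) (cM 0%N). Qed.

Lemma shift_op_sum_le x n :
  \sum_(0 <= i < n) nm (c i * ip x (g i)) ^+ 2 <= (M * hn x) ^+ 2.
Proof.
rewrite exprMn; apply: le_trans (_ : M ^+ 2 * \sum_(0 <= i < n) nm (ip x (g i)) ^+ 2 <= _).
  rewrite mulr_sumr; apply: ler_sum => i _; rewrite nmM exprMn.
  by rewrite ler_wpM2r ?sqr_ge0// ler_sqr ?nnegrE ?nm_ge0 ?shift_op_bound_ge0.
by rewrite ler_wpM2l ?sqr_ge0//; apply: bessel => //; exact: iota_uniq.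
Qed.

Lemma shift_op_cvg x :
  series (fun n => (c n * ip x (g n)) *: h n) @ \oo --> shift_op c g h x.
Proof.
by have := orthonormal_series oh (shift_op_sum_le x).
Qed.

Lemma shift_op_linear : linear (shift_op c g h).
Proof.
move=> a x y; apply: cvg_lim => //.
have -> : series (fun n => (c n * ip (a *: x + y) (g n)) *: h n) =
    (fun n => a *: series (fun n => (c n * ip x (g n)) *: h n) n +
              series (fun n => (c n * ip y (g n)) *: h n) n).
  apply/funext => n; rewrite /series /= scaler_sumr -big_split; apply: eq_bigr => i _ /=.
  by rewrite ip_linear mulrDr scalerDl mulrCA scalerA.
apply: cvgD; last exact: shift_op_cvg.
by apply: cvgZl_tmp; exact: shift_op_cvg.
Qed.

Lemma shift_op_coef x n : ip (shift_op c g h x) (h n) = c n * ip x (g n).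
Proof.
have h1 : (fun N => ip (series (fun n => (c n * ip x (g n)) *: h n) N) (h n) : C^o) @ \oo -->
    (ip (shift_op c g h x) (h n) : C^o).
  apply: (@cvg_comp _ _ _ _ (fun z => ip z (h n) : C^o) _ _ _ (@shift_op_cvg x)).
  exact: ip_continuous.
apply: (cvg_unique (@norm_hausdorff C C^o) h1).
apply: cvg_near_cst; exists n.+1 => // N /= nN.
rewrite /series /= ip_sum_orthonormal ?iota_uniq//.
by rewrite mem_index_iota leq0n nN.
Qed.

Lemma shift_op_le x : hn (shift_op c g h x) <= M * hn x.
Proof.
apply/ler_addgt0Pr => e e0.
have /cvg_hnP := @shift_op_cvg x; move=> /(_ e e0) /filter_ex[n hn_n].
rewrite -[shift_op c g h x](subrK (series (fun n => (c n * ip x (g n)) *: h n) n)).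
apply: (le_trans (hnD _ _)); rewrite addrC lerD ?(ltW hn_n)//.
have Mx : 0 <= M * hn x by rewrite mulr_ge0 ?hn_ge0 ?shift_op_bound_ge0.
rewrite -ler_sqr ?nnegrE ?hn_ge0// /series /= pythagoras ?iota_uniq//.
exact: shift_op_sum_le.
Qed.

Lemma shift_op_basis n : shift_op c g h (g n) = c n *: h n.
Proof.
apply: cvg_lim => //; apply: cvg_near_cst; exists n.+1 => // N /= nN.
rewrite /series /= (bigD1_seq n) ?iota_uniq ?mem_index_iota ?nN//= og eqxx mulr1.
by rewrite big1 ?addr0// => i ni; rewrite og eq_sym (negbTE ni) mulr0 scale0r.
Qed.

Lemma shift_op_orth x : (forall n, ip x (g n) = 0) -> shift_op c g h x = 0.
Proof.
move=> x0; apply: cvg_lim => //; apply: cvg_near_cst; exists 0%N => // N /= _.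
by rewrite /series /= big1// => i _; rewrite x0 mulr0 scale0r.
Qed.

End Bounded.

Lemma op_norm_le (S : H -> K) (M : R) :
  (forall x, hn (S x) <= M * hn x) -> 0 <= M -> op_norm S <= M.
Proof.
move=> hS M0; apply: ge_sup; first by exists (hn (S 0)), 0 => //=; rewrite normr0.
move=> _ [x /= x1 <-]; apply: (le_trans (hS x)).
by rewrite ler_piMr//; move: x1; rewrite hnE -[1]/(1%:C) lecR.
Qed.

End PartialOperators.

Section Bases.
Variable H : hilbert R.
Implicit Types (g : nat -> H) (x : H).

Lemma basis_expansion g x : orthonormal g -> total g ->
  series (fun n => ip x (g n) *: g n) @ \oo --> x.
Proof.
move=> og tg; have c1 (n : nat) : nm ((fun=> 1 : C) n) <= 1 by rewrite nm1.
have := shift_op_cvg og og c1 (x := x).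
have -> : (fun n => (1 * ip x (g n)) *: g n) = (fun n => ip x (g n) *: g n).
  by apply/funext => n; rewrite mul1r.
have -> // : shift_op (fun=> 1) g g x = x.
apply/eqP; rewrite -subr_eq0; apply/eqP/tg => n.
by rewrite ipBl (shift_op_coef og og c1) mul1r subrr.
Qed.

Lemma bounded_op_eq (K : normedModType C) (S T : H -> K) g : orthonormal g -> total g ->
  bounded_op S -> bounded_op T -> (forall n, S (g n) = T (g n)) -> S = T.
Proof.
move=> og tg [lS cS] [lT cT] ST; apply/funext => x.
have h := basis_expansion og tg (x := x).
have hS : S \o series (fun n => ip x (g n) *: g n) @ \oo --> S x.
  exact: (@cvg_comp _ _ _ _ S _ _ _ h (cS x)).
have hT : T \o series (fun n => ip x (g n) *: g n) @ \oo --> T x.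
  exact: (@cvg_comp _ _ _ _ T _ _ _ h (cT x)).
have E : T \o series (fun n => ip x (g n) *: g n) = S \o series (fun n => ip x (g n) *: g n).
  apply/funext => n; rewrite /series /= (lin_sum lS) (lin_sum lT).
  by apply: eq_bigr => i _; rewrite (linZ lS) (linZ lT) ST.
by rewrite E in hT; exact: (cvg_unique (@norm_hausdorff C K) hS hT).
Qed.

Definition orthonormal_set (M : set H) : Prop :=
  forall x y, M x -> M y -> ip x y = `[< x = y >]%:R.

(** The distance is the square root of 2; the bound 1 is all that is needed to separate balls of
    radius 1/2. *)
Lemma orthonormal_set_dist M x y : orthonormal_set M -> M x -> M y ->
  x <> y -> 1 <= hn (x - y).
Proof.
move=> oM Mx My xy; rewrite -[leLHS]ger0_norm// -ler_sqr ?nnegrE ?hn_ge0// normr1 expr1n.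
have : (hn (x - y) ^+ 2)%:C = 2%:C :> C.
  rewrite -ip_hn ipBl !ipBr !oM//.
  have -> : `[< x = x >] = true by exact/asboolP.
  have -> : `[< y = y >] = true by exact/asboolP.
  have -> : `[< x = y >] = false by apply/asboolP.
  have -> : `[< y = x >] = false by apply/asboolP => yx; exact/xy.
  by rewrite subr0 sub0r opprK -[2%:C]/((1 + 1)%:C) rmorphD.
by move=> /(@complexI R) ->; rewrite ler1n.
Qed.

Lemma maximal_orthonormal : exists2 M : set H, orthonormal_set M &
  forall x, (forall e, M e -> ip x e = 0) -> x = 0.
Proof.
have [F Fo Ft|M [oM hM]] := @Zorn_bigcup H orthonormal_set.
  move=> x y [X FX Xx] [Y FY Yy].
  have [XY|YX] := Ft _ _ FX FY; first exact: (Fo Y FY _ _ (XY _ Xx)).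
  exact: (Fo X FX _ _ Xx (YX _ Yy)).
exists M => // x xM; apply/eqP; apply/negPn/negP => x0.
have n0 := hn_gt0 x0.
pose u := ((hn x)^-1)%:C *: x.
have uM e : M e -> ip u e = 0 by move=> Me; rewrite ipZl xM// mulr0.
have uu : ip u u = 1.
  rewrite ip_hn hnZ nm_real gtr0_norm ?invr_gt0// mulVf ?gt_eqF//.
  by rewrite expr1n.
have Mu : ~ M u by move=> /uM; rewrite uu; exact/eqP/oner_neq0.
apply: (hM (M `|` [set u])).
  split; first by move=> e; left.
  by move=> /(_ u) h; apply/Mu/h; right.
move=> e f [Me|->] [Mf|->].
- exact: oM.
- rewrite ip_conj uM// rmorph0; case: asboolP => // eu.
  by move: Mu; rewrite -eu.
- rewrite uM//; case: asboolP => // eu.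
  by move: Mu; rewrite eu.
- rewrite uu; have -> // : `[< u = u >] = true by exact/asboolP.
Qed.

End Bases.

(** A maximal orthonormal set is countable by separability, and infinite because otherwise finite
    Fourier sums would exhaust [H]. Cantor-Bernstein then enumerates it by the natural numbers. *)
Lemma orthonormal_basis_exists (H : sepHilbert R) :
  exists g : nat -> H, orthonormal g /\ total g.
Proof.
have [M oM tM] := maximal_orthonormal H.
have Mcount : countable M.
  have [D Dc Dd] := sh_separable H.
  have near (x : H) : exists d, D d /\ hn (x - d) < 1 / 2.
    pose O := [set y : H | hn (x - y) < 1 / 2]°.
    have xO : O x.
      have /cvg_hnP : id @ x --> x by exact: cvg_id.
      by apply; rewrite divr_gt0.
    have [|y [/interior_subset yO Dy]] := Dd O _ (@open_interior _ _).
      by exists x.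
    by exists y.
  pose f x := sval (cid (near x)).
  have fP x : D (f x) /\ hn (x - f x) < 1 / 2 by rewrite /f; case: cid.
  have /countable_injP[k kinj] := Dc.
  apply/countable_injP; exists (k \o f) => x y xM yM /= /kinj.
  rewrite !inE => /(_ (fP x).1 (fP y).1) fxy.
  apply: contrapT => xy.
  have := orthonormal_set_dist oM (set_mem xM) (set_mem yM) xy.
  apply/negP; rewrite -ltNge -[x - y](subrKA (f x)) (splitr 1).
  apply: (le_lt_trans (hnD _ _)); apply: ltrD; first by have [] := fP x.
  by rewrite hnB fxy; have [] := fP y.
have Minf : infinite_set M.
  move=> /finite_seqP[s0 Ms0]; pose s := undup s0.
  have Ms x : M x <-> x \in s by rewrite Ms0 /= mem_undup.
  have us : uniq s by exact: undup_uniq.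
  have Mn i : (i < size s)%N -> M (nth 0 s i) by move=> i_s; apply/Ms; exact: mem_nth.
  have [x hx] := sh_infinite_dim (fun i : 'I_(size s) => nth 0 s i : H).
  apply: (hx (fun i => ip x (nth 0 s i))).
  apply/eqP; rewrite -subr_eq0; apply/eqP/tM => e /Ms es.
  have js : (index e s < size s)%N by rewrite index_mem.
  rewrite -[e](nth_index 0 es) ipBl ip_suml (bigD1 (Ordinal js))//= big1 => [|i ij].
    rewrite ipZl (oM _ _ (Mn _ js) (Mn _ js)).
    by rewrite asboolT// mulr1 addr0 subrr.
  rewrite ipZl (oM _ _ (Mn _ (ltn_ord i)) (Mn _ js)).
  rewrite asboolF ?mulr0// => /eqP; rewrite nth_uniq// => /eqP h.
  by move: ij; rewrite -val_eqE /= h eqxx.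
have /card_esym/card_set_bijP[g [gM gi gs]] := Cantor_Bernstein Mcount (proj1 (infiniteP _) Minf).
exists g; split.
  move=> m n; rewrite (oM _ _ (gM m I) (gM n I)); congr (nat_of_bool _)%:R.
  apply/asboolP/eqP => [mn|-> //]; apply: gi => //; exact: in_setT.
move=> x xg; apply: tM => e Me; have [n _ <-] := gs e Me; exact: xg.
Qed.

End HilbertSpaces.

(** * Diagonal operators in operator ideals *)

Section IdealOperators.
Variable R : realType.
Local Notation C := R[i].
Local Notation nm := (@ComplexField.Normc.normc R).
Local Notation I01 := (set_type `[0 : R, 1]).
Local Notation "x ** y" := (lca_mul x y) (at level 40, left associativity).

(** An explicit real bound, since [op_norm] is a supremum in [R] and only meaningful once
    boundedness is known. *)
Definition opbd (H K : hilbert R) (M : R) (S : H -> K) : Prop :=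
  [/\ 0 <= M, linear S & forall x, hn (S x) <= M * hn x].

Lemma opbd_bounded (H K : hilbert R) M (S : H -> K) : opbd M S -> bounded_op S.
Proof. by move=> [_ lS hS]; split=> //; exact: lin_bounded_continuous lS hS. Qed.

Lemma opbd_id (H : hilbert R) : opbd 1 (@id H).
Proof. by split=> // x; rewrite mul1r. Qed.

Lemma opbd_shift (H K : hilbert R) c (g : nat -> H) (h : nat -> K) M :
  orthonormal g -> orthonormal h -> (forall n, nm (c n) <= M) -> opbd M (shift_op c g h).
Proof.
move=> og oh cM; split; first exact: shift_op_bound_ge0 cM.
  exact: shift_op_linear og oh cM.
exact: shift_op_le.
Qed.

Lemma bounded_op_comp (H1 H2 H3 : hilbert R) (S : H2 -> H3) (T : H1 -> H2) :
  bounded_op S -> bounded_op T -> bounded_op (S \o T).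
Proof.
move=> [lS cS] [lT cT]; split; first by move=> c x y /=; rewrite lT lS.
by move=> x; apply: continuous_comp; [exact: cT|exact: cS].
Qed.

Lemma op_norm_ge0 (H K : hilbert R) (M : R) (S : H -> K) : opbd M S -> 0 <= op_norm S.
Proof.
move=> [M0 lS hS]; apply: sup_upper_bound.
  split; first by exists (hn (S 0)), 0 => //=; rewrite normr0.
  exists M => _ [x /= x1 <-]; apply: (le_trans (hS x)).
  by rewrite ler_piMr//; move: x1; rewrite hnE -[1]/(1%:C) lecR.
by exists 0; rewrite /= ?normr0// (lin0 lS) normr0.
Qed.

Variables (J : banachIdeal R) (H : sepHilbert R).
Implicit Types (a b : J H) (S T : H -> H).

(** [bi_ideal] only asserts that some element of the ideal has the operator [S a T]. It is unique by
    [bi_inj], and the default 0 never intervenes when [S] and [T] are bounded. *)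
Definition lract S T a : J H := xget 0 [set b | bi_op b = S \o bi_op a \o T].

Lemma lract_spec M N S T a : opbd M S -> opbd N T ->
  bi_op (lract S T a) = S \o bi_op a \o T /\ hn (lract S T a) <= M * hn a * N.
Proof.
move=> hS hT; have [b bE bn] := bi_ideal a (opbd_bounded hS) (opbd_bounded hT).
have h : bi_op (lract S T a) = S \o bi_op a \o T.
  exact: (@xgetPex _ 0 [set b | bi_op b = S \o bi_op a \o T] (ex_intro _ b bE)).
split=> //; have -> : lract S T a = b by apply: bi_inj; rewrite h.
have [[M0 _ SM] [N0 _ TN]] := (hS, hT).
move: bn; rewrite !hnE -!rmorphM lecR => /le_trans; apply.
rewrite ler_pM ?mulr_ge0 ?hn_ge0 ?(op_norm_ge0 hS) ?(op_norm_ge0 hT)//.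
  by rewrite ler_wpM2r ?hn_ge0// op_norm_le.
exact: op_norm_le.
Qed.

Lemma lractE M N S T a x : opbd M S -> opbd N T ->
  bi_op (lract S T a) x = S (bi_op a (T x)).
Proof. by move=> hS hT; have [-> _] := lract_spec a hS hT. Qed.

Lemma ideal_ext a b : (forall x, bi_op a x = bi_op b x) -> a = b.
Proof. by move=> h; apply/bi_inj/funext. Qed.

Lemma ideal_ext_basis (g : nat -> H) a b : orthonormal g -> total g ->
  (forall n, bi_op a (g n) = bi_op b (g n)) -> a = b.
Proof.
by move=> og tg h; apply: bi_inj; apply: (bounded_op_eq og tg) => //; exact: bi_bounded.
Qed.

Lemma bi_op_lin a : linear (bi_op a).
Proof. by have [] := bi_bounded a. Qed.

Lemma bi_op0 x : bi_op (0 : J H) x = 0.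
Proof.
have := bi_linear (-1) (0 : J H) 0 x.
by rewrite scaler0 addr0 scaleN1r addNr.
Qed.

Lemma bi_opD a b x : bi_op (a + b) x = bi_op a x + bi_op b x.
Proof. by have := bi_linear 1 a b x; rewrite !scale1r. Qed.

Lemma bi_opZ c a x : bi_op (c *: a) x = c *: bi_op a x.
Proof. by have := bi_linear c a 0 x; rewrite bi_op0 !addr0. Qed.

Lemma lract_linear M N S T : opbd M S -> opbd N T -> linear (lract S T).
Proof.
move=> hS hT c a b; apply: ideal_ext => x.
by rewrite bi_linear !(lractE _ _ hS hT) bi_linear; have [_ -> _] := hS.
Qed.

Lemma lract_cont M N S T : opbd M S -> opbd N T ->
  cont_linear (lract S T : ideal_alg J H -> ideal_alg J H).
Proof.
move=> hS hT; have lST := lract_linear hS hT; split=> //.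
apply: (@lin_bounded_continuous R (J H) (J H) _ (M * N)) => // a.
by have [_] := lract_spec a hS hT; rewrite mulrAC.
Qed.

Lemma nbhs0_hnP (V : normedModType C) (U : set V) : nbhs 0 U <->
  exists2 e : R, 0 < e & forall x, hn x < e -> U x.
Proof.
split=> [/nbhs_ballP[e /= e0 h]|[e e0 h]].
  exists (complex.Re e); first exact: ltc_Re.
  move=> x xe; apply: h; rewrite -ball_normE /= sub0r normrN hnE.
  by move: e0 xe; case: (e) => p q; rewrite ltcE /= => /andP[/eqP -> _]; rewrite ltcR.
apply/nbhs_ballP; exists e%:C; first by rewrite /= ltcR.
by move=> x; rewrite -ball_normE /= sub0r normrN hnE ltcR; exact: h.
Qed.

(** * Diagonal and shift operators for a fixed basis *)

Section Diagonal.
Variable g : nat -> H.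
Hypotheses (og : orthonormal g) (tg : total g).

Definition diag (c : nat -> C) : H -> H := shift_op c g g.

Lemma diag_opbd c M : (forall n, nm (c n) <= M) -> opbd M (diag c).
Proof. exact: opbd_shift. Qed.

Lemma diag_basis c n : diag c (g n) = c n *: g n.
Proof. exact: shift_op_basis. Qed.

Definition shift_iso (s : nat -> nat) : H -> H := shift_op (fun=> 1) g (g \o s).

Definition shift_coiso (s : nat -> nat) : H -> H := shift_op (fun=> 1) (g \o s) g.

Lemma orthonormal_comp s : injective s -> orthonormal (g \o s).
Proof. by move=> si m n; rewrite /= og (inj_eq si). Qed.

Lemma nm_one (n : nat) : nm ((fun=> 1) n) <= 1.
Proof. by rewrite nm1. Qed.

Lemma shift_iso_opbd s : injective s -> opbd 1 (shift_iso s).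
Proof. by move=> si; apply: opbd_shift nm_one => //; exact: orthonormal_comp. Qed.

Lemma shift_coiso_opbd s : injective s -> opbd 1 (shift_coiso s).
Proof. by move=> si; apply: opbd_shift nm_one => //; exact: orthonormal_comp. Qed.

Lemma shift_iso_basis s n : shift_iso s (g n) = g (s n).
Proof.
by rewrite /shift_iso shift_op_basis// scale1r.
Qed.

Lemma shift_coiso_basis s n : injective s -> shift_coiso s (g (s n)) = g n.
Proof.
move=> si; rewrite -[g (s n)]/((g \o s) n) /shift_coiso shift_op_basis ?scale1r//.
exact: orthonormal_comp.
Qed.

Lemma shift_coiso_orth s n : (forall k, s k != n) -> shift_coiso s (g n) = 0.
Proof.
by move=> sn; apply: shift_op_orth => k; rewrite /= og eq_sym (negbTE (sn k)).
Qed.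

Lemma shift_isoK s : injective s -> shift_coiso s \o shift_iso s = id.
Proof.
move=> si; apply: (bounded_op_eq og tg).
- apply: bounded_op_comp; apply: opbd_bounded; last exact: shift_iso_opbd.
  exact: shift_coiso_opbd.
- exact: opbd_bounded (opbd_id H).
- by move=> n /=; rewrite shift_iso_basis// shift_coiso_basis.
Qed.

Section PointEvaluations.
Implicit Types (f : C01 R) (p q : nat -> I01).

Definition eval_op p f : H -> H := diag (fun n => f (p n)).

Lemma eval_op_opbd p f M : c01_near 0 M f -> opbd M (eval_op p f).
Proof. by move=> fM; apply: diag_opbd => n; apply: ltW; exact: (fM 0%N). Qed.

Lemma eval_op_ex p f : exists M, opbd M (eval_op p f).
Proof. by have [M _ fM] := c01_dbound f 0; exists M; exact: eval_op_opbd. Qed.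

Lemma eval_op_basis p f n : eval_op p f (g n) = f (p n) *: g n.
Proof. exact: diag_basis. Qed.

Lemma eval_op_mul p f f' : eval_op p (c01_mul f f') = eval_op p f \o eval_op p f'.
Proof.
have [M hM] := eval_op_ex p (c01_mul f f').
have [N hN] := eval_op_ex p f; have [N' hN'] := eval_op_ex p f'.
apply: (bounded_op_eq og tg); first exact: opbd_bounded hM.
  by apply: bounded_op_comp; [exact: opbd_bounded hN|exact: opbd_bounded hN'].
move=> n /=; rewrite !eval_op_basis; have [_ l _] := hN.
rewrite (linZ l) eval_op_basis scalerA mulrC.
by congr (_ *: _).
Qed.

Lemma eval_op_lin p c f f' x : eval_op p (c *: f + f') x = c *: eval_op p f x + eval_op p f' x.
Proof.
have [M hM] := eval_op_ex p (c *: f + f').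
have [N hN] := eval_op_ex p f; have [N' hN'] := eval_op_ex p f'.
have [l1 c1] := opbd_bounded hN; have [l2 c2] := opbd_bounded hN'.
have hb : bounded_op (fun x => c *: eval_op p f x + eval_op p f' x).
  split; first by move=> a y z; rewrite l1 l2 !scalerDr !scalerA addrACA [c * a]mulrC.
  move=> y; apply: cvgD; last exact: c2.
  by apply: cvgZl_tmp; exact: c1.
suff -> : eval_op p (c *: f + f') = (fun x => c *: eval_op p f x + eval_op p f' x) by [].
apply: (bounded_op_eq og tg) => //; first exact: opbd_bounded hM.
by move=> n; rewrite !eval_op_basis scalerA -scalerDl.
Qed.

Definition eval_actl p (f : C01_alg R) (a : ideal_alg J H) : ideal_alg J H :=
  lract (eval_op p f) id a.

Definition eval_actr p (f : C01_alg R) (a : ideal_alg J H) : ideal_alg J H :=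
  lract id (eval_op p f) a.

Lemma eval_actlE p f a x : bi_op (eval_actl p f a) x = eval_op p f (bi_op a x).
Proof. by have [M hM] := eval_op_ex p f; rewrite (lractE _ _ hM (opbd_id H)). Qed.

Lemma eval_actrE p f a x : bi_op (eval_actr p f a) x = bi_op a (eval_op p f x).
Proof. by have [M hM] := eval_op_ex p f; rewrite (lractE _ _ (opbd_id H) hM). Qed.

Lemma eval_actl_bilinear p : cont_bilinear (eval_actl p).
Proof.
have l1 f : linear (eval_actl p f).
  by have [M hM] := eval_op_ex p f; exact: lract_linear hM (opbd_id H).
have l2 a : linear (eval_actl p ^~ a).
  move=> c f f'; apply: ideal_ext => x.
  by rewrite bi_opD bi_opZ !eval_actlE eval_op_lin.
split=> //; apply: bilinear_continuous0 => // U /nbhs0_hnP[e e0 hU].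
exists [set f : C01 R | c01_near 0 1 f].
  apply/c01_nbhsP; exists 0%N, 1; split=> // f /c01_nearN.
  by rewrite sub0r opprK.
exists [set a : J H | hn a < e]; first by apply/nbhs0_hnP; exists e.
move=> f a hf ha; apply: hU; apply: le_lt_trans ha.
by have [_] := lract_spec a (eval_op_opbd p hf) (opbd_id H); rewrite mul1r mulr1.
Qed.

Lemma eval_actr_bilinear p : cont_bilinear (eval_actr p).
Proof.
have l1 f : linear (eval_actr p f).
  by have [M hM] := eval_op_ex p f; exact: lract_linear (opbd_id H) hM.
have l2 a : linear (eval_actr p ^~ a).
  move=> c f f'; apply: ideal_ext => x.
  by rewrite bi_opD bi_opZ !eval_actrE eval_op_lin bi_op_lin.
split=> //; apply: bilinear_continuous0 => // U /nbhs0_hnP[e e0 hU].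
exists [set f : C01 R | c01_near 0 1 f].
  apply/c01_nbhsP; exists 0%N, 1; split=> // f /c01_nearN.
  by rewrite sub0r opprK.
exists [set a : J H | hn a < e]; first by apply/nbhs0_hnP; exists e.
move=> f a hf ha; apply: hU; apply: le_lt_trans ha.
by have [_] := lract_spec a (opbd_id H) (eval_op_opbd p hf); rewrite mul1r mulr1.
Qed.

Variable d : J H.
Hypothesis dE : forall n, bi_op d (g n) = (n.+1%:R^-1)%:C *: g n.

Definition near_seq p q : Prop :=
  exists k : R, forall n, `|\val (p n) - \val (q n)| <= k / n.+1%:R.

(** The ideal element whose operator is pi_p f - pi_q f: the factor [n + 1] cancels the eigenvalue
    of [d], and for points at distance O(1 / n) the mean value theorem keeps the remaining diagonal
    bounded. *)
Definition eval_diff p q (f : C01_alg R) : ideal_alg J H :=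
  lract (diag (fun n => n.+1%:R%:C * (f (p n) - f (q n)))) id d.

Lemma c01_lip f (M : R) x y : c01_near 1 M f ->
  nm (f x - f y) <= M * `|\val x - \val y|.
Proof.
move=> fM; apply: (@mean_value R f (der01 f)) => t; first exact: (c01_has_der 0 f t).
by apply: ltW; exact: (fM 1%N).
Qed.

Lemma eval_diff_opbd p q k f (M : R) : (forall n, `|\val (p n) - \val (q n)| <= k / n.+1%:R) ->
  c01_near 1 M f -> opbd (M * k) (diag (fun n => n.+1%:R%:C * (f (p n) - f (q n)))).
Proof.
move=> pq fM; have M0 : 0 <= M.
  by have := fM 0%N (I01_0 R) isT; move=> /ltW; apply: le_trans; exact: nm_ge0.
apply: diag_opbd => n; rewrite nmM nm_real normr_nat.
have n0 : 0 < n.+1%:R :> R by rewrite ltr0n.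
rewrite mulrC -ler_pdivlMr// -mulrA; apply: (le_trans (c01_lip _ _ fM)).
by rewrite ler_wpM2l.
Qed.

Lemma eval_diff_basis p q f n : near_seq p q ->
  bi_op (eval_diff p q f) (g n) = (f (p n) - f (q n)) *: g n.
Proof.
move=> [k pq]; have [M M0 fM] := c01_dbound f 1.
have hk := eval_diff_opbd pq fM; rewrite (lractE _ _ hk (opbd_id H)) dE.
have [_ l _] := hk; rewrite (linZ l) diag_basis scalerA mulrA -rmorphM.
by rewrite mulVf ?pnatr_eq0// mul1r.
Qed.

(** The norm of the ideal element is controlled by a Lipschitz constant of [f], hence by the
    seminorm of derivatives of order at most 1. *)
Lemma eval_diff_cont p q : near_seq p q -> cont_linear (eval_diff p q).
Proof.
move=> pq; have l : linear (eval_diff p q).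
  move=> c f f'; apply: (ideal_ext_basis og tg) => n.
  rewrite bi_opD bi_opZ !eval_diff_basis// scalerA -scalerDl; congr (_ *: _).
  rewrite -[c01_fun _ (p n)]/(c * f (p n) + f' (p n)) -[c01_fun _ (q n)]/(c * f (q n) + f' (q n)).
  by ring.
split=> //; have [k hk] := pq; apply: linear_continuous0 => // U /nbhs0_hnP[e e0 hU].
have K0 : 0 < `|k| * hn d + 1 by rewrite ltr_wpDl// mulr_ge0 ?hn_ge0.
have e1 : 0 < e / (`|k| * hn d + 1) by rewrite divr_gt0.
exists [set f : C01 R | c01_near 1 (e / (`|k| * hn d + 1)) f].
  apply/c01_nbhsP; exists 1%N, (e / (`|k| * hn d + 1)); split=> // f /c01_nearN.
  by rewrite sub0r opprK.
move=> f hf; apply: hU.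
have [_] := lract_spec d (eval_diff_opbd hk hf) (opbd_id H); rewrite mulr1.
move=> /le_lt_trans; apply; rewrite -!mulrA gtr_pMr// ltr_pdivrMl// mulr1.
by rewrite ltr_pwDr// ler_wpM2r ?hn_ge0// ler_norm.
Qed.

End PointEvaluations.
End Diagonal.
End IdealOperators.

(** * Shifts and minimal idempotents *)

Section TensorMaps.
Variable R : realType.
Local Notation C := R[i].
Local Notation "x ** y" := (lca_mul x y) (at level 40, left associativity).

Section LinearMap.
Variables (A B B' : lcAlg R) (T : ptensor A B) (T' : ptensor A B') (phi : B -> B').
Hypothesis cphi : cont_linear phi.

Lemma tens_lin_bilinear : cont_bilinear (fun a b => pt_tens T' a (phi b)).
Proof.
exact: (cont_bilinear_comp (pt_univ T').1 (lcHom_id_subproof A) cphi).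
Qed.

(** The identity tensored with a map that is only linear. One-sided multiplications and linear
    splittings are not homomorphisms, so [ptensor_map] does not cover them. *)
Definition tens_lin : T -> T' := sval (cid2 ((pt_univ T).2 T' _ tens_lin_bilinear)).

Lemma tens_lin_cont : cont_linear tens_lin.
Proof. by rewrite /tens_lin; case: cid2 => f /= []. Qed.

Lemma tens_linE a b : tens_lin (pt_tens T a b) = pt_tens T' a (phi b).
Proof. by rewrite /tens_lin; case: cid2 => f /= []. Qed.

End LinearMap.

Lemma ptensor_mapE (A A' B B' : lcAlg R) (T : ptensor A B) (T' : ptensor A' B')
    (f : lcHom A A') (g : lcHom B B') a b :
  ptensor_map T T' f g (pt_tens T a b) = pt_tens T' (f a) (g b).
Proof. exact: ptensor_liftE. Qed.

Lemma ptensor_ext2 (V W V' W' U U' X : lcs R) (t : V -> W -> U) (t' : V' -> W' -> U')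
    (f g : U -> U' -> X) :
  is_ptensor t -> is_ptensor t' ->
  (forall u, cont_linear (f u)) -> (forall u', cont_linear (f^~ u')) ->
  (forall u, cont_linear (g u)) -> (forall u', cont_linear (g^~ u')) ->
  (forall v w v' w', f (t v w) (t' v' w') = g (t v w) (t' v' w')) ->
  forall u u', f u u' = g u u'.
Proof.
move=> ut ut' f1 f2 g1 g2 fg u u'.
have h v w : f (t v w) = g (t v w).
  by apply: (ptensor_ext ut') => // v' w'; exact: fg.
have : f^~ u' = g^~ u' by apply: (ptensor_ext ut) => // v w; rewrite h.
by move=> /(congr1 (@^~ u)).
Qed.

End TensorMaps.

Section HarmonicIdeals.
Variable R : realType.
Local Notation C := R[i].
Local Notation nm := (@ComplexField.Normc.normc R).
Local Notation "x ** y" := (lca_mul x y) (at level 40, left associativity).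

(** The same formula with the bases exchanged gives an inverse [W], which is also the adjoint of
    [U]; preservation of [ip] follows. *)
Lemma basis_unitary (H K : hilbert R) (g : nat -> H) (h : nat -> K) :
  orthonormal g -> total g -> orthonormal h -> total h ->
  unitary (shift_op (fun=> 1) g h).
Proof.
move=> og tg oh th.
set U := shift_op _ g h; pose W := shift_op (fun=> 1) h g.
have bU : opbd 1 U by exact: opbd_shift (@nm_one R).
have bW : opbd 1 W by exact: opbd_shift (@nm_one R).
have UW : U \o W = id.
  apply: (bounded_op_eq oh th).
  - by apply: bounded_op_comp; [exact: opbd_bounded bU|exact: opbd_bounded bW].
  - exact: opbd_bounded (opbd_id K).
  - by move=> n /=; rewrite /U /W !(shift_op_basis, scale1r).
have WU : W \o U = id.
  apply: (bounded_op_eq og tg).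
  - by apply: bounded_op_comp; [exact: opbd_bounded bW|exact: opbd_bounded bU].
  - exact: opbd_bounded (opbd_id H).
  - by move=> n /=; rewrite /U /W !(shift_op_basis, scale1r).
have adj x y : ip (U x) y = ip x (W y).
  have : (fun x => ip (U x) y : C^o) = (fun x => ip x (W y) : C^o).
    have [lU cU] := opbd_bounded bU.
    apply: (bounded_op_eq og tg).
    - split; first by move=> c a b; rewrite lU ip_linear.
      move=> z; apply: (@continuous_comp _ _ _ U (fun z => ip z y : C^o)).
        exact: cU.
      exact: ip_continuous.
    - by split; [move=> c a b; exact: ip_linear|exact: ip_continuous].
    move=> n; rewrite /U shift_op_basis// scale1r ip_conj [RHS]ip_conj.
    by rewrite (shift_op_coef oh og (@nm_one R)) mul1r.
  by move=> /(congr1 (@^~ x)).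
split.
- by have [] := opbd_bounded bU.
- by move=> x y; rewrite adj -[W (U y)]/((W \o U) y) WU.
- by move=> z; exists (W z); rewrite -[U (W z)]/((U \o W) z) UW.
Qed.

(** A polar decomposition by hand. Since [S' (bi_op a (e n))] is [e n] divided by the square of
    [n + 1], the rescaled images [phi n] of the singular vectors are orthonormal. After a unitary
    carries [a] to [H], the operators [T], from the basis to the [e n], and [S], from the [phi n]
    back to the basis, make it diagonal. *)
Lemma harmonic_diag (J : banachIdeal R) (H : sepHilbert R) (g : nat -> H) :
  harmonic_ideal J -> orthonormal g -> total g ->
  exists d : J H, forall n, bi_op d (g n) = (n.+1%:R^-1)%:C *: g n.
Proof.
move=> [H1 [a [_ [s0 _ [S' [adj [e [oe He _]]]]]]]] og tg.
have [g1 [og1 tg1]] := orthonormal_basis_exists H1.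
pose U : H1 -> H := shift_op (fun=> 1) g1 g.
have hU : unitary U by exact: basis_unitary.
have [lU Uip _] := hU.
have [f fE] := bi_unitary J hU.
have sn0 n : (n.+1%:R)%:C != 0 :> C by rewrite fmorph_eq0 pnatr_eq0.
have snV n : (n.+1%:R)%:C * (n.+1%:R^-1)%:C = 1 :> C.
  by rewrite -rmorphM divff ?pnatr_eq0.
pose phi n : H1 := (n.+1%:R)%:C *: bi_op a (e n).
have ophi : orthonormal phi.
  move=> m n; rewrite /phi ipZl ipZr adj He ipZr oe !conjc_real.
  case: eqP => [->|_]; last by rewrite !mulr0.
  by rewrite mulr1 rmorphXn expr2 /= [X in _ * X]mulrA snV mul1r snV.
have oU (h : nat -> H1) : orthonormal h -> orthonormal (U \o h).
  by move=> oh m n; rewrite /= Uip oh.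
pose S := shift_op (fun=> 1) (U \o phi) g; pose T := shift_op (fun=> 1) g (U \o e).
have bS : opbd 1 S by apply: opbd_shift (@nm_one R) => //; exact: oU.
have bT : opbd 1 T by apply: opbd_shift (@nm_one R) => //; exact: oU.
exists (lract S T (f a)) => n; rewrite (lractE _ _ bS bT).
rewrite /T shift_op_basis// scale1r /= fE.
have -> : U (bi_op a (e n)) = (n.+1%:R^-1)%:C *: (U \o phi) n.
  by rewrite /= /phi (linZ lU) scalerA mulrC snV scale1r.
have [_ lS _] := bS; rewrite (linZ lS) /S shift_op_basis ?scale1r//.
exact: oU.
Qed.

Section RankOne.
Variables (J : banachIdeal R) (H : sepHilbert R).

Definition rank1 (u v : H) : H -> H := fun z => ip z v *: u.

Lemma rank1_opbd u v : opbd (hn v * hn u) (rank1 u v).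
Proof.
split; first by rewrite mulr_ge0 ?hn_ge0.
  by move=> c x y; rewrite /rank1 ip_linear scalerDl scalerA.
move=> x; rewrite /rank1 hnZ mulrAC ler_wpM2r ?hn_ge0//.
by rewrite mulrC cauchy_schwarz.
Qed.

(** For a nonzero [x] in the range of [p], composing [p] with the projection onto the line of [x]
    gives a nonzero idempotent [q] in the ideal with [p q = q p = q], and minimality forces [q = p].
    As [p] need not be self-adjoint, its functional is [ip (bi_op p z) x'] and not [ip z x']. *)
Lemma minimal_idempotent_rank1 (p : ideal_alg J H) : minimal_idempotent p ->
  exists (x x' : H), ip x x' = 1 /\ bi_op p x = x /\
    forall z, bi_op p z = ip (bi_op p z) x' *: x.
Proof.
move=> [p0 pp pmin].
have [z0 pz0] : exists z, bi_op p z <> 0.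
  apply: contrapT => h; apply: p0; apply: ideal_ext => z; rewrite bi_op0.
  by apply: contrapT => hz; apply: h; exists z.
set x := bi_op p z0 in pz0.
have px : bi_op p x = x by rewrite /x -bi_mul -[ba_mul p p]/(p ** p) pp.
have x0 : hn x != 0 by apply/eqP => /hn_eq0.
pose x' := ((hn x ^+ 2)^-1)%:C *: x.
have xx' : ip x x' = 1.
  rewrite ipZr conjc_real ip_hn -rmorphM mulVf ?expf_neq0//.
pose q : ideal_alg J H := lract (rank1 x x') id p.
have qE z : bi_op q z = ip (bi_op p z) x' *: x.
  by rewrite (lractE _ _ (rank1_opbd x x') (opbd_id H)).
have qp : q = p.
  apply: pmin.
  - move=> q0; have := qE x; rewrite px xx' scale1r q0 bi_op0 => x00.
    by move: x0; rewrite -x00 hn0 eqxx.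
  - apply: ideal_ext => z; rewrite bi_mul !qE (linZ (bi_op_lin p)) px.
    by rewrite ipZl xx' mulr1.
  - by apply: ideal_ext => z; rewrite bi_mul qE (linZ (bi_op_lin p)) px.
  - by apply: ideal_ext => z; rewrite bi_mul !qE -bi_mul -[ba_mul p p]/(p ** p) pp.
by exists x, x'; split=> //; split=> // z; rewrite -qE qp.
Qed.

Variable g : nat -> H.
Hypotheses (og : orthonormal g) (tg : total g).

Section Conjugation.
Variable s : nat -> nat.
Hypothesis si : injective s.
Local Notation V := (shift_iso g s).
Local Notation W := (shift_coiso g s).

Lemma shift_conjE (a : J H) x : bi_op (lract V W a) x = V (bi_op a (W x)).
Proof. by rewrite (lractE _ _ (shift_iso_opbd og si) (shift_coiso_opbd og si)). Qed.

Lemma shift_conj_mul :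
  {morph (lract V W : ideal_alg J H -> ideal_alg J H) : a b / a ** b}.
Proof.
move=> a b; apply: ideal_ext => x; rewrite bi_mul !shift_conjE bi_mul.
by rewrite -[W (V _)]/((W \o V) _) shift_isoK.
Qed.

Definition shift_conj : lcHom (ideal_alg J H) (ideal_alg J H) :=
  LcHom (lract_cont J (shift_iso_opbd og si) (shift_coiso_opbd og si)) shift_conj_mul.

(** [fmap_inner] applies with [V] multiplying on the left and [W] on the right in the second tensor
    factor; the two cancel in the middle because [W] after [V] is the identity. *)
Lemma fmap_shift_conj (E : lcFunctor R) (A : lcAlg R) (T : ptensor A (ideal_alg J H)) :
  m2_stable E -> forall z, fmap E (ptensor_map T T (lcHom_id A) shift_conj) z = z.
Proof.
move=> E_M2; have bV := shift_iso_opbd og si; have bW := shift_coiso_opbd og si.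
have bi := opbd_id H.
have cl := lract_cont J bV bi; have cr := lract_cont J bi bW.
have ut := pt_univ T.
apply: (fmap_inner E_M2 (tens_lin_cont T T cl) (tens_lin_cont T T cr)).
- apply: (ptensor_ext2 ut ut).
  + by move=> u; exact: (cont_linear_comp (tens_lin_cont T T cl) (lca_mull_cont u)).
  + by move=> u; exact: (cont_linear_comp (tens_lin_cont T T cl) (lca_mulr_cont u)).
  + by move=> u; exact: lca_mull_cont.
  + by move=> u; exact: (cont_linear_comp (lca_mulr_cont u) (tens_lin_cont T T cl)).
  move=> a j a' j'; rewrite pt_mul !tens_linE pt_mul; congr (pt_tens T _ _).
  by apply: ideal_ext => x; rewrite bi_mul !(lractE _ _ bV bi) bi_mul.
- apply: (ptensor_ext2 ut ut).
  + by move=> u; exact: (cont_linear_comp (tens_lin_cont T T cr) (lca_mull_cont u)).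
  + by move=> u; exact: (cont_linear_comp (tens_lin_cont T T cr) (lca_mulr_cont u)).
  + by move=> u; exact: (cont_linear_comp (lca_mull_cont u) (tens_lin_cont T T cr)).
  + by move=> u; exact: lca_mulr_cont.
  move=> a j a' j'; rewrite pt_mul !tens_linE pt_mul; congr (pt_tens T _ _).
  by apply: ideal_ext => x; rewrite bi_mul !(lractE _ _ bi bW) bi_mul.
- apply: (ptensor_ext2 ut ut).
  + by move=> u; exact: (cont_linear_comp (lca_mull_cont _) (tens_lin_cont T T cl)).
  + by move=> u; exact: (cont_linear_comp (lca_mulr_cont _) (tens_lin_cont T T cr)).
  + by move=> u; exact: lca_mull_cont.
  + by move=> u; exact: lca_mulr_cont.
  move=> a j a' j'; rewrite pt_mul !tens_linE pt_mul; congr (pt_tens T _ _).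
  apply: ideal_ext => x; rewrite !bi_mul (lractE _ _ bi bW) (lractE _ _ bV bi).
  by rewrite -[W (V _)]/((W \o V) _) shift_isoK.
move=> u; suff : (ptensor_map T T (lcHom_id A) shift_conj : T -> T) =
    tens_lin T cl \o tens_lin T cr by move=> /(congr1 (@^~ u)).
apply: (ptensor_ext ut).
- exact: hom_linear.
- exact: (cont_linear_comp (tens_lin_cont T T cl) (tens_lin_cont T T cr)).
move=> a j; rewrite ptensor_mapE /= !tens_linE; congr (pt_tens T _ _).
apply: ideal_ext => x; rewrite shift_conjE.
by rewrite (lractE _ _ bV bi) (lractE _ _ bi bW).
Qed.

End Conjugation.

Variable e : ideal_alg J H.
Hypothesis eE : forall z, bi_op e z = ip z (g 0%N) *: g 0%N.

Lemma corner_idem : e ** e = e.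
Proof.
by apply: ideal_ext => z; rewrite bi_mul !eE ipZl og eqxx mulr1.
Qed.

(** [p] may overlap with [e]. Conjugation by a shift is invisible to [E] and moves [p] to an
    idempotent orthogonal to [e]; rank one operators between the two complete a system of matrix
    units. *)
Lemma fmap_minimal_idempotent (E : lcFunctor R) (A : lcAlg R)
    (T : ptensor A (ideal_alg J H)) (p : ideal_alg J H) (pp : p ** p = p) :
  m2_stable E -> minimal_idempotent p -> forall z,
  fmap E (tens_idem T pp) z = fmap E (tens_idem T corner_idem) z.
Proof.
move=> E_M2 pmin z; have [x [x' [xx' [px pE]]]] := minimal_idempotent_rank1 pmin.
(* What matters is that [s] is injective and omits 0, so that the range of [V] is orthogonal to
   [g 0]. *)
pose s (n : nat) := n.*2.+2.
have si : injective s by move=> m n [] /double_inj.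
have bV := shift_iso_opbd og si; have bW := shift_coiso_opbd og si.
have bi := opbd_id H.
set V := shift_iso g s in bV; set W := shift_coiso g s in bW.
have [_ lV _] := bV; have [_ lW _] := bW.
have WV y : W (V y) = y by rewrite -[LHS]/((W \o V) y) shift_isoK.
have Wg0 : W (g 0%N) = 0 by apply: shift_coiso_orth.
have Vg0 y : ip (V y) (g 0%N) = 0.
  have : (fun y => ip (V y) (g 0%N) : C^o) = fun=> 0.
    apply: (bounded_op_eq og tg).
    - split; first by move=> c a b; rewrite lV ip_linear.
      have [_ cV] := opbd_bounded bV.
      move=> w; apply: (@continuous_comp _ _ _ V (fun z => ip z (g 0%N) : C^o)).
        exact: cV.
      exact: ip_continuous.
    - by split; [move=> c a b; rewrite scaler0 addr0|move=> w; exact: cvg_cst].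
    - by move=> n; rewrite /V shift_iso_basis// og.
  by move=> /(congr1 (@^~ y)).
(* The conjugate of [p] sends [w] to [l w] times [V x]. Here [l] is 1 at [V x] and 0 at [g 0], and
   [V x] is orthogonal to the unit vector [g 0]; these relations give all sixteen products. *)
pose l w := ip (bi_op p (W w)) x'.
have lZ c w : l (c *: w) = c * l w.
  by rewrite /l (linZ lW) (linZ (bi_op_lin p)) ipZl.
have lVx : l (V x) = 1 by rewrite /l WV px.
have lg0 : l (g 0%N) = 0 by rewrite /l Wg0 (lin0 (bi_op_lin p)) ip0l.
pose u11 := shift_conj si p.
have u11E w : bi_op u11 w = l w *: V x.
  by rewrite (shift_conjE si p w) -/V -/W pE (linZ lV).
pose u12 : ideal_alg J H := lract (rank1 (V x) (g 0%N)) id e.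
have u12E w : bi_op u12 w = ip w (g 0%N) *: V x.
  by rewrite (lractE _ _ (rank1_opbd _ _) bi) eE /rank1 ipZl og eqxx mulr1.
pose u21 : ideal_alg J H := lract (rank1 (g 0%N) x') W p.
have u21E w : bi_op u21 w = l w *: g 0%N by rewrite (lractE _ _ (rank1_opbd _ _) bW).
have g00 : ip (g 0%N) (g 0%N) = 1 by rewrite og eqxx.
have red := (u11E, u12E, u21E, eE, lZ, ipZl, lVx, lg0, Vg0, g00).
have h1111 : u11 ** u11 = u11 by apply: ideal_ext => w; rewrite bi_mul !red ?(mulr1, mulr0).
have -> : fmap E (tens_idem T pp) z = fmap E (tens_idem T h1111) z.
  have -> : tens_idem T h1111 =
      lcHom_comp (ptensor_map T T (lcHom_id A) (shift_conj si)) (tens_idem T pp).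
    apply: lcHom_eq => a.
    by rewrite -[RHS]/(ptensor_map T T (lcHom_id A) (shift_conj si) (pt_tens T a p)) ptensor_mapE.
  by rewrite fmap_comp fmap_shift_conj.
apply: (@fmap_matrix_units _ E E_M2 A (ideal_alg J H) T u11 u12 u21 e h1111);
  apply: ideal_ext => w; rewrite ?bi_op0 bi_mul !red ?(mulr1, mulr0, scale0r)//.
Qed.

End RankOne.
End HarmonicIdeals.

(** * Semidirect products and dyadic intervals *)

Section SemidirectProduct.
Variable R : realType.
Local Notation C := R[i].
Local Notation "x ** y" := (lca_mul x y) (at level 40, left associativity).
Variables (B J : lcAlg R) (l r : B -> J -> J).
Hypotheses (bl : cont_bilinear l) (br : cont_bilinear r).
Hypothesis l_mul : forall f f' j, l (f ** f') j = l f (l f' j).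
Hypothesis r_mul : forall f f' j, r (f ** f') j = r f' (r f j).
Hypothesis lrC : forall f f' j, l f (r f' j) = r f' (l f j).
Hypothesis lM : forall f j j', l f (j ** j') = l f j ** j'.
Hypothesis rM : forall f j j', r f (j ** j') = j ** r f j'.
Hypothesis lrM : forall f j j', j ** l f j' = r f j ** j'.

(** The product of formal sums [f + j], with [B] acting on [J] by multipliers. Working with pairs
    keeps the sum direct even if some [f] acts as an element of [J]. *)
Definition semid_mul (x y : prod_lcs B J) : prod_lcs B J :=
  (x.1 ** y.1, l x.1 y.2 + r y.1 x.2 + x.2 ** y.2).

Lemma cont_bilinear_flip (V W X : lcs R) (b : V -> W -> X) :
  cont_bilinear b -> cont_bilinear (fun w v => b v w).
Proof.
move=> [l1 l2 cb]; split=> // z.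
apply: (@continuous_comp _ (V * W)%type _ (fun z : W * V => (z.2, z.1))
  (fun z => b z.1 z.2)); last exact: cb.
by apply: cvg_pair; [exact: cvg_snd|exact: cvg_fst].
Qed.

Lemma semid_mul_bilinear : cont_bilinear semid_mul.
Proof.
have c1 := @cont_linear_fst _ B J; have c2 := @cont_linear_snd _ B J.
apply: cont_bilinear_pair.
  exact: (cont_bilinear_comp (lca_mul_bilinear B) c1 c1).
apply: cont_bilinearD; last exact: (cont_bilinear_comp (lca_mul_bilinear J) c2 c2).
apply: cont_bilinearD; first exact: (cont_bilinear_comp bl c1 c2).
exact: (cont_bilinear_comp (cont_bilinear_flip br) c2 c1).
Qed.

Lemma semid_lD f j j' : l f (j + j') = l f j + l f j'.
Proof. by have [l1 _ _] := bl; exact: (linD (l1 f)). Qed.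

Lemma semid_rD f j j' : r f (j + j') = r f j + r f j'.
Proof. by have [l1 _ _] := br; exact: (linD (l1 f)). Qed.

Lemma semid_mulA : associative semid_mul.
Proof.
move=> [f j] [f' j'] [f'' j'']; congr (_, _); rewrite /= ?lca_mulA//.
rewrite !semid_lD !semid_rD !lca_mulDl !lca_mulDr l_mul r_mul lrC lM rM lrM lca_mulA.
rewrite -!addrA; congr (_ + _); rewrite !addrA; congr (_ + _).
rewrite -!addrA; congr (_ + _).
by rewrite addrCA; congr (_ + _); rewrite addrA addrC.
Qed.

Definition semid : lcAlg R := LcAlg semid_mul_bilinear semid_mulA.

Lemma semid_mulE f j f' j' :
  ((f, j) : semid) ** ((f', j') : semid) = (f ** f', l f j' + r f' j + j ** j').
Proof. by []. Qed.

Lemma semid_l0 f : l f 0 = 0.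
Proof. by have [l1 _ _] := bl; exact: (lin0 (l1 f)). Qed.

Lemma semid_0l j : l 0 j = 0.
Proof. by have [_ l2 _] := bl; exact: (lin0 (l2 j)). Qed.

Lemma semid_r0 f : r f 0 = 0.
Proof. by have [l1 _ _] := br; exact: (lin0 (l1 f)). Qed.

Lemma semid_0r j : r 0 j = 0.
Proof. by have [_ l2 _] := br; exact: (lin0 (l2 j)). Qed.

Lemma semid_in_mul : {morph (fun j => (0, j) : semid) : x y / x ** y}.
Proof. by move=> x y; rewrite semid_mulE lca_mul0l semid_0l semid_0r !add0r. Qed.

Definition semid_in : lcHom J semid := @LcHom R J semid (fun j => (0, j))
  (cont_linear_pair (@cont_linear0 _ J B) (lcHom_id_subproof J)) semid_in_mul.

Definition semid_proj : lcHom semid B := @LcHom R semid B fst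
  (@cont_linear_fst _ B J) (fun _ _ => erefl).

Section Sections.
Variable delta : B -> J.
Hypothesis cdelta : cont_linear delta.
Hypothesis deltaM : forall f f',
  delta (f ** f') = l f (delta f') + r f' (delta f) + delta f ** delta f'.

Lemma semid_sec_mul : {morph (fun f => (f, delta f) : semid) : x y / x ** y}.
Proof. by move=> x y; rewrite semid_mulE deltaM. Qed.

Definition semid_sec : lcHom B semid := @LcHom R B semid (fun f => (f, delta f))
  (cont_linear_pair (lcHom_id_subproof B) cdelta) semid_sec_mul.

Variable theta : J -> J.
Hypothesis ctheta : cont_linear theta.
Hypothesis thetal : forall f j, theta (l f j) = l f (theta j) + delta f ** theta j.
Hypothesis thetar : forall f j, theta (r f j) = r f (theta j) + theta j ** delta f.
Hypothesis thetaM : {morph theta : x y / x ** y}.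

(** In terms of formal sums, [f] goes to [f + delta f] and [j] to [theta j]; the hypotheses on
    [theta] say that it intertwines the action of [f] with that of [f + delta f]. *)
Definition semid_endo_fun (x : semid) : semid := (x.1, delta x.1 + theta x.2).

Lemma semid_endo_linear : cont_linear semid_endo_fun.
Proof.
have c1 := @cont_linear_fst _ B J; have c2 := @cont_linear_snd _ B J.
apply: cont_linear_pair => //; apply: cont_linearD.
  exact: (cont_linear_comp cdelta c1).
exact: (cont_linear_comp ctheta c2).
Qed.

Lemma semid_endo_mul : {morph semid_endo_fun : x y / x ** y}.
Proof.
move=> [f j] [f' j']; rewrite /semid_endo_fun; congr (_, _) => /=.
rewrite deltaM !(linD ctheta.1) thetal thetar thetaM.
rewrite semid_lD semid_rD !lca_mulDl !lca_mulDr.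
move: (l f (delta f')) (r f' (delta f)) (delta f ** delta f') (l f (theta j'))
  (delta f ** theta j') (r f' (theta j)) (theta j ** delta f') (theta j ** theta j').
move=> a b c d e h k m.
rewrite [a + d + _]addrACA [d + e + _]addrACA -[d + h + _ + m]addrA [LHS]addrACA.
by rewrite -!addrA.
Qed.

Definition semid_endo : lcHom semid semid := LcHom semid_endo_linear semid_endo_mul.

End Sections.

Lemma semid_zero_sec_mul f f' :
  0 = l f (0 : J) + r f' (0 : J) + (0 : J) ** (0 : J) :> J.
Proof. by rewrite semid_l0 semid_r0 lca_mul0l !addr0. Qed.

Lemma semid_split : split_extension semid_in semid_proj.
Proof.
split; last by exists (semid_sec (@cont_linear0 R B J) semid_zero_sec_mul).
split.
  split=> [x y [] //|x|z]; last by exists (z, 0).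
  split=> [|[y <-] //]; case: x => [a b] /= ->; by exists b.
exists snd, (fun b => (b, 0)); split=> //.
- exact: cont_linear_snd.
- exact: (cont_linear_pair (lcHom_id_subproof B) (@cont_linear0 _ B J)).
- by move=> [a b]; congr (_, _); rewrite /= ?add0r ?addr0.
Qed.

End SemidirectProduct.

Section TensorExtension.
Variable R : realType.
Variables (A I D B : lcAlg R) (i : lcHom I D) (p : lcHom D B).
Variables (TI : ptensor A I) (TD : ptensor A D) (TB : ptensor A B).

(** Extensions come with continuous linear splittings [r] and [s]. Their defining identities survive
    tensoring, because they can be checked on elementary tensors, and exactness follows from
    them. *)
Lemma split_extension_tens : split_extension i p ->
  split_extension (ptensor_map TI TD (lcHom_id A) i) (ptensor_map TD TB (lcHom_id A) p).
Proof.
move=> [[[_ ex _] [r [s [cr cs ri ps dec]]]] [h ph]].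
have pi0 y : p (i y) = 0 by apply/ex; exists y.
set fi := ptensor_map TI TD _ _; set fp := ptensor_map TD TB _ _.
have fiE v w : fi (pt_tens TI v w) = pt_tens TD v (i w) by exact: ptensor_mapE.
have fpE v w : fp (pt_tens TD v w) = pt_tens TB v (p w) by exact: ptensor_mapE.
have lfi := hom_linear fi; have lfp := hom_linear fp.
clearbody fi fp.
have cr' := tens_lin_cont TD TI cr; have cs' := tens_lin_cont TB TD cs.
have ext (X : lcs R) (V W : lcAlg R) (T : ptensor V W) (f g : T -> X) :
    cont_linear f -> cont_linear g ->
    (forall v w, f (pt_tens T v w) = g (pt_tens T v w)) -> forall z, f z = g z.
  by move=> cf cg fg z; rewrite (ptensor_ext (pt_univ T) cf cg fg).
have ri' : cancel fi (tens_lin TI cr).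
  apply: (ext TI); [exact: (cont_linear_comp cr' lfi)|exact: lcHom_id_subproof|].
  by move=> v w /=; rewrite fiE tens_linE ri.
have ps' : cancel (tens_lin TD cs) fp.
  apply: (ext TB); [exact: (cont_linear_comp lfp cs')|exact: lcHom_id_subproof|].
  by move=> v w /=; rewrite tens_linE fpE ps.
have dec' a : fi (tens_lin TI cr a) + tens_lin TD cs (fp a) = a.
  move: a; apply: (ext TD); [|exact: lcHom_id_subproof|].
    apply: cont_linearD; first exact: (cont_linear_comp lfi cr').
    exact: (cont_linear_comp cs' lfp).
  move=> v w; rewrite /= tens_linE fiE fpE tens_linE.
  have [t1 _ _] := (pt_univ TD).1.
  by rewrite -(linD (t1 v)) dec.
have pi' y : fp (fi y) = 0.
  move: y; apply: (ext TB); [exact: (cont_linear_comp lfp lfi)|exact: cont_linear0|].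
  move=> v w; rewrite /= fiE fpE pi0.
  by have [t1 _ _] := (pt_univ TB).1; exact: (lin0 (t1 v)).
split.
  split; last by exists (tens_lin TI cr), (tens_lin TD cs).
  split; [exact: can_inj ri'| |by move=> z; exists (tens_lin TD cs z); exact: ps'].
  move=> x; split=> [px|[y <-] //]; exists (tens_lin TI cr x).
  by rewrite -[RHS]dec' px (lin0 cs'.1) addr0.
exists (ptensor_map TB TD (lcHom_id A) h).
apply: (ext TB); [exact: (cont_linear_comp lfp (hom_linear _))|exact: lcHom_id_subproof|].
by move=> v w; rewrite [ptensor_map _ _ _ _ _]ptensor_mapE fpE ph.
Qed.

End TensorExtension.

Section DyadicPoints.
Variable R : realType.
Local Notation I01 := (set_type `[0 : R, 1]).

Let lvl n := trunc_log 2 n.+1.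

Let lvlS0 n : lvl n.*2.+1 = (lvl n).+1.
Proof. by rewrite /lvl trunc_log2S// -doubleS doubleK. Qed.

Let lvlS1 n : lvl n.*2.+2 = (lvl n).+1.
Proof. by rewrite /lvl trunc_log2S// -doubleS -[_./2]/(uphalf n.+1.*2) uphalf_double. Qed.

(* Breadth-first numbering of the infinite binary tree of dyadic intervals. *)
Lemma dyadic_intervals (s t : I01) : exists al be mi : nat -> I01,
  [/\ al 0%N = s, be 0%N = t,
      forall n, [/\ al n.*2.+1 = al n, be n.*2.+1 = mi n,
                    al n.*2.+2 = mi n & be n.*2.+2 = be n] &
      forall n, `|\val (be n) - \val (al n)| <= 2 / n.+1%:R /\
                `|\val (mi n) - \val (al n)| <= 2 / n.+1%:R].
Proof.
pose w n : R := (2 ^ lvl n)%:R^-1.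
have w0 n : 0 < w n by rewrite invr_gt0 ltr0n expn_gt0.
have wE n : w n * (2 ^ lvl n)%:R = 1 by rewrite mulVf// pnatr_eq0 expn_eq0.
have wS n k : lvl k = (lvl n).+1 -> w k = w n / 2.
  by move=> h; rewrite /w h expnS natrM invfM mulrC.
(* Level k of the tree begins with index [2^k - 1], so the n-th interval has position [n + 1 - 2^k]
   on its level and starts at that number divided by [2^k]. *)
pose a n : R := n.+1%:R * w n - 1.
pose b n : R := n.+2%:R * w n - 1.
pose m n : R := (n.*2.+3)%:R * (w n / 2) - 1.
have lo n : (2 ^ lvl n <= n.+1)%N by exact: trunc_logP.
have hi n : (n.+2 <= 2 ^ (lvl n).+1)%N by exact: trunc_log_ltn.
have a0 n : 0 <= a n.
  by rewrite /a subr_ge0 -[X in X <= _](wE n) [leRHS]mulrC ler_wpM2l ?(ltW (w0 n))// ler_nat.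
have b1 n : b n <= 1.
  rewrite lerBlDr -[X in _ <= X + X](wE n) -mulrDr mulrC ler_wpM2l ?(ltW (w0 n))//.
  by rewrite -natrD addnn -mul2n -expnS ler_nat.
have ba n : b n - a n = w n.
  by rewrite /a /b opprB addrA subrK -mulrBl -natr1 [n.+1%:R + 1]addrC addrK mul1r.
have ma n : m n - a n = w n / 2.
  rewrite /m /a opprB addrA subrK -addnn -addn3 !natrD -natr1.
  by field.
have ab n : a n <= b n by rewrite -subr_ge0 ba ltW.
(* The length is [2^-k], and [n + 2 <= 2^(k + 1)] on level k. *)
have w2 n : w n <= 2 / n.+1%:R.
  rewrite ler_pdivlMr ?ltr0n// mulrC -ler_pdivlMr// /w invrK.
  by rewrite -natrM -expnS ler_nat ltnW.
have wh n : w n / 2 <= w n by rewrite ler_pdivrMr// ler_peMr ?(ltW (w0 n))// ler1n.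
have ma0 n : a n <= m n by rewrite -subr_ge0 ma divr_ge0// ltW.
have mb n : m n <= b n by rewrite -[m n](subrK (a n)) ma -lerBrDr ba.
have st01 (x : R) : 0 <= x <= 1 -> 0 <= \val s + (\val t - \val s) * x <= 1.
  move=> /andP[x0 x1]; have /andP[s0 s1] := I01_bd s; have /andP[t0 t1] := I01_bd t.
  have -> : \val s + (\val t - \val s) * x = \val s * (1 - x) + \val t * x by ring.
  apply/andP; split; first by rewrite addr_ge0// mulr_ge0// subr_ge0.
  apply: (@le_trans _ _ (1 * (1 - x) + 1 * x)); last by rewrite !mul1r subrK.
  by apply: lerD; rewrite ler_wpM2r// subr_ge0.
(* The affine path from [s] to [t]; parameters outside [0, 1] get the arbitrary value [s]. *)
have ptex (x : R) : exists z : I01, 0 <= x <= 1 -> \val z = \val s + (\val t - \val s) * x.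
  have [x01|x01] := boolP (0 <= x <= 1); last by exists s.
  by have [z zE] := mkI01 (st01 _ x01); exists z.
pose pt x := sval (cid (ptex x)).
have ptE x : 0 <= x <= 1 -> \val (pt x) = \val s + (\val t - \val s) * x.
  by rewrite /pt; case: cid.
have pt_dist x y : 0 <= x <= 1 -> 0 <= y <= 1 -> `|\val (pt x) - \val (pt y)| <= `|x - y|.
  move=> x01 y01; rewrite !ptE// opprD addrACA subrr add0r -mulrBr normrM.
  by rewrite ler_piMl// I01_dist.
have a01 n : 0 <= a n <= 1 by rewrite a0 (le_trans (ab n)).
have b01 n : 0 <= b n <= 1 by rewrite b1 (le_trans (a0 n)).
have m01 n : 0 <= m n <= 1 by rewrite (le_trans (a0 n))// (le_trans (mb n)).
have w00 : w 0%N = 1 by rewrite /w expn0 invr1.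
exists (pt \o a), (pt \o b), (pt \o m); split.
- by apply: val_inj; rewrite /= ptE// /a w00 mul1r subrr mulr0 addr0.
- apply: val_inj; rewrite /= ptE// /b w00 mulr1.
  have -> : 2%:R - 1 = 1 :> R by ring.
  by rewrite mulr1 addrC subrK.
- move=> n; rewrite /= /a /b /m !(wS n _ (lvlS0 n)) !(wS n _ (lvlS1 n)).
  split=> //; congr (pt (_ - 1)).
    by rewrite -doubleS -muln2 natrM -mulrA; congr (_ * _); field.
  by rewrite -!doubleS -muln2 natrM -mulrA; congr (_ * _); field.
- move=> n; split; apply: (le_trans (pt_dist _ _ _ _)) => //.
    by rewrite ba gtr0_norm.
  by rewrite ma gtr0_norm ?divr_gt0// (le_trans (wh n)).
Qed.

End DyadicPoints.

(** * Diffotopy invariance *)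

Section DiffotopyInvariance.
Variable R : realType.
Local Notation C := R[i].
Local Notation nm := (@ComplexField.Normc.normc R).
Local Notation I01 := (set_type `[0 : R, 1]).
Local Notation "x ** y" := (lca_mul x y) (at level 40, left associativity).

Section DiagonalAlgebra.
Variables (J : banachIdeal R) (H : sepHilbert R) (g : nat -> H).
Hypotheses (og : orthonormal g) (tg : total g).
Variable d : J H.
Hypothesis dE : forall n, bi_op d (g n) = (n.+1%:R^-1)%:C *: g n.
Variable al : nat -> I01.
Local Notation JH := (ideal_alg J H).
Local Notation actl := (@eval_actl R J H g al).
Local Notation actr := (@eval_actr R J H g al).
Local Notation ev_op := (eval_op g al).

Lemma ev_op_bounded f : bounded_op (ev_op f).
Proof. by have [M hM] := eval_op_ex og al f; exact: opbd_bounded hM. Qed.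

Let opD (a b : JH) x : bi_op (a + b) x = bi_op a x + bi_op b x.
Proof. exact: bi_opD. Qed.

Let opM (a b : JH) x : bi_op (a ** b) x = bi_op a (bi_op b x).
Proof. exact: bi_mul. Qed.

Let ext (a b : JH) : (forall n, bi_op a (g n) = bi_op b (g n)) -> a = b.
Proof. exact: ideal_ext_basis. Qed.

Let l_mul f f' j : actl (f ** f') j = actl f (actl f' j).
Proof.
apply: ideal_ext => x; rewrite !eval_actlE//.
by rewrite -[lca_mul f f']/(c01_mul f f') eval_op_mul.
Qed.

Let r_mul f f' j : actr (f ** f') j = actr f' (actr f j).
Proof.
apply: ideal_ext => x; rewrite !eval_actrE//.
by rewrite -[lca_mul f f']/(c01_mul f f') eval_op_mul.
Qed.

Let lrC f f' j : actl f (actr f' j) = actr f' (actl f j).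
Proof. by apply: ideal_ext => x; rewrite !(eval_actlE, eval_actrE). Qed.

Let lM f (j j' : JH) : actl f (j ** j') = actl f j ** j'.
Proof. by apply: ideal_ext => x; rewrite bi_mul !eval_actlE// bi_mul. Qed.

Let rM f (j j' : JH) : actr f (j ** j') = j ** actr f j'.
Proof. by apply: ideal_ext => x; rewrite bi_mul !eval_actrE// bi_mul. Qed.

Let lrM f (j j' : JH) : j ** actl f j' = actr f j ** j'.
Proof. by apply: ideal_ext => x; rewrite !bi_mul eval_actlE// eval_actrE. Qed.

(* The algebra of pairs [(f, j)], thought of as the operators
   [diag (f (al n)) + j]. *)
Definition diag_alg : lcAlg R := semid (eval_actl_bilinear J og tg al)
  (eval_actr_bilinear J og tg al) l_mul r_mul lrC lM rM lrM.

Definition diag_in : lcHom JH diag_alg := semid_in _ _ _ _ _ _ _ _.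

Definition diag_proj : lcHom diag_alg (C01_alg R) := semid_proj _ _ _ _ _ _ _ _.

Lemma diag_split : split_extension diag_in diag_proj.
Proof. exact: semid_split. Qed.

Section PerturbedSection.
Variables (q : nat -> I01) (hq : near_seq q al).

(** Multiplicativity of pi_q, with pi_q f written as pi_al f plus an element of the ideal. All
    operators involved are diagonal, so the claim is an identity of scalars. *)
Lemma diag_sec_mul f f' : eval_diff g d q al (f ** f') =
  actl f (eval_diff g d q al f') + actr f' (eval_diff g d q al f) +
  eval_diff g d q al f ** eval_diff g d q al f'.
Proof.
have D := eval_diff_basis og dE; pose de f := eval_diff g d q al f.
have dZ f0 (c : C) x : bi_op (de f0) (c *: x) = c *: bi_op (de f0) x.
  exact: (linZ (bi_op_lin (de f0))).
have {}D f0 n : bi_op (de f0) (g n) = (f0 (q n) - f0 (al n)) *: g n := D q al f0 n hq.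
apply: ext => n; rewrite (opD _ (de f ** de f')) (opD _ (actr f' (de f))) (opM (de f)).
rewrite (eval_actlE og al f) (eval_actrE og al f').
rewrite (D (f ** f')) (D f') (eval_op_basis og al f' n) !(dZ f) (D f).
rewrite (linZ (ev_op_bounded f).1) (eval_op_basis og) !scalerA -!scalerDl; congr (_ *: _).
rewrite -[c01_fun (lca_mul f f') (q n)]/(f (q n) * f' (q n)).
rewrite -[c01_fun (lca_mul f f') (al n)]/(f (al n) * f' (al n)).
by ring.
Qed.

Definition diag_sec : lcHom (C01_alg R) diag_alg :=
  semid_sec _ _ _ _ _ _ _ _ (eval_diff_cont og tg dE hq) diag_sec_mul.

End PerturbedSection.


(** * Conjugation by a shift, extended to the diagonal algebra *)

Section ShiftEndomorphism.
Variables (ga : nat -> I01) (hga : near_seq ga al) (s : nat -> nat) (si : injective s).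
Hypothesis ga_s : forall n, ga (s n) = al n.
Local Notation V := (shift_iso g s).
Local Notation W := (shift_coiso g s).
Local Notation dga := (eval_diff g d ga al).

Lemma bounded_opD (K L : hilbert R) (S S' : K -> L) :
  bounded_op S -> bounded_op S' -> bounded_op (fun x => S x + S' x).
Proof.
move=> [l c] [l' c']; split; first by move=> a x y; rewrite l l' scalerDr addrACA.
by move=> x; apply: cvgD; [exact: c|exact: c'].
Qed.

Let bV : bounded_op V.
Proof. exact: opbd_bounded (shift_iso_opbd og si). Qed.

Let bW : bounded_op W.
Proof. exact: opbd_bounded (shift_coiso_opbd og si). Qed.

(** As operators, V pi_al f = pi_ga f V, because [ga (s n) = al n]; the right-hand side appears with
    pi_ga f split into pi_al f and its ideal part. *)
Lemma shift_iso_intertwines f x : V (ev_op f x) = ev_op f (V x) + bi_op (dga f) (V x).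
Proof.
have : V \o ev_op f = (fun x => (ev_op f \o V) x + (bi_op (dga f) \o V) x).
  apply: (bounded_op_eq og tg).
  - exact: bounded_op_comp bV (ev_op_bounded f).
  - apply: bounded_opD; first exact: bounded_op_comp (ev_op_bounded f) bV.
    exact: bounded_op_comp (bi_bounded _) bV.
  move=> n /=; rewrite eval_op_basis// (linZ bV.1) !shift_iso_basis//.
  by rewrite eval_op_basis// (eval_diff_basis og dE)// ga_s -scalerDl addrC subrK.
by move=> /(congr1 (@^~ x)).
Qed.

(** The companion relation pi_al f W = W pi_ga f. On basis vectors outside the image of [s] both
    sides vanish, whatever [ga] is there. *)
Lemma shift_coiso_intertwines f x :
  ev_op f (W x) = W (ev_op f x) + W (bi_op (dga f) x).
Proof.
have : ev_op f \o W = (fun x => (W \o ev_op f) x + (W \o bi_op (dga f)) x).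
  apply: (bounded_op_eq og tg).
  - exact: bounded_op_comp (ev_op_bounded f) bW.
  - apply: bounded_opD; first exact: bounded_op_comp bW (ev_op_bounded f).
    exact: bounded_op_comp bW (bi_bounded _).
  move=> m /=; rewrite eval_op_basis// (eval_diff_basis og dE)// -(linD bW.1) -scalerDl.
  rewrite addrC subrK (linZ bW.1).
  have [[n <-]|nm_] := pselect (exists n, s n = m).
    by rewrite shift_coiso_basis// eval_op_basis// ga_s.
  rewrite shift_coiso_orth ?scaler0 ?(lin0 (ev_op_bounded f).1)// => k.
  by apply/eqP => km; apply: nm_; exists k.
by move=> /(congr1 (@^~ x)).
Qed.

Let theta : JH -> JH := shift_conj J og tg si.

Let thetaE j x : bi_op (theta j) x = V (bi_op j (W x)).
Proof. exact: shift_conjE. Qed.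

Lemma shift_endo_l f j : theta (actl f j) = actl f (theta j) + dga f ** theta j.
Proof.
apply: ideal_ext => x; rewrite (opD _ (dga f ** theta j)) (opM (dga f)).
rewrite (thetaE (actl f j)) (eval_actlE og al f (theta j)) (thetaE j) (eval_actlE og al f j).
exact: shift_iso_intertwines.
Qed.

Lemma shift_endo_r f j : theta (actr f j) = actr f (theta j) + theta j ** dga f.
Proof.
apply: ideal_ext => x; rewrite (opD _ (theta j ** dga f)) (opM (theta j)).
rewrite (thetaE (actr f j)) (eval_actrE og al f (theta j)) !(thetaE j) (eval_actrE og al f j).
by rewrite shift_coiso_intertwines (linD (bi_op_lin j)) (linD bV.1).
Qed.

(** This sends pi_al f + j to pi_ga f + V j W. Plain conjugation would give V pi_al f W, which
    vanishes off the range of [V]; filling in the entries of [ga] there keeps the first component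
    equal to [f]. *)
Definition shift_endo : lcHom diag_alg diag_alg :=
  semid_endo _ _ _ _ _ _ _ _ (eval_diff_cont og tg dE hga) (diag_sec_mul hga)
    (hom_linear (shift_conj J og tg si)) shift_endo_l shift_endo_r
    (@hom_mul _ _ _ (shift_conj J og tg si)).

Lemma shift_endo_in j : shift_endo (diag_in j) = diag_in (shift_conj J og tg si j).
Proof.
rewrite [LHS]/= /semid_endo_fun /=; congr (_, _).
by rewrite (lin0 (eval_diff_cont og tg dE hga).1) add0r.
Qed.

Lemma shift_endo_sec q q' (hq : near_seq q al) (hq' : near_seq q' al) :
  (forall n, q' (s n) = q n) -> (forall m, (forall n, s n != m) -> q' m = ga m) ->
  forall f, shift_endo (diag_sec hq f) = diag_sec hq' f.
Proof.
move=> q's q'o f; rewrite [LHS]/= /semid_endo_fun /=; congr (_, _).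
have D := eval_diff_basis og dE; pose de := eval_diff g d q al f.
apply: ext => m; rewrite (opD (dga f) (theta de)) (thetaE de) (D _ _ _ _ hga) (D _ _ _ _ hq').
have [[n <-]|nm_] := pselect (exists n, s n = m).
  rewrite (shift_coiso_basis og n si) (D _ _ _ _ hq) (linZ bV.1) (shift_iso_basis og).
  rewrite -scalerDl ga_s q's; congr (_ *: _).
  by rewrite [LHS]addrC addrA subrK.
have sm n : s n != m by apply/eqP => km; apply: nm_; exists n.
by rewrite (shift_coiso_orth og sm) (lin0 (bi_op_lin _)) (lin0 bV.1) addr0 q'o.
Qed.

End ShiftEndomorphism.

Section Tensored.
Variables (E : lcFunctor R) (E_split : split_exact E) (E_M2 : m2_stable E).
Variables (A : lcAlg R) (T : ptensor A (C01_alg R)) (TJ : ptensor A JH) (TD : ptensor A diag_alg).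

Lemma fmap_tens_comp (B B' B'' : lcAlg R) (S : ptensor A B) (S' : ptensor A B')
    (S'' : ptensor A B'') (h : lcHom B' B'') (k : lcHom B B') (m : lcHom B B'') x :
  (forall b, h (k b) = m b) ->
  fmap E (ptensor_map S' S'' (lcHom_id A) h) (fmap E (ptensor_map S S' (lcHom_id A) k) x) =
  fmap E (ptensor_map S S'' (lcHom_id A) m) x.
Proof.
move=> hkm; rewrite -fmap_comp; congr (fmap E _ x); apply: lcHom_eq => z.
have : ptensor_map S' S'' (lcHom_id A) h \o ptensor_map S S' (lcHom_id A) k =
    ptensor_map S S'' (lcHom_id A) m :> (S -> S'').
  apply: (ptensor_ext (pt_univ S)).
  - by apply: cont_linear_comp; exact: hom_linear.
  - exact: hom_linear.
  move=> a b; rewrite /comp (ptensor_mapE S S') (ptensor_mapE S' S'') (ptensor_mapE S S'').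
  by rewrite hkm.
by move=> /(congr1 (@^~ z)).
Qed.

Definition tsec q (hq : near_seq q al) : lcHom T TD :=
  ptensor_map T TD (lcHom_id A) (diag_sec hq).

Lemma near_seq_refl : near_seq al al.
Proof. by exists 0 => n; rewrite subrr normr0 mul0r. Qed.

(** The right-hand side dies in [E T], so it comes from [E TJ], where the shift acts trivially, and
    [shift_endo] fixes it. On the other hand [shift_endo] carries the section of [q] to that of [q']
    and, by the same lemma, the section of [al] to that of [ga]. *)
Lemma fmap_shift_sec (s : nat -> nat) ga q q' (hga : near_seq ga al)
    (hq : near_seq q al) (hq' : near_seq q' al) x :
  injective s -> (forall n, ga (s n) = al n) -> (forall n, q' (s n) = q n) ->
  (forall m, (forall n, s n != m) -> q' m = ga m) ->
  fmap E (tsec hq') x - fmap E (tsec hga) x =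
  fmap E (tsec hq) x - fmap E (tsec near_seq_refl) x.
Proof.
move=> si gas q's q'o; pose Th := shift_endo hga si gas.
pose tp := ptensor_map TD T (lcHom_id A) diag_proj.
pose ti := ptensor_map TJ TD (lcHom_id A) diag_in.
pose tTh := ptensor_map TD TD (lcHom_id A) Th.
have [_ ex _] := E_split (split_extension_tens TJ TD T diag_split).
have tpE r (hr : near_seq r al) : fmap E tp (fmap E (tsec hr) x) = x.
  rewrite (@fmap_tens_comp _ _ _ T TD T diag_proj (diag_sec hr) (lcHom_id _) x)// -[RHS]fmap_id.
  congr (fmap E _ x); apply: lcHom_eq => z.
  have : (ptensor_map T T (lcHom_id A) (lcHom_id (C01_alg R)) : T -> T) = id.
    apply: (ptensor_ext (pt_univ T)); [exact: hom_linear|exact: lcHom_id_subproof|].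
    by move=> a b; rewrite ptensor_mapE.
  by move=> /(congr1 (@^~ z)).
have /ex[k kE] : fmap E tp (fmap E (tsec hq) x - fmap E (tsec near_seq_refl) x) = 0.
  by rewrite raddfB !tpE subrr.
rewrite -kE.
have <- : fmap E tTh (fmap E ti k) = fmap E ti k.
  have hc : forall b, Th (diag_in b) = lcHom_comp diag_in (shift_conj J og tg si) b.
    by move=> b; exact: shift_endo_in.
  rewrite (@fmap_tens_comp _ _ _ TJ TD TD Th diag_in _ k hc).
  rewrite -(@fmap_tens_comp _ _ _ TJ TJ TD diag_in (shift_conj J og tg si)
    (lcHom_comp diag_in (shift_conj J og tg si)) k (fun=> erefl)).
  by rewrite fmap_shift_conj.
rewrite kE raddfB; congr (_ - _); symmetry; apply: fmap_tens_comp.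
  exact: shift_endo_sec.
exact: shift_endo_sec.
Qed.

(** * Separating the root of the tree *)

Section Root.
Variable e : JH.
Hypothesis eE : forall z, bi_op e z = ip z (g 0%N) *: g 0%N.

Lemma corner_basis n : bi_op e (g n) = ((n == 0%N)%:R : C) *: g n.
Proof. by rewrite eE og; case: eqP => [->|_]; rewrite ?scale0r. Qed.

Lemma eval_actl_corner f : actl f e = (f (al 0%N) : C) *: e.
Proof.
apply: ext => n; rewrite (eval_actlE og al f) (bi_opZ _ e) corner_basis.
rewrite (linZ (ev_op_bounded f).1) (eval_op_basis og) !scalerA mulrC.
by case: eqP => [->|_]; rewrite ?mulr0 ?mul0r.
Qed.

Lemma eval_actr_corner f : actr f e = (f (al 0%N) : C) *: e.
Proof.
apply: ext => n; rewrite (eval_actrE og al f) (bi_opZ _ e) (eval_op_basis og).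
rewrite (linZ (bi_op_lin e)) corner_basis !scalerA.
by case: eqP => [->|_]; rewrite ?mulr0 ?mul0r.
Qed.

(** The correction that deletes the entry at [g 0] from pi_al f, so that [chi_sec] is pi_al f cut
    down by [1 - e]. *)
Definition chi_diff (f : C01_alg R) : JH := - ((f (al 0%N) : C) *: e).

Lemma chi_diff_cont : cont_linear chi_diff.
Proof.
apply: cont_linearN; split.
  move=> c f f'; rewrite scalerA -scalerDl; congr (_ *: _).
move=> f; apply: (@continuous_comp _ _ _ (fun f : C01 R => f (al 0%N) : C^o) (fun c : C^o => c *: e)).
  exact: c01_eval_continuous.
exact: scalel_continuous.
Qed.

Lemma chi_diff_mul f f' : chi_diff (f ** f') =
  actl f (chi_diff f') + actr f' (chi_diff f) + chi_diff f ** chi_diff f'.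
Proof.
have [l1 _ _] := eval_actl_bilinear J og tg al.
have [r1 _ _] := eval_actr_bilinear J og tg al.
rewrite /chi_diff (linN (l1 f)) (linN (r1 f')) (linZ (l1 f)) (linZ (r1 f')).
rewrite eval_actl_corner eval_actr_corner lca_mulNl lca_mulNr opprK lca_mulZl lca_mulZr.
rewrite (corner_idem og eE) !scalerA [f' _ * f _]mulrC addrNK.
by rewrite -[c01_fun (lca_mul f f') _]/(f (al 0%N) * f' (al 0%N)).
Qed.

Definition chi_sec : lcHom (C01_alg R) diag_alg :=
  semid_sec _ _ _ _ _ _ _ _ chi_diff_cont chi_diff_mul.

Lemma diag_corner_idem : (diag_in e : diag_alg) ** diag_in e = diag_in e.
Proof. by rewrite -hom_mul (corner_idem og eE). Qed.

Lemma chi_sec_corner f : chi_sec f ** diag_in e = 0.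
Proof.
rewrite [LHS]semid_mulE lca_mul0r; congr (_, _).
rewrite eval_actl_corner (semid_0r (eval_actr_bilinear J og tg al)) addr0 /chi_diff.
by rewrite lca_mulNl lca_mulZl (corner_idem og eE) subrr.
Qed.

Lemma corner_chi_sec f : diag_in e ** chi_sec f = 0.
Proof.
rewrite [LHS]semid_mulE lca_mul0l; congr (_, _).
rewrite eval_actr_corner (semid_0l (eval_actl_bilinear J og tg al)) add0r /chi_diff.
by rewrite lca_mulNr lca_mulZr (corner_idem og eE) subrr.
Qed.

Lemma diag_sec_root q (hq : near_seq q al) : (forall n, (0 < n)%N -> q n = al n) ->
  forall f, diag_sec hq f = chi_sec f + (f (q 0%N) : C) *: diag_in e.
Proof.
move=> qa f; apply/pair_equal_spec; split; first by rewrite /= scaler0 addr0.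
rewrite [LHS]/= [RHS]/=; apply: ext => n.
rewrite (eval_diff_basis og dE)// (opD (chi_diff f)) /chi_diff -scaleNr !bi_opZ corner_basis.
rewrite !scalerA -!scalerDl; congr (_ *: _).
case: n => [|n]; first by rewrite addrC scaler1.
by rewrite qa// subrr scaler0.
Qed.

(** [fmap_orthogonal] for the decomposition in [diag_sec_root]: only the second summand sees the
    root value [q 0]. *)
Lemma fmap_tsec_root q (hq : near_seq q al) x : (forall n, (0 < n)%N -> q n = al n) ->
  fmap E (tsec hq) x = fmap E (ptensor_map T TD (lcHom_id A) chi_sec) x +
    fmap E (tens_idem TD diag_corner_idem) (fmap E (ev_hom T (q 0%N)) x).
Proof.
move=> qa; have [t1 t2 _] := (pt_univ TD).1.
set tchi := ptensor_map _ _ _ chi_sec; set rho := tens_idem _ _.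
have tchiE a f : tchi (pt_tens T a f) = pt_tens TD a (chi_sec f) by rewrite /tchi ptensor_mapE.
have rhoE a : rho a = pt_tens TD a (diag_in e) by [].
apply: (fmap_orthogonal E_split).
- move=> z a.
  have : (fun z => tchi z ** rho a) = (fun=> 0).
    apply: (ptensor_ext (pt_univ T)).
    + exact: (cont_linear_comp (lca_mulr_cont (rho a)) (hom_linear tchi)).
    + exact: cont_linear0.
    by move=> b f; rewrite tchiE rhoE pt_mul chi_sec_corner (lin0 (t1 _)).
  by move=> /(congr1 (@^~ z)).
- move=> z a.
  have : (fun z => rho a ** tchi z) = (fun=> 0).
    apply: (ptensor_ext (pt_univ T)).
    + exact: (cont_linear_comp (lca_mull_cont (rho a)) (hom_linear tchi)).
    + exact: cont_linear0.
    by move=> b f; rewrite tchiE rhoE pt_mul corner_chi_sec (lin0 (t1 _)).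
  by move=> /(congr1 (@^~ z)).
move=> z.
have : (tsec hq : T -> TD) = (fun z => tchi z + rho (ev_hom T (q 0%N) z)).
  apply: (ptensor_ext (pt_univ T)); first exact: hom_linear.
    apply: cont_linearD; first exact: hom_linear.
    exact: (cont_linear_comp (hom_linear rho) (hom_linear _)).
  move=> a f; rewrite tchiE rhoE [tsec hq _]ptensor_mapE [ev_hom T _ _]ptensor_liftE.
  rewrite (diag_sec_root hq qa) (linD (t1 a)) (linZ (t1 a)); congr (_ + _).
  by rewrite /ev_bilin (linZ (t2 (diag_in e))).
by move=> /(congr1 (@^~ z)).
Qed.

Lemma fmap_diag_corner_inj : injective (fmap E (ptensor_map TJ TD (lcHom_id A) diag_in)).
Proof. by have [] := E_split (split_extension_tens TJ TD T diag_split). Qed.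

Lemma fmap_diag_corner x : fmap E (tens_idem TD diag_corner_idem) x =
  fmap E (ptensor_map TJ TD (lcHom_id A) diag_in) (fmap E (tens_idem TJ (corner_idem og eE)) x).
Proof.
rewrite -fmap_comp; congr (fmap E _ x); apply: lcHom_eq => a.
rewrite -[RHS]/(ptensor_map TJ TD (lcHom_id A) diag_in (pt_tens TJ a e)).
by rewrite ptensor_mapE.
Qed.

Lemma fmap_ev_corner (be mi : nat -> I01) :
  (forall n, [/\ al n.*2.+1 = al n, be n.*2.+1 = mi n,
                 al n.*2.+2 = mi n & be n.*2.+2 = be n]) ->
  (forall n, `|\val (be n) - \val (al n)| <= 2 / n.+1%:R /\
             `|\val (mi n) - \val (al n)| <= 2 / n.+1%:R) ->
  forall x, fmap E (tens_idem TJ (corner_idem og eE)) (fmap E (ev_hom T (be 0%N)) x) =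
            fmap E (tens_idem TJ (corner_idem og eE)) (fmap E (ev_hom T (al 0%N)) x).
Proof.
move=> ch near x.
have near_be : near_seq be al by exists 2 => n; have [] := near n.
have near_mi : near_seq mi al by exists 2 => n; have [] := near n.
(* [g0] is [al] with its root moved. [g2] is [al] transported by the right shift and [be] off its
   image. [g1] is [mi] transported by the left shift with [g0] off the image, and equally by the
   right shift with [g2] off the image. *)
pose g0 n := if n == 0%N then be 0%N else al n.
pose g1 n := if (n == 0%N) || odd n then be n else al n.
pose g2 n := if (n == 0%N) || odd n then be n else al n./2.-1.
have div_ge0 (k : R) n : 0 <= k -> 0 <= k / n.+1%:R by move=> k0; rewrite divr_ge0.
have near_g0 : near_seq g0 al.
  by exists 2 => -[|n]; rewrite /g0 /=; [have [] := near 0%N|rewrite subrr normr0 div_ge0].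
have near_g1 : near_seq g1 al.
  exists 2 => n; rewrite /g1; case: ifP => _; first by have [] := near n.
  by rewrite subrr normr0 div_ge0.
have near_g2 : near_seq g2 al.
  (* At index [2m + 2] the sequence [g2] has the value [al m] and [al] has the value [mi m]. They
     differ by at most [2 / (m + 1)], which is at most [6 / (2m + 3)]. *)
  exists 6 => n; rewrite /g2; case: ifP => [_|].
    have [/le_trans h _] := near n; apply: h.
    by rewrite ler_pM2r ?invr_gt0// ler_nat.
  case: n => // n /negbT; rewrite negb_or /= negbK => on.
  have -> : n.+1 = n./2.*2.+2 by rewrite -[in LHS](odd_double_half n) on.
  have [_ _ -> _] := ch n./2; rewrite uphalf_half on distrC.
  have [_ /le_trans h] := near n./2; apply: h.
  rewrite ler_pdivrMr// mulrAC ler_pdivlMr// -!natrM ler_nat.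
  by rewrite -mul2n; lia.
have i1 : injective (fun n => n.*2.+1) by move=> m n [] /double_inj.
have i2 : injective (fun n => n.*2.+2) by move=> m n [] /double_inj.
have odd_hit n : odd n -> n./2.*2.+1 = n by move=> on; rewrite -[RHS](odd_double_half n) on.
have even_hit n : (n != 0)%N -> ~~ odd n -> n./2.-1.*2.+2 = n.
  by move=> n0 on; rewrite -[RHS](odd_double_half n) (negbTE on); case: n n0 on => [//|[|n]].
have h1 : fmap E (tsec near_g1) x - fmap E (tsec near_g0) x =
    fmap E (tsec near_mi) x - fmap E (tsec near_seq_refl) x.
  apply: (@fmap_shift_sec (fun n => n.*2.+1) _ _ _ _ _ _ _ i1) => n.
  - by rewrite /g0 /=; have [] := ch n.
  - by rewrite /g1 /= odd_double; have [] := ch n.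
  move=> hn; rewrite /g1 /g0; case: eqP => [->//|_] /=; case: ifP => // on.
  by have := hn n./2; rewrite odd_hit// eqxx.
have h2 q q' (hq : near_seq q al) (hq' : near_seq q' al) : (forall n, q' n.*2.+2 = q n) ->
    (forall n, (n == 0%N) || odd n -> q' n = be n) ->
    fmap E (tsec hq') x - fmap E (tsec near_g2) x =
    fmap E (tsec hq) x - fmap E (tsec near_seq_refl) x.
  move=> qq' qbe; apply: (@fmap_shift_sec (fun n => n.*2.+2) _ _ _ _ _ _ _ i2) => // n.
    by rewrite /g2 /= odd_double /= doubleK.
  rewrite /g2; case: ifP => [n0 _|]; first exact: qbe.
  move=> /negbT; rewrite negb_or => /andP[n0 on] /(_ n./2.-1).
  by rewrite even_hit// eqxx.
have h3 : fmap E (tsec near_g1) x - fmap E (tsec near_g2) x =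
    fmap E (tsec near_mi) x - fmap E (tsec near_seq_refl) x.
  apply: h2 => n; first by rewrite /g1 /= odd_double; have [] := ch n.
  by rewrite /g1 => ->.
(* The right shift carries [be] to itself; cancelling it shows that the classes of [g2] and [al]
   agree. *)
have h4 : fmap E (tsec near_be) x - fmap E (tsec near_g2) x =
    fmap E (tsec near_be) x - fmap E (tsec near_seq_refl) x.
  by apply: h2 => // n; have [] := ch n.
(* Once [g2] is replaced by [al], the equations [h1] and [h3] share their right-hand side and their
   first term. *)
have h5 : fmap E (tsec near_g0) x = fmap E (tsec near_seq_refl) x.
  move: h3; move: h4 => /addrI /oppr_inj ->; rewrite -h1 => /addrI /oppr_inj.
  by [].
apply: fmap_diag_corner_inj; rewrite -!fmap_diag_corner.
move: h5; rewrite fmap_tsec_root; last by case.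
by rewrite [in RHS]fmap_tsec_root// => /addrI.
Qed.

End Root.

End Tensored.

End DiagonalAlgebra.
End DiffotopyInvariance.

Theorem theorem4p2p1 (R : realType) (E : lcFunctor R) (J : banachIdeal R)
    (E_split : split_exact E) (E_M2 : m2_stable E)
    (J_harmonic : harmonic_ideal J) (E_J : weakly_stable J E) :
  diffotopy_invariant E.
Proof.
move=> A T s t x; have [H [p [pp [phi [pmin _ phiE]]]]] := E_J.
have [g [og tg]] := orthonormal_basis_exists H.
have [d dE] := harmonic_diag J_harmonic og tg.
(* [d] has eigenvalue 1 at [g 0], so cutting it down to that line yields the projection itself as an
   element of the ideal. *)
have [e eE] : exists e : ideal_alg J H, forall z, bi_op e z = ip z (g 0%N) *: g 0%N.
  have b1 := rank1_opbd (g 0%N) (g 0%N); exists (lract (rank1 (g 0%N) (g 0%N)) id d).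
  suff hb : bi_op (lract (rank1 (g 0%N) (g 0%N)) id d) = rank1 (g 0%N) (g 0%N).
    by move=> z; rewrite hb.
  apply: (bounded_op_eq og tg (bi_bounded _) (opbd_bounded b1)) => n.
  rewrite (lractE _ _ b1 (opbd_id H)) dE /rank1 ipZl og.
  by case: eqP => [->|_]; rewrite ?mulr0// invr1 mul1r.
have [al [be [mi [al0 be0 ch near]]]] := dyadic_intervals s t.
pose D := diag_alg J og tg al.
(* Only the existence of these models is retained; from here on their universal property
   suffices. *)
have [TJ _] : exists TJ : ptensor A (ideal_alg J H), True by exists (ptens A (ideal_alg J H)).
have [TD _] : exists TD : ptensor A D, True by exists (ptens A D).
rewrite -(phiE A TJ (fmap E (ev_hom T s) x)) -(phiE A TJ (fmap E (ev_hom T t) x)).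
congr (phi A TJ _); rewrite !(fmap_minimal_idempotent og tg eE)//.
by rewrite -al0 -be0 (fmap_ev_corner dE E_split E_M2 TJ TD eE ch near).
Qed.
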